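(* Let $M^n$ be a closed manifold and $F:M^n\times[0,T)\to\mathbb{R}^{n+1}$ a family of smooth embeddings evolving by the rescaled mean curvature flow, with positive rescaled mean curvature (respectively, negative rescaled mean curvature). If $\widetilde M_0=F(M,0)$ is rescaled-$\delta$-non-collapsed (respectively, rescaled-$(-\delta)$-non-collapsed) for some $\delta>0$, then $\widetilde M_t=F(M,t)$ is also rescaled-$\delta$-non-collapsed (respectively, rescaled-$(-\delta)$-non-collapsed) for every $t\in[0,T)$.
   Context: For a closed embedded hypersurface in $\mathbb{R}^{n+1}$, $\mathbf{n}$ is the unit normal pointing to the unbounded component of the complement, $H=\operatorname{div}\mathbf{n}$ is the mean curvature (positive on round spheres), and $\widetilde H=H-\frac{\langle x,\mathbf{n}\rangle}{2}$ is the rescaled mean curvature. The hypersurface is rescaled mean convex if $\widetilde H>0$ and rescaled mean concave if $\widetilde H<0$. $F$ evolves by rescaled mean curvature flow if $\partial_tF(x,t)=-\widetilde H(x,t)\,\mathbf{n}(x,t)$. Let $\Omega$ be the bounded open region enclosed by a closed embedded hypersurface $M$. Given $\delta>0$, a rescaled mean convex $M$ is rescaled-$\delta$-non-collapsed if for every $x\in M$ there is an open ball $B\subset\Omega$ of radius $\delta/\widetilde H(x)$ with $x\in\partial B$. Given $\delta<0$, a rescaled mean concave $M$ is rescaled-$\delta$-non-collapsed if for every $x\in M$ there is an open ball $B\subset\Omega$ of radius $\delta/\widetilde H(x)$ (a positive number) with $x\in\partial B$. *)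

(* Defs.v *)
From HB Require Import structures.
From mathcomp Require Import all_boot all_order all_algebra.
From mathcomp Require Import all_classical all_reals all_analysis.
Set Implicit Arguments.
Unset Strict Implicit.
Unset Printing Implicit Defensive.
Import Order.TTheory GRing.Theory Num.Theory.
Import numFieldNormedType.Exports.
Local Open Scope classical_set_scope.
Local Open Scope ring_scope.

Section Smoothness.
Context {R : realType} {V W : normedModType R}.

Fixpoint Ck (k : nat) (U : set V) (f : V -> W) : Prop :=
  match k with
  | 0 => forall x, U x -> {for x, continuous f}
  | k'.+1 => (forall x, U x -> differentiable f x) /\
             (forall v, Ck k' U (fun x => 'D_v f x))
  end.

(* On an arbitrary set A, f is smooth when it is locally the restriction of a
   C^infinity map defined on an open set; values of f outside A are
   irrelevant. This covers smoothness up to the boundary t = 0 of [0, T). *)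
Definition smooth_on (A : set V) (f : V -> W) :=
  forall a, A a -> exists (U : set V) (g : V -> W),
    [/\ open U, U a, (forall k, Ck k U g) &
        forall x, A x -> U x -> f x = g x].

End Smoothness.

Section Euclidean.
Context {R : realType} {m : nat}.
Implicit Types u v c x : 'rV[R]_m.

(* The library norm on 'rV[R]_m is the sup norm; it induces the same topology
   and bounded sets, but orthogonality and round balls need these. *)
Definition dot u v : R := \sum_i u 0 i * v 0 i.
Definition enorm u : R := Num.sqrt (dot u u).
Definition eball c (r : R) : set 'rV[R]_m := [set x | enorm (x - c) < r].

Definition frontier (A : set 'rV[R]_m) : set 'rV[R]_m := closure A `\` A°.

End Euclidean.

Record chart (R : realType) (n : nat) (M : topologicalType) := Chart {
  chart_dom : set M;
  chart_cod : set 'rV[R]_n;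
  chart_map : M -> 'rV[R]_n;
  chart_inv : 'rV[R]_n -> M;
  chart_dom_open : open chart_dom;
  chart_cod_open : open chart_cod;
  chart_map_dom : forall p, chart_dom p -> chart_cod (chart_map p);
  chart_inv_cod : forall x, chart_cod x -> chart_dom (chart_inv x);
  chart_mapK : forall p, chart_dom p -> chart_inv (chart_map p) = p;
  chart_invK : forall x, chart_cod x -> chart_map (chart_inv x) = x;
  chart_map_continuous : {within chart_dom, continuous chart_map};
  chart_inv_continuous : {within chart_cod, continuous chart_inv}
}.

(* Second countability is implied by compactness and the charts. *)
Record closedManifold (R : realType) (n : nat) := ClosedManifold {
  manifold_space :> topologicalType;
  atlas : set (chart R n manifold_space);
  manifold_compact : compact [set: manifold_space];
  manifold_hausdorff : hausdorff_space manifold_space;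
  atlas_cover : forall p, exists2 c, atlas c & chart_dom c p;
  atlas_smooth : forall c d, atlas c -> atlas d ->
    smooth_on (chart_map c @` (chart_dom c `&` chart_dom d))
              (chart_map d \o chart_inv c)
}.

Section Hypersurface.
Context {R : realType} {n : nat} {M : closedManifold R n}.
Implicit Types (f : M -> 'rV[R]_n.+1) (X : M -> 'rV[R]_n.+1) (p : M).

Definition chart_at p : chart R n M := sval (cid2 (atlas_cover p)).

Definition smooth_map f :=
  forall c, atlas c -> smooth_on (chart_cod c) (f \o chart_inv c).

Definition immersion f :=
  forall c, atlas c -> forall x, chart_cod c x ->
    injective ('d (f \o chart_inv c) x).

Definition topological_embedding f :=
  injective f /\
  forall U : set M, open U <-> exists2 V, open V & U = f @^-1` V.

Definition smooth_embedding f :=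
  [/\ smooth_map f, immersion f & topological_embedding f].

Definition exterior f : set 'rV[R]_n.+1 :=
  [set x | (~` range f) x /\
           ~ bounded_set (connected_component (~` range f) x)].

Definition enclosed f : set 'rV[R]_n.+1 :=
  [set x | (~` range f) x /\
           bounded_set (connected_component (~` range f) x)].

Definition normal_vector f p (v : 'rV[R]_n.+1) :=
  forall c, atlas c -> chart_dom c p ->
    forall w, dot v ('d (f \o chart_inv c) (chart_map c p) w) = 0.

Definition outward_unit_normal f p (v : 'rV[R]_n.+1) :=
  [/\ enorm v = 1, normal_vector f p v &
      \forall s \near (0 : R)^'+, exterior f (f p + s *: v)].

(* Definite description: the value is 0 unless exactly one of the two unit
   normals at p points into the unbounded component of the complement. *)
Definition unit_normal f p : 'rV[R]_n.+1 :=
  xget 0 [set v | unique (outward_unit_normal f p) v].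

(* Tangential divergence g^{ij} <d_i X, d_j f>: the rows of the Jacobians
   (library convention) are the partial derivatives d_i X and d_j f in the
   chart, so that g = Jf *m Jf^T. It does not depend on the chart. *)
Definition surface_div f X p : R :=
  let c := chart_at p in
  let x := chart_map c p in
  let Jf := 'J (f \o chart_inv c) x in
  let JX := 'J (X \o chart_inv c) x in
  \tr (invmx (Jf *m Jf^T) *m (JX *m Jf^T)).

Definition mean_curvature f p : R := surface_div f (unit_normal f) p.

Definition rescaled_mean_curvature f p : R :=
  mean_curvature f p - dot (f p) (unit_normal f p) / 2.

Definition rescaled_mean_convex f := forall p, 0 < rescaled_mean_curvature f p.
Definition rescaled_mean_concave f := forall p, rescaled_mean_curvature f p < 0.

Definition rescaled_noncollapsed (delta : R) f :=
  (0 < delta /\ rescaled_mean_convex f \/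
   delta < 0 /\ rescaled_mean_concave f) /\
  forall p, exists c : 'rV[R]_n.+1,
    let B := eball c (delta / rescaled_mean_curvature f p) in
    B `<=` enclosed f /\ frontier B (f p).

Definition time_interval (T : \bar R) : set R :=
  [set t | 0 <= t /\ (t%:E < T)%E].

(* Only times in [0, T) matter; the time derivative is one-sided at t = 0. *)
Definition rescaled_MCF (T : \bar R) (F : M -> R -> 'rV[R]_n.+1) :=
  [/\ forall c, atlas c ->
        smooth_on (chart_cod c `*` time_interval T)
                  (fun z => F (chart_inv c z.1) z.2),
      forall t, time_interval T t -> smooth_embedding (F ^~ t) &
      forall p t, time_interval T t ->
        (fun h : R => h^-1 *: (F p (t + h) - F p t))
          @ within [set h | time_interval T (t + h)] (0 : R)^'
        --> - (rescaled_mean_curvature (F ^~ t) p *: unit_normal (F ^~ t) p)].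

End Hypersurface.

(* Main.v *)
(* Write n for the outward normal, k for the absolute value of the rescaled mean
   curvature divided by delta, and d = F(y,t) - F(x,t).  The ball of radius 1/k
   touching the hypersurface from inside at x is enclosed for every x if and only
   if psi(x,y,t) = k(x,t) |d|^2 + 2 <d, n(x,t)> is nonnegative, and this is
   preserved by Andrews' two-point maximum principle.  At a spatial minimum with
   psi = -s for a small s > 0 one has k d + n(x) = rho n(y) with rho > 0, and the
   second variation of psi, summed over the directions (P_x e, P_y e) where e runs
   over the standard basis of R^(n+1) and P_x, P_y are the projections onto the
   tangent spaces, gives together with the evolution equations
     d_t n = grad H,  d_t H = Delta H + |A|^2 H + H/2 - <F, grad H>/2
   (H the rescaled mean curvature) the inequality
     d_t psi >= k |d|^2 + psi (|A|^2 + 1/2 + 2 k <grad k, d> / rho^2).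
   For C large this excludes a first zero of psi + eta exp(C t).  No separate
   discussion of the diagonal is needed, since psi = 0 there.

   As d_t F = - H n and H has a fixed sign, both H and n are smooth functions of
   d_t F.  No separation theorem is used: that the inner side of the hypersurface
   is enclosed follows from the uniqueness of the outward unit normal, which holds
   wherever H is nonzero. *)
From HB Require Import structures.
Require Import Defs.
From mathcomp Require Import all_boot all_order all_algebra.
From mathcomp Require Import all_classical all_reals all_analysis.
From mathcomp Require Import perm ring lra.
Set Implicit Arguments.
Unset Strict Implicit.
Unset Printing Implicit Defensive.
Import Order.TTheory GRing.Theory Num.Theory.
Import numFieldNormedType.Exports.
Local Open Scope classical_set_scope.
Local Open Scope ring_scope.

(** * Calculus for vector-valued maps *)

(** Summing over the projected standard basis avoids orthonormal frames and any comparison of the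
    two tangent planes: P_y e - P_x e = <n(x), e> n(x) - <n(y), e> n(y), so the first variations of
    d are expressed through the two normals alone, and k d + n(x) = rho n(y) then removes n(y).
    Squaring this relation gives rho^2 = 1 + k psi, so 1/rho^2 is at most 2 once psi is close to 0.
    As |A|, grad k and d are bounded on a compact time interval, the coefficient of psi is bounded
    by a constant.

    The sign of H enters through a factor sg = 1 or -1 and kappa = sg / delta, so that k = kappa H
    is positive in both cases and one argument serves them.

    The flow is smooth up to t = 0 only in the sense of local extensions. Hence continuity and
    compactness are used on [0, t1], with time clipped to that interval, while the two-point
    inequality is used at positive times only: a first zero has positive time because the perturbed
    function is positive at t = 0. *)

Section Dot.
Context {R : realType} {m : nat}.
Implicit Types u v w : 'rV[R]_m.

Lemma dotE u v : dot u v = (u *m v^T) 0 0.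
Proof. by rewrite mxE; apply: eq_bigr => i _; rewrite mxE. Qed.

Lemma mul_row_tr u v : u *m v^T = (dot u v)%:M.
Proof. by rewrite [LHS]mx11_scalar dotE. Qed.

Lemma dotC u v : dot u v = dot v u.
Proof. by apply: eq_bigr => i _; rewrite mulrC. Qed.

Lemma dotDl u v w : dot (u + v) w = dot u w + dot v w.
Proof. by rewrite -big_split; apply: eq_bigr => i _; rewrite mxE mulrDl. Qed.

Lemma dotDr u v w : dot u (v + w) = dot u v + dot u w.
Proof. by rewrite dotC dotDl !(dotC u). Qed.

Lemma dotZl a u v : dot (a *: u) v = a * dot u v.
Proof. by rewrite mulr_sumr; apply: eq_bigr => i _; rewrite mxE mulrA. Qed.

Lemma dotZr a u v : dot u (a *: v) = a * dot u v.
Proof. by rewrite dotC dotZl dotC. Qed.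

Lemma dotNl u v : dot (- u) v = - dot u v.
Proof. by rewrite -scaleN1r dotZl mulN1r. Qed.

Lemma dotNr u v : dot u (- v) = - dot u v.
Proof. by rewrite dotC dotNl dotC. Qed.

Lemma dotBl u v w : dot (u - v) w = dot u w - dot v w.
Proof. by rewrite dotDl dotNl. Qed.

Lemma dotBr u v w : dot u (v - w) = dot u v - dot u w.
Proof. by rewrite dotDr dotNr. Qed.

Lemma dot0l v : dot 0 v = 0.
Proof. by rewrite -(scale0r 0) dotZl mul0r. Qed.

Lemma dot0r v : dot v 0 = 0.
Proof. by rewrite dotC dot0l. Qed.

Lemma dot_sumr I (r : seq I) (P : pred I) (f : I -> 'rV[R]_m) u :
  dot u (\sum_(i <- r | P i) f i) = \sum_(i <- r | P i) dot u (f i).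
Proof. exact: (big_morph _ (dotDr u) (dot0r u)). Qed.

Lemma dot_ge0 u : 0 <= dot u u.
Proof. by apply: sumr_ge0 => i _; rewrite -expr2 sqr_ge0. Qed.

Lemma dot_eq0 u : (dot u u == 0) = (u == 0).
Proof.
apply/eqP/eqP => [/psumr_eq0P u0|->]; last exact: dot0l.
apply/rowP => i; rewrite mxE; apply/eqP; rewrite -sqrf_eq0 expr2.
by apply/eqP/u0 => // j _; rewrite -expr2 sqr_ge0.
Qed.

Lemma sqr_enorm u : enorm u ^+ 2 = dot u u.
Proof. by rewrite sqr_sqrtr// dot_ge0. Qed.

Lemma enorm_ge0 u : 0 <= enorm u.
Proof. exact: sqrtr_ge0. Qed.

Lemma enormZ a u : enorm (a *: u) = `|a| * enorm u.
Proof. by rewrite /enorm dotZl dotZr mulrA -expr2 sqrtrM ?sqr_ge0// sqrtr_sqr. Qed.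

Lemma enorm_eq0 u : (enorm u == 0) = (u == 0).
Proof. by rewrite -sqrf_eq0 sqr_enorm dot_eq0. Qed.

End Dot.

Section Derivatives.
Context {R : realType} {V : normedModType R}.

Lemma is_derive_rVP m (f : V -> 'rV[R]_m) (df : 'rV[R]_m) x v :
  (forall i, is_derive x v (fun z => f z 0 i) (df 0 i)) <-> is_derive x v f df.
Proof.
split=> [h|[hd <-]].
  have df' : derivable f x v.
    by apply/derivable_mxP => i j; rewrite ord1; case: (h j).
  apply: DeriveDef => //; rewrite (derive_mx df').
  by apply/rowP => j; rewrite mxE; case: (h j).
move=> i; apply: DeriveDef; first by move/derivable_mxP : hd; exact.
by rewrite (derive_mx hd) mxE.
Qed.

Lemma is_derive_dot m (f g : V -> 'rV[R]_m) (df dg : 'rV[R]_m) x v :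
  is_derive x v f df -> is_derive x v g dg ->
  is_derive x v (fun z => dot (f z) (g z)) (dot df (g x) + dot (f x) dg).
Proof.
move=> /is_derive_rVP hf /is_derive_rVP hg.
have -> : (fun z => dot (f z) (g z)) =
    \sum_(i < m) (fun z => f z 0 i * g z 0 i).
  by apply/funext => z; rewrite fct_sumE.
have -> : dot df (g x) + dot (f x) dg =
    \sum_i (f x 0 i *: dg 0 i + g x 0 i *: df 0 i).
  rewrite addrC /dot -big_split; apply: eq_bigr => i _ /=.
  by rewrite [g x 0 i *: _]mulrC.
apply: is_derive_sum => i; exact: is_deriveM.
Qed.

Lemma is_derive_smul m (a : V -> R) (f : V -> 'rV[R]_m) da (df : 'rV[R]_m) x v :
  is_derive x v a da -> is_derive x v f df ->
  is_derive x v (fun z => a z *: f z) (da *: f x + a x *: df).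
Proof.
move=> ha /is_derive_rVP hf; apply/is_derive_rVP => i.
have -> : (fun z => (a z *: f z) 0 i) = a * (fun z => f z 0 i).
  by apply/funext => z; rewrite mxE.
apply: is_derive_eq; rewrite !mxE addrC; congr (_ + _).
exact: mulrC.
Qed.

Lemma differentiable_rVP m (f : V -> 'rV[R]_m) x :
  (forall i, differentiable (fun z => f z 0 i) x) <-> differentiable f x.
Proof.
split=> [h|h i]; last first.
  have := @differentiable_comp _ _ _ _ f (fun M : 'rV[R]_m => M 0 i) x h.
  by apply; exact: differentiable_coord.
have -> : f = \sum_(i < m) (fun z => f z 0 i *: delta_mx 0 i).
  by apply/funext => z; rewrite fct_sumE [LHS]row_sum_delta.
by apply: differentiable_sum => i; exact: differentiableZl.
Qed.

End Derivatives.

Section CkTheory.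
Context {R : realType} {V : normedModType R}.

Lemma derive_eq_on {W : normedModType R} (U : set V) (f g : V -> W) v x :
  open U -> (forall z, U z -> f z = g z) -> U x -> 'D_v f x = 'D_v g x.
Proof.
move=> oU fg Ux; apply: near_eq_derive.
by apply: filterS (open_nbhs_nbhs (conj oU Ux)) => z; exact: fg.
Qed.

Lemma differentiable_eq_near {W : normedModType R} (f g : V -> W) x :
  (\near x, f x = g x) -> differentiable f x -> differentiable g x.
Proof.
move=> fg /diff_locallyP[cf ef].
have key : g \o shift x = cst (g x) + 'd f x +o_ 0 id.
  apply/eqaddoP => e e0; have /eqaddoP/(_ _ e0) := ef.
  have : \forall y \near 0, f (y + x) = g (y + x).
    by move: fg; rewrite (near_shift 0) subr0.
  apply: filterS2 => y; rewrite !fctE /= => ->.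
  by rewrite -(nbhs_singleton fg).
by apply/diff_locallyP; rewrite (diff_unique cf key).
Qed.

Lemma differentiable_eq_on {W : normedModType R} (U : set V) (f g : V -> W) x :
  open U -> (forall z, U z -> f z = g z) -> U x ->
  differentiable f x -> differentiable g x.
Proof.
move=> oU fg Ux; apply: differentiable_eq_near.
by apply: filterS (open_nbhs_nbhs (conj oU Ux)) => z; exact: fg.
Qed.

Lemma Ck_ext {W : normedModType R} k (U : set V) (f g : V -> W) :
  open U -> (forall z, U z -> f z = g z) -> Ck k U f -> Ck k U g.
Proof.
move=> oU; elim: k f g => [|k IH] f g fg /=.
  move=> cf x Ux; have /= := cf x Ux; rewrite /prop_for /continuous_at (fg x)//.
  have fgx : {near x, f =1 g}.
    by apply: filterS (open_nbhs_nbhs (conj oU Ux)) => z /fg.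
  exact: cvg_trans (near_eq_cvg fgx).
move=> [df cf]; split=> [x Ux|v].
  exact: differentiable_eq_on oU fg Ux (df x Ux).
apply: IH (cf v) => z Uz; exact: derive_eq_on oU fg Uz.
Qed.

Lemma CkW {W : normedModType R} k (U : set V) (f : V -> W) :
  Ck k.+1 U f -> Ck k U f.
Proof.
elim: k f => [|k IH] f /= [df cf].
  by move=> x Ux; exact: differentiable_continuous (df x Ux).
by split=> // v; apply: IH.
Qed.

Lemma Ck_sub {W : normedModType R} k (U U' : set V) (f : V -> W) :
  U' `<=` U -> Ck k U f -> Ck k U' f.
Proof.
move=> UU'; elim: k f => [|k IH] f /=; first by move=> h x /UU'; exact: h.
by move=> [df cf]; split=> [x /UU'|v]; [exact: df|exact: IH].
Qed.

Lemma CkD {W : normedModType R} k (U : set V) (f g : V -> W) :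
  open U -> Ck k U f -> Ck k U g -> Ck k U (f + g).
Proof.
move=> oU; elim: k f g => [|k IH] f g /=.
  by move=> cf cg x Ux; apply: continuousD; [exact: cf|exact: cg].
move=> [df cf] [dg cg]; split=> [x Ux|v].
  by apply: differentiableD; [exact: df|exact: dg].
apply: (Ck_ext oU _ (IH _ _ (cf v) (cg v))) => z Uz.
by rewrite deriveD//; apply: diff_derivable; [exact: df|exact: dg].
Qed.

Lemma CkM k (U : set V) (f g : V -> R) :
  open U -> Ck k U f -> Ck k U g -> Ck k U (f * g).
Proof.
move=> oU; elim: k f g => [|k IH] f g /=.
  by move=> cf cg x Ux; apply: continuousM; [exact: cf|exact: cg].
(* The product rule involves f and g themselves, so both are also kept at the lower order k. *)
move=> /[dup] /CkW cf' [df cf] /[dup] /CkW cg' [dg cg]; split=> [x Ux|v].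
  by apply: differentiableM; [exact: df|exact: dg].
apply: (Ck_ext oU _ (CkD oU (IH _ _ cf' (cg v)) (IH _ _ cg' (cf v)))) => z Uz.
by rewrite deriveM//; apply: diff_derivable; [exact: df|exact: dg].
Qed.

Lemma Ck_cst {W : normedModType R} k (U : set V) (a : W) :
  Ck k U (cst a : V -> W).
Proof.
elim: k a => [|k IH] a /=; first by move=> x _; exact: cst_continuous.
split=> [x _|v]; first exact: differentiable_cst.
by have -> : (fun x : V => 'D_v (cst a) x) = cst 0 by
  apply/funext => x; rewrite derive_cst.
Qed.

Lemma Ck_sum k (U : set V) I (r : seq I) (P : pred I) (f : I -> V -> R) :
  open U -> (forall i, Ck k U (f i)) -> Ck k U (\sum_(i <- r | P i) f i).
Proof.
move=> oU h; elim/big_rec : _ => [|i g _]; first exact: Ck_cst.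
exact: CkD.
Qed.

(** The derivative of 1/f is -f' (1/f)^2, whose factors 1/f are C^k by induction. *)
Lemma CkV k (U : set V) (f : V -> R) :
  open U -> (forall z, U z -> f z != 0) -> Ck k U f ->
  Ck k U (fun z => (f z)^-1).
Proof.
move=> oU f0; elim: k => [|k IH] /=.
  by move=> cf x Ux; apply: (@continuousV _ _ f); [exact: f0|exact: cf].
move=> /[dup] /CkW cf' [df cf]; split=> [x Ux|v].
  by apply: differentiableV; [exact: df|exact: f0].
have c := CkM oU (CkM oU (@Ck_cst R k U (-1)) (cf v))
  (CkM oU (IH cf') (IH cf')).
apply: (Ck_ext oU _ c) => z Uz.
rewrite [RHS](deriveV (f0 _ Uz)); last exact: diff_derivable (df _ Uz).
by rewrite !fctE -[RHS]/(_ * _) -exprVn mulN1r expr2 mulrC mulrN mulNr.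
Qed.

Lemma Ck_rVP k (U : set V) m (f : V -> 'rV[R]_m) : open U ->
  (forall i, Ck k U (fun z => f z 0 i)) <-> Ck k U f.
Proof.
move=> oU; elim: k f => [|k IH] f /=.
  split=> [h x Ux|h i x Ux].
    have -> : f = \sum_(i < m) (fun z => f z 0 i *: delta_mx 0 i).
      by apply/funext => z; rewrite fct_sumE [LHS]row_sum_delta.
    elim/big_rec : _ => [|i g _ cg]; first exact: cst_continuous.
    have ci : {for x, continuous (fun z => f z 0 i *: (delta_mx 0 i : 'rV[R]_m))}.
      by apply: continuousZr_tmp; exact: h.
    exact: (continuousD ci cg).
  apply: (@continuous_comp _ _ _ f (fun M : 'rV[R]_m => M 0 i)).
    exact: h.
  exact: coord_continuous.
split=> [h|[h1 h2] i].
  have df x : U x -> differentiable f x.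
    by move=> Ux; apply/differentiable_rVP => i; case: (h i) => d _; exact: d.
  split=> // v; apply/IH => i; case: (h i) => _ /(_ v).
  apply: Ck_ext => // z Uz.
  by rewrite derive_mx ?mxE//; apply: diff_derivable; exact: df.
split=> [x Ux|v]; first by move/differentiable_rVP : (h1 x Ux); exact.
have /IH/(_ i) := h2 v; apply: Ck_ext => // z Uz.
by rewrite derive_mx ?mxE//; apply: diff_derivable; exact: h1.
Qed.

Lemma Ck_smul k (U : set V) m (a : V -> R) (f : V -> 'rV[R]_m) :
  open U -> Ck k U a -> Ck k U f -> Ck k U (fun z => a z *: f z).
Proof.
move=> oU ca /(Ck_rVP _ _ oU) cf; apply/(Ck_rVP _ _ oU) => i.
by apply: Ck_ext (CkM oU ca (cf i)) => // z _; rewrite mxE.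
Qed.

Lemma Ck_dot k (U : set V) m (f g : V -> 'rV[R]_m) :
  open U -> Ck k U f -> Ck k U g -> Ck k U (fun z => dot (f z) (g z)).
Proof.
move=> oU /(Ck_rVP _ _ oU) cf /(Ck_rVP _ _ oU) cg.
apply: Ck_ext (Ck_sum (index_enum 'I_m) predT oU
  (fun i => CkM oU (cf i) (cg i))) => // z _.
by rewrite fct_sumE.
Qed.

End CkTheory.

(** Restriction to a line, through which one-variable results such as the mean value theorem and the
    second derivative test reach directional derivatives. *)
Lemma is_derive_comp_line {R : realType} {V W : normedModType R} (f : V -> W)
    x v (s : R) : derivable f (x + s *: v) v ->
  is_derive s 1 (fun r : R => f (x + r *: v)) ('D_v f (x + s *: v)).
Proof.
have e : (fun h : R => h^-1 *: (((fun r : R => f (x + r *: v)) \o shift s)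
      (h *: 1) - f (x + s *: v))) =
    (fun h : R => h^-1 *: ((f \o shift (x + s *: v)) (h *: v) -
      f (x + s *: v))).
  apply/funext => h /=; congr (_ *: (f _ - _)).
  by rewrite scalerDl addrCA -scalerA scale1r.
by move=> df; apply: DeriveDef; rewrite /derivable /derive e.
Qed.

Lemma continuous_line {R : realType} {V : normedModType R} (x v : V) :
  continuous (fun r : R => x + r *: v).
Proof.
by move=> r; apply: cvgD; [exact: cvg_cst|apply: cvgZr_tmp; exact: cvg_id].
Qed.

(** * Symmetry of second derivatives and the second derivative test *)

Section Schwarz.
Context {R : realType} {V : normedModType R}.

(** The mean value theorem twice: for the increment [q] in the direction b, as a function of the
    step along a, and then for [p], the derivative along a, as a function of the step along b. *)
Lemma second_difference (U : set V) (f : V -> R) x a b (h : R) :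
  0 <= h -> Ck 2 U f ->
  (forall s r : R, 0 <= s <= h -> 0 <= r <= h -> U (x + s *: a + r *: b)) ->
  exists s r : R, [/\ 0 <= s <= h, 0 <= r <= h &
    f (x + h *: a + h *: b) - f (x + h *: a) - f (x + h *: b) + f x =
    'D_b ('D_a f) (x + s *: a + r *: b) * h * h].
Proof.
move=> h0 [df /(_ a)[dfa _]] hU.
have h1 : 0 <= h <= h by rewrite h0 lexx.
have h2 : 0 <= (0 : R) <= h by rewrite h0 lexx.
pose q s := f (x + h *: b + s *: a) - f (x + s *: a).
have dq s : 0 <= s <= h -> is_derive s 1 q
    ('D_a f (x + h *: b + s *: a) - 'D_a f (x + s *: a)).
  move=> s01; apply: is_deriveB; apply: is_derive_comp_line;
    apply: diff_derivable; apply: df.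
    by rewrite addrAC; exact: hU.
  by have := hU s 0 s01 h2; rewrite scale0r addr0.
have [| |s s01] := MVT_segment (df := fun s =>
    'D_a f (x + h *: b + s *: a) - 'D_a f (x + s *: a)) h0 (f := q).
- by move=> s; rewrite in_itv /= => /andP[s0 s1]; apply: dq; rewrite !ltW.
- apply: derivable_within_continuous => s; rewrite in_itv /= => s01.
  by have [] := dq s s01.
move: s01; rewrite in_itv /= => s01.
pose p r := 'D_a f (x + s *: a + r *: b).
have dp r : 0 <= r <= h -> is_derive r 1 p ('D_b ('D_a f) (x + s *: a + r *: b)).
  move=> r01; apply: is_derive_comp_line.
  by apply: diff_derivable; apply: dfa; exact: hU.
have [| |r r01] := MVT_segment (df := fun r =>
    'D_b ('D_a f) (x + s *: a + r *: b)) h0 (f := p).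
- by move=> r; rewrite in_itv /= => /andP[s0 s1]; apply: dp; rewrite !ltW.
- apply: derivable_within_continuous => r; rewrite in_itv /= => r01.
  by have [] := dp r r01.
move: r01; rewrite in_itv /= => r01.
rewrite /p scale0r addr0 /q !scale0r !addr0 !subr0.
rewrite (addrAC x (s *: a)) => -> e.
exists s, r; split => //; rewrite -e (addrAC x (h *: a)) opprB addrA.
exact: addrAC.
Qed.

(** The second difference is symmetric in a and b, so by [second_difference] the two mixed
    derivatives agree at two possibly different points of a small parallelogram. Both are continuous
    at x, hence within any e of each other there. *)
Lemma derive_comm (U : set V) (f : V -> R) x a b :
  open U -> U x -> Ck 2 U f -> 'D_a ('D_b f) x = 'D_b ('D_a f) x.
Proof.
move=> oU Ux cf; apply/eqP; rewrite -subr_eq0 -normr_eq0; apply/eqP.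
apply/eqP; rewrite eq_le normr_ge0 andbT; apply/ler_addgt0Pr => e e0.
rewrite add0r.
have e2 : 0 < e / 2 by rewrite divr_gt0.
have cont a' b' : {for x, continuous ('D_a' ('D_b' f))}.
  by case: cf => _ /(_ b')[_ /(_ a')]; exact.
pose P := [set y | [/\ U y, `|'D_a ('D_b f) x - 'D_a ('D_b f) y| < e / 2 &
   `|'D_b ('D_a f) x - 'D_b ('D_a f) y| < e / 2]].
have nP : nbhs x P.
  have n1 : \forall y \near x, `|'D_a ('D_b f) x - 'D_a ('D_b f) y| < e / 2.
    by have /cvgrPdist_lt/(_ _ e2) := cont a b.
  have n2 : \forall y \near x, `|'D_b ('D_a f) x - 'D_b ('D_a f) y| < e / 2.
    by have /cvgrPdist_lt/(_ _ e2) := cont b a.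
  have nU : \forall y \near x, U y by exact: open_nbhs_nbhs.
  exact: (@filterS3 V (nbhs x) _ _ _ _ P (fun y a b c => And3 a b c) nU n1 n2).
have [h h0 hP] : exists2 h : R, 0 < h & forall s r : R, 0 <= s <= h ->
    0 <= r <= h -> P (x + s *: a + r *: b).
  have [r /= r0 rP] := (nbhs_ballP x P).1 nP.
  (* The summand 1 keeps the denominator positive when a = b = 0. *)
  have c0 : 0 < `|a| + `|b| + 1 by rewrite ltr_wpDl// addr_ge0.
  exists (r / (`|a| + `|b| + 1)); first by rewrite divr_gt0.
  move=> s t /andP[s0 sr] /andP[t0 tr]; apply: rP.
  rewrite -ball_normE /= -addrA opprD addrA subrr add0r normrN.
  rewrite (le_lt_trans (ler_normD _ _))// !normrZ !ger0_norm//.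
  apply: (@le_lt_trans _ _ (r / (`|a| + `|b| + 1) * (`|a| + `|b|))).
    by rewrite mulrDr lerD// ler_wpM2r.
  by rewrite mulrAC ltr_pdivrMr// ltr_pM2l// ltrDl.
have hU s r : 0 <= s <= h -> 0 <= r <= h -> U (x + s *: a + r *: b).
  by move=> sh rh; case: (hP s r sh rh).
have hU' s r : 0 <= s <= h -> 0 <= r <= h -> U (x + s *: b + r *: a).
  by move=> sh rh; rewrite addrAC; exact: hU.
have [s [r [s1 r1 e1]]] := second_difference (ltW h0) cf hU.
have [s' [r' [s2 r2 e2']]] := second_difference (ltW h0) cf hU'.
have {e1 e2'} e12 : 'D_b ('D_a f) (x + s *: a + r *: b) =
    'D_a ('D_b f) (x + s' *: b + r' *: a).
  apply: (mulIf (lt0r_neq0 h0)); apply: (mulIf (lt0r_neq0 h0)).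
  apply: etrans (esym e1) (etrans _ e2').
  by rewrite (addrAC x (h *: b)); congr (_ + _); exact: addrAC.
have [_ _ b1] := hP _ _ s1 r1; have [_ b2 _] := hP _ _ r2 s2.
rewrite e12 addrAC distrC in b1.
have := lerD (ltW b2) (ltW b1); rewrite -splitr; apply: le_trans.
exact: ler_distD.
Qed.

Lemma derive_comm_rV m (U : set V) (f : V -> 'rV[R]_m) x a b :
  open U -> U x -> Ck 2 U f -> 'D_a ('D_b f) x = 'D_b ('D_a f) x.
Proof.
move=> oU Ux cf; have cfi := (Ck_rVP _ _ oU).2 cf.
have coord c d i : 'D_c ('D_d f) x 0 i = 'D_c ('D_d (fun z => f z 0 i)) x.
  case: (cf) => df /(_ d)[ddf _].
  rewrite derive_mx ?mxE; last exact: diff_derivable (ddf _ Ux).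
  apply: derive_eq_on oU _ Ux => z Uz.
  by rewrite derive_mx ?mxE//; exact: diff_derivable (df _ Uz).
apply/rowP => i; apply: etrans (coord a b i) (etrans _ (esym (coord b a i))).
exact: (derive_comm a b oU Ux (cfi i)).
Qed.

End Schwarz.

(** As for [CkV]: the derivative f' / (2 sqrt f) contains the square root at one order less. *)
Lemma Ck_sqrt {R : realType} {V : normedModType R} k (U : set V) (f : V -> R) :
  open U -> (forall z, U z -> 0 < f z) -> Ck k U f ->
  Ck k U (fun z => Num.sqrt (f z)).
Proof.
move=> oU f0; elim: k => [|k IH] /=.
  move=> cf x Ux; apply: (@continuous_comp _ _ _ f Num.sqrt); first exact: cf.
  exact: sqrt_continuous.
move=> /[dup] /CkW cf' [df cf].
have ds z : U z -> is_derive (f z) 1 Num.sqrt (2 * Num.sqrt (f z))^-1.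
  by move=> Uz; apply: is_derive1_sqrt; exact: f0.
split=> [x Ux|v].
  apply: (@differentiable_comp _ _ _ _ f Num.sqrt); first exact: df.
  by apply/derivable1_diffP; case: (ds _ Ux).
have s0 z : U z -> 2 * Num.sqrt (f z) != 0.
  by move=> Uz; rewrite mulf_neq0// sqrtr_eq0 -ltNge f0.
have c := CkM oU (cf v) (CkV oU s0 (CkM oU (@Ck_cst _ _ R k U 2) (IH cf'))).
apply: (Ck_ext oU _ c) => z Uz.
have dfz : differentiable f z := df z Uz.
have dsz : differentiable Num.sqrt (f z).
  by apply/derivable1_diffP; case: (ds _ Uz).
have -> : (fun z => Num.sqrt (f z)) = Num.sqrt \o f by [].
rewrite deriveE; last exact: differentiable_comp.
rewrite diff_comp//= deriv1E; last by case: (ds _ Uz).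
by rewrite -deriveE// derive1E; case: (ds _ Uz) => _ ->.
Qed.

(** If ddf were negative, df would be negative on some interval (0, h], and the mean value theorem
    would give f h < f 0. *)
Lemma second_derivative_at_min {R : realType} (f df : R -> R) (ddf : R) :
  (\forall s \near (0 : R), is_derive (s : R) 1 f (df s)) -> is_derive (0 : R) 1 df ddf ->
  (\forall s \near (0 : R), f 0 <= f s) -> df 0 = 0 /\ 0 <= ddf.
Proof.
move=> /nbhs_ballP[r1 /= r10 h1] ddf0 /nbhs_ballP[r2 /= r20 h2].
pose r := Num.min r1 r2.
have r0 : 0 < r by rewrite lt_min r10.
have dfr (s : R) : `|s| < r -> is_derive s 1 f (df s).
  by rewrite lt_min => /andP[sr _]; apply: h1; rewrite /ball /= sub0r normrN.
have fr (s : R) : `|s| < r -> f 0 <= f s.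
  by rewrite lt_min => /andP[_ sr]; apply: h2; rewrite /ball /= sub0r normrN.
have Or : (0 : R) \in `]- r, r[ by rewrite in_itv /= oppr_lt0 r0.
have df0 : df 0 = 0.
  have d0 : is_derive (0 : R) 1 f 0.
    apply: (@derive1_at_min _ f (- r) r) => //; first by rewrite ge0_cp ?ltW.
      move=> t; rewrite in_itv /= -ltr_norml => tr.
      by have [] := dfr _ tr.
    by move=> t; rewrite in_itv /= -ltr_norml => /fr.
  have Or' : `|0 : R| < r by rewrite normr0.
  by case: (dfr 0 Or') => _ <-; case: d0.
split=> //; rewrite leNgt; apply/negP => dd0.
have [dd1 dd2] := ddf0.
have : (fun h : R => h^-1 *: (df (h *: 1 + 0) - df 0)) @ 0^' --> ddf.
  by rewrite -dd2; exact: dd1.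
have dd2' : 0 < - ddf by rewrite oppr_gt0.
move=> /cvgrPdist_lt/(_ _ dd2') /nbhs_ballP[r3 /= r30 h3].
pose h := Num.min r r3 / 2.
have hm : 0 < Num.min r r3 by rewrite lt_min r0.
have h0 : 0 < h by rewrite divr_gt0.
have hr : h < r /\ h < r3.
  by apply/andP; rewrite -lt_min ltr_pdivrMr// ltr_pMr// ltr1n.
case: hr => hr hr3.
have dfn (s : R) : 0 < s <= h -> df s < 0.
  move=> /andP[s0 sh].
  have := h3 s; rewrite /ball /= sub0r normrN gtr0_norm// (le_lt_trans sh)//.
  move=> /(_ isT (lt0r_neq0 s0)); rewrite df0 subr0 addr0.
  rewrite [s *: 1]mulr1 ltr_norml opprK ltrDl oppr_gt0 => /andP[+ _].
  by rewrite pmulr_rlt0// invr_gt0.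
have [| |c] := MVT (df := df) h0 (f := f).
- move=> s; rewrite in_itv /= => /andP[s0 s1]; apply: dfr.
  by rewrite gtr0_norm// (lt_trans s1).
- apply: derivable_within_continuous => s; rewrite in_itv /= => /andP[s0 s1].
  have sr : `|s| < r by rewrite ger0_norm// (le_lt_trans s1).
  by case: (dfr s sr).
rewrite in_itv /= subr0 => /andP[c0 c1] e.
have := fr h; rewrite gtr0_norm// => /(_ hr); rewrite -subr_ge0 e.
by apply/negP; rewrite -ltNge pmulr_llt0// dfn// c0 ltW.
Qed.

(** * Limits of matrix-valued maps *)

Section MatrixLimits.
Context {R : realType} {T : Type} (F : set_system T) {FF : Filter F}.

Lemma cvg_mxP m n (f : T -> 'M[R]_(m, n)) (A : 'M[R]_(m, n)) :
  (forall i j, (fun x => f x i j) @ F --> A i j) <-> f @ F --> A.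
Proof.
split=> [h|h i j]; last first.
  apply: (@cvg_comp _ _ _ f (fun M : 'M[R]_(m, n) => M i j) F (nbhs A)) => //.
  exact: coord_continuous.
apply/cvgrPdist_lt => e e0; near=> x.
rewrite [ltLHS]/Num.Def.normr/= mx_normrE (bigmax_lt _ e0)// => -[i j] _ /=.
rewrite !mxE; move: i j; near: x.
apply: filter_forall => i; apply: filter_forall => j.
by have /cvgrPdist_lt/(_ _ e0) := h i j.
Unshelve. all: by end_near. Qed.

Lemma cvg_sum I (r : seq I) (f : I -> T -> R) (a : I -> R) :
  (forall i, f i @ F --> a i) ->
  (fun x => \sum_(i <- r) f i x) @ F --> \sum_(i <- r) a i.
Proof.
move=> h; elim: r => [|i r IH].
  by under eq_fun do rewrite big_nil; rewrite big_nil; exact: cvg_cst.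
under eq_fun do rewrite big_cons; rewrite big_cons.
exact: cvgD.
Qed.

Lemma cvg_prod I (r : seq I) (f : I -> T -> R) (a : I -> R) :
  (forall i, f i @ F --> a i) ->
  (fun x => \prod_(i <- r) f i x) @ F --> \prod_(i <- r) a i.
Proof.
move=> h; elim: r => [|i r IH].
  by under eq_fun do rewrite big_nil; rewrite big_nil; exact: cvg_cst.
under eq_fun do rewrite big_cons; rewrite big_cons.
exact: cvgM.
Qed.

Lemma cvg_mulmx m n p (f : T -> 'M[R]_(m, n)) (g : T -> 'M[R]_(n, p))
    (A : 'M[R]_(m, n)) (B : 'M[R]_(n, p)) :
  f @ F --> A -> g @ F --> B -> (fun x => f x *m g x) @ F --> A *m B.
Proof.
move=> /cvg_mxP hf /cvg_mxP hg; apply/cvg_mxP => i j.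
under eq_fun do rewrite mxE; rewrite mxE.
by apply: cvg_sum => k; exact: cvgM.
Qed.

Lemma cvg_trmx m n (f : T -> 'M[R]_(m, n)) (A : 'M[R]_(m, n)) :
  f @ F --> A -> (fun x => (f x)^T) @ F --> A^T.
Proof.
move=> /cvg_mxP hf; apply/cvg_mxP => i j.
under eq_fun do rewrite mxE; rewrite mxE; exact: hf.
Qed.

Lemma cvg_mxtrace n (f : T -> 'M[R]_n) (A : 'M[R]_n) :
  f @ F --> A -> (fun x => \tr (f x)) @ F --> \tr A.
Proof.
move=> /cvg_mxP hf.
exact: (@cvg_sum 'I_n (index_enum _) (fun i x => f x i i) (fun i => A i i)
  (fun i => hf i i)).
Qed.

Lemma cvg_det n (f : T -> 'M[R]_n) (A : 'M[R]_n) :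
  f @ F --> A -> (fun x => \det (f x)) @ F --> \det A.
Proof.
move=> /cvg_mxP hf.
have h (s : 'S_n) : (fun x => (-1) ^+ s * \prod_i f x i (s i)) @ F -->
    (-1) ^+ s * \prod_i A i (s i).
  apply: cvgM; first exact: cvg_cst.
  exact: (@cvg_prod 'I_n (index_enum _) (fun i x => f x i (s i))
    (fun i => A i (s i)) (fun i => hf i (s i))).
exact: (@cvg_sum 'S_n (index_enum _)
  (fun s x => (-1) ^+ s * \prod_i f x i (s i)) _ h).
Qed.

(** By Cramer's rule. [invmx] is the adjugate over the determinant only on invertible matrices, so
    invertibility is first carried to f x for x near the limit. *)
Lemma cvg_invmx n (f : T -> 'M[R]_n) (A : 'M[R]_n) : A \in unitmx ->
  f @ F --> A -> (fun x => invmx (f x)) @ F --> invmx A.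
Proof.
move=> uA hf.
have dA : \det A != 0 by rewrite -unitfE.
have hd := cvg_det hf.
have nu : \forall x \near F, f x \in unitmx.
  near=> x; rewrite unitmxE unitfE; near: x.
  exact: hd (open_nbhs_nbhs (conj (@open_neq R 0) dA)).
have eqA B : B \in unitmx -> invmx B = (\det B)^-1 *: \adj B.
  by rewrite /invmx => ->.
have e : {near F, (fun x => (\det (f x))^-1 *: \adj (f x)) =1
    (fun x => invmx (f x))}.
  by near=> x; rewrite -eqA//; near: x.
rewrite eqA//; apply: cvg_trans (near_eq_cvg e) _.
have cadj : (fun x => \adj (f x)) @ F --> \adj A.
  apply/cvg_mxP => i j; under eq_fun do rewrite mxE; rewrite mxE.
  apply: cvgM; first exact: cvg_cst.
  apply: cvg_det; apply/cvg_mxP => k l; move/cvg_mxP : hf => hf.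
  by under eq_fun do rewrite !mxE; rewrite !mxE; exact: hf.
apply/cvg_mxP => i j; move/cvg_mxP : cadj => cadj.
under eq_fun do rewrite mxE; rewrite mxE.
by apply: cvgM; [exact: cvgV|exact: cadj].
Unshelve. all: by end_near. Qed.

End MatrixLimits.

Section DotMatrix.
Context {R : realType}.

Lemma dot_mull m p (w : 'rV[R]_m) (X : 'M[R]_(m, p)) v :
  dot (w *m X) v = dot w (v *m X^T).
Proof. by rewrite !dotE trmx_mul trmxK mulmxA. Qed.

Lemma mxtrace_dot m p (X Y : 'M[R]_(m, p)) :
  \tr (X *m Y^T) = \sum_i dot (row i X) (row i Y).
Proof.
apply: eq_bigr => i _; rewrite mxE; apply: eq_bigr => j _.
by rewrite !mxE.
Qed.

Lemma mxtrace_scale_sub m p (a : R) (U V : 'M[R]_(m, p))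
    (X Y : 'M[R]_(p, m)) (Z : 'M[R]_m) :
  \tr (U *m (a *: X)) - \tr (V *m (a *: Y) *m Z) =
  a * (\tr (U *m X) - \tr (V *m Y *m Z)).
Proof. by rewrite -!scalemxAr -scalemxAl !mxtraceZ -mulrBr. Qed.

Lemma delta_mul_row m p (X : 'M[R]_(m, p)) i : delta_mx 0 i *m X = row i X.
Proof. by rewrite rowE. Qed.

(* The square matrix obtained by adding the row v to J is invertible, with
   inverse [J^T (J J^T)^-1, v^T]. *)
Lemma gram_projection n (J : 'M[R]_(n, n.+1)) (v : 'rV[R]_n.+1) :
  J *m J^T \in unitmx -> dot v v = 1 -> J *m v^T = 0 ->
  J^T *m invmx (J *m J^T) *m J = 1%:M - v^T *m v.
Proof.
move=> uJ v1 Jv; set U := J^T *m _.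
have JU : J *m U = 1%:M by rewrite mulmxA mulmxV.
have vU : v *m U = 0 by rewrite mulmxA -[v]trmxK -trmx_mul Jv trmx0 mul0mx.
have KL : (col_mx J v : 'M[R]_(n + 1, n.+1)) *m (row_mx U v^T : 'M[R]_(n.+1, n + 1)) =
    1%:M.
  by rewrite mul_col_row JU Jv vU mul_row_tr v1 -scalar_mx_block.
have LK : (row_mx U v^T : 'M[R]_(n.+1, n + 1)) *m (col_mx J v : 'M[R]_(n + 1, n.+1)) =
    1%:M.
  move: (row_mx _ _) (col_mx _ _) KL; rewrite addn1 => L K; exact: mulmx1C.
by rewrite -LK mul_row_col addrK.
Qed.

(** The projection of [gram_projection] kills w, being a product that starts with J^T, and it equals
    the identity minus the projection to the line of v. *)
Lemma normal_multiple n (J : 'M[R]_(n, n.+1)) (v w : 'rV[R]_n.+1) :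
  J *m J^T \in unitmx -> dot v v = 1 -> J *m v^T = 0 -> J *m w^T = 0 ->
  w = dot w v *: v.
Proof.
move=> uJ v1 Jv Jw; apply/eqP; rewrite -subr_eq0; apply/eqP.
rewrite -[X in X - _]mulmx1 -mul_scalar_mx -mul_row_tr -mulmxA -mulmxBr.
by rewrite -(gram_projection uJ v1 Jv) !mulmxA -[w]trmxK -trmx_mul Jw trmx0
  !mul0mx.
Qed.

End DotMatrix.

(** * Geometry of the flow in one chart *)

Section SpaceTime.
Context {R : realType} {n : nat} {E : normedModType R}.
Variables (sdir : {linear 'rV[R]_n -> E}) (tdir : E).

(** Space-time E stays abstract: [sdir] maps the n chart directions into it and [tdir] is the time
    direction, so one derivative operator covers space and time. *)
Definition jac m (f : E -> 'rV[R]_m) z : 'M[R]_(n, m) :=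
  \matrix_i 'D_(sdir (delta_mx 0 i)) f z.

(** Limit of the difference quotients of [jac] along c, which is a chart direction in the Codazzi
    equation and the time direction in the evolution equation. *)
Definition jacD m (f : E -> 'rV[R]_m) c z : 'M[R]_(n, m) :=
  \matrix_i 'D_c ('D_(sdir (delta_mx 0 i)) f) z.

Lemma sdir_mul k (W : normedModType R) (f : E -> W) z (w : 'rV[R]_k)
    (U : 'M[R]_(k, n)) : differentiable f z ->
  'D_(sdir (w *m U)) f z = \sum_i w 0 i *: 'D_(sdir (row i U)) f z.
Proof.
move=> df; rewrite deriveE// mulmx_sum_row.
rewrite !linear_sum; apply: eq_bigr => i _.
by rewrite !linearZ -deriveE.
Qed.

Lemma row_jac m (f : E -> 'rV[R]_m) z i :
  row i (jac f z) = 'D_(sdir (delta_mx 0 i)) f z.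
Proof. exact: rowK. Qed.

Lemma mul_jac m (f : E -> 'rV[R]_m) z v : differentiable f z ->
  v *m jac f z = 'D_(sdir v) f z.
Proof.
move=> df; rewrite -[v in RHS]mulmx1 sdir_mul// mulmx_sum_row.
by apply: eq_bigr => i _; rewrite rowK row1.
Qed.

Lemma mul_jacD m (U : set E) (f : E -> 'rV[R]_m) c z v :
  open U -> U z -> Ck 2 U f ->
  v *m jacD f c z = 'D_c ('D_(sdir v) f) z.
Proof.
move=> oU Uz [df ddf].
have -> : 'D_c ('D_(sdir v) f) z =
    'D_c (\sum_i v 0 i *: 'D_(sdir (delta_mx 0 i)) f) z.
  apply: derive_eq_on oU _ Uz => y Uy.
  rewrite -[v in LHS]mulmx1 sdir_mul; last exact: df.
  by rewrite fct_sumE; apply: eq_bigr => i _; rewrite row1.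
have dd i : derivable ('D_(sdir (delta_mx 0 i)) f) z c.
  by apply: diff_derivable; case: (ddf (sdir (delta_mx 0 i))) => + _; exact.
rewrite derive_sum; last by move=> i; exact: derivableZ.
rewrite mulmx_sum_row; apply: eq_bigr => i _.
by rewrite deriveZ// rowK.
Qed.

Lemma cvg_jac m (U : set E) (f : E -> 'rV[R]_m) z :
  U z -> Ck 1 U f -> jac f y @[y --> z] --> jac f z.
Proof.
move=> Uz [_ cf]; apply/cvg_mxP => i j.
under eq_fun do rewrite mxE; rewrite mxE.
have /= := cf (sdir (delta_mx 0 i)) z Uz.
by move=> /cvg_mxP/(_ 0 j).
Qed.

Lemma cvg_jacD m (U : set E) (f : E -> 'rV[R]_m) c z :
  U z -> Ck 2 U f ->
  (fun h : R => h^-1 *: (jac f (h *: c + z) - jac f z)) @ 0^' --> jacD f c z.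
Proof.
move=> Uz [_ Cf]; apply/cvg_mxP => i j.
under eq_fun do rewrite !mxE; rewrite mxE.
have dfi : derivable ('D_(sdir (delta_mx 0 i)) f) z c.
  by apply: diff_derivable; case: (Cf (sdir (delta_mx 0 i))) => + _; exact.
have /cvg_mxP/(_ 0 j) := dfi.
by under eq_fun do rewrite !mxE.
Qed.

Definition gram m (f : E -> 'rV[R]_m) z := jac f z *m (jac f z)^T.

(* The rows of [codual f z] are the vectors u_i such that df(u_i) is the
   orthogonal projection to the tangent space of the i-th standard basis vector
   of the ambient space; they replace an orthonormal frame. *)
Definition codual m (f : E -> 'rV[R]_m) z : 'M[R]_(m, n) :=
  (jac f z)^T *m invmx (gram f z).

Lemma cvg_codual m (U : set E) (f : E -> 'rV[R]_m) z :
  U z -> Ck 1 U f -> gram f z \in unitmx ->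
  codual f y @[y --> z] --> codual f z.
Proof.
move=> Uz cf ug; have cj := cvg_jac Uz cf.
apply: cvg_mulmx; first exact: cvg_trmx.
by apply: cvg_invmx => //; apply: cvg_mulmx => //; exact: cvg_trmx.
Qed.

(** The shape operator, extended by 0 to the normal line and written in the ambient basis: row i is
    the derivative of N along the tangential part of the i-th basis vector. Its trace is the mean
    curvature. *)
Definition weingarten m (f N : E -> 'rV[R]_m) z : 'M[R]_m :=
  codual f z *m jac N z.

(* A rescaled mean curvature flow read in one chart, with its unit normal [N]
   and its rescaled mean curvature [phi] given as independent smooth fields. *)
Record flow_patch (W : set E) (G N : E -> 'rV[R]_n.+1) (phi : E -> R) :
    Prop := FlowPatch {
  patch_open : open W;
  patch_G : Ck 2 W G;
  patch_N : Ck 2 W N;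
  patch_phi : Ck 2 W phi;
  patch_unit : forall z, W z -> dot (N z) (N z) = 1;
  patch_normal : forall z v, W z -> dot (N z) ('D_(sdir v) G z) = 0;
  patch_time : forall z, W z -> 'D_tdir G z = - (phi z *: N z);
  patch_gram : forall z, W z -> gram G z \in unitmx;
  patch_trace : forall z, W z ->
    \tr (weingarten G N z) - dot (G z) (N z) / 2 = phi z
}.

End SpaceTime.

Local Opaque derive jac.

Section PatchFacts.
Context {R : realType} {n : nat} {E : normedModType R}.
Context (sdir : {linear 'rV[R]_n -> E}) (tdir : E).
Context (W : set E) (G N : E -> 'rV[R]_n.+1) (phi : E -> R).
Hypothesis patch : flow_patch sdir tdir W G N phi.

Let oW : open W := patch_open patch.
Let CG : Ck 2 W G := patch_G patch.
Let CN : Ck 2 W N := patch_N patch.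
Let Cphi : Ck 2 W phi := patch_phi patch.

Let dG z c : W z -> is_derive z c G ('D_c G z).
Proof. by move=> Wz; apply/derivableP/diff_derivable/(proj1 CG). Qed.
Let dN z c : W z -> is_derive z c N ('D_c N z).
Proof. by move=> Wz; apply/derivableP/diff_derivable/(proj1 CN). Qed.
Let dphi z c : W z -> is_derive z c phi ('D_c phi z).
Proof. by move=> Wz; apply/derivableP/diff_derivable/(proj1 Cphi). Qed.
Let ddG z c a : W z -> is_derive z c ('D_a G) ('D_c ('D_a G) z).
Proof. by move=> Wz; apply/derivableP/diff_derivable/(proj1 (proj2 CG a)). Qed.
Let ddN z c a : W z -> is_derive z c ('D_a N) ('D_c ('D_a N) z).
Proof. by move=> Wz; apply/derivableP/diff_derivable/(proj1 (proj2 CN a)). Qed.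

(** Differentiates an identity that holds throughout the open set W. The structure equations below
    come from applying it to the constraints of the patch. *)
Let on_patch {X : normedModType R} (f g : E -> X) z c df dg :
  (forall y, W y -> f y = g y) -> W z ->
  is_derive z c f df -> is_derive z c g dg -> df = dg.
Proof. by move=> fg Wz [_ <-] [_ <-]; exact: derive_eq_on oW fg Wz. Qed.

Lemma dot_N_dN z c : W z -> dot (N z) ('D_c N z) = 0.
Proof.
move=> Wz.
have := on_patch (patch_unit patch) Wz
  (is_derive_dot (dN c Wz) (dN c Wz)) (is_derive_cst (1 : R) z c).
rewrite (dotC ('D_c N z)) -mulr2n => /eqP.
by rewrite mulrn_eq0 /= => /eqP.
Qed.

Lemma dot_N_ddG z c v : W z ->
  dot (N z) ('D_c ('D_(sdir v) G) z) = - dot ('D_c N z) ('D_(sdir v) G z).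
Proof.
move=> Wz.
have := on_patch (fun y => patch_normal patch v) Wz
  (is_derive_dot (dN c Wz) (ddG c (sdir v) Wz)) (is_derive_cst (0 : R) z c).
by move=> /eqP; rewrite addrC addr_eq0 => /eqP.
Qed.

Lemma dot_N_ddN z c : W z ->
  dot (N z) ('D_c ('D_c N) z) = - dot ('D_c N z) ('D_c N z).
Proof.
move=> Wz.
have := on_patch (fun y Wy => dot_N_dN c Wy) Wz
  (is_derive_dot (dN c Wz) (ddN c c Wz)) (is_derive_cst (0 : R) z c).
by move=> /eqP; rewrite addrC addr_eq0 => /eqP.
Qed.

(** Both sides are minus the normal component of a second derivative of G, and second derivatives
    commute. *)
Lemma second_form_sym z a b : W z ->
  dot ('D_(sdir a) N z) ('D_(sdir b) G z) =
  dot ('D_(sdir b) N z) ('D_(sdir a) G z).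
Proof.
move=> Wz; apply: oppr_inj.
apply: etrans (esym (dot_N_ddG (sdir a) b Wz)) _.
apply: etrans _ (dot_N_ddG (sdir b) a Wz).
apply: (congr1 (dot (N z))).
exact: derive_comm_rV (sdir a) (sdir b) oW Wz CG.
Qed.

(** The derivative of [second_form_sym]. Second derivatives of G take the place of Christoffel
    symbols. *)
Lemma codazzi z a b c : W z ->
  dot ('D_c ('D_(sdir a) N) z) ('D_(sdir b) G z) +
  dot ('D_(sdir a) N z) ('D_c ('D_(sdir b) G) z) =
  dot ('D_c ('D_(sdir b) N) z) ('D_(sdir a) G z) +
  dot ('D_(sdir b) N z) ('D_c ('D_(sdir a) G) z).
Proof.
move=> Wz; apply: (on_patch (fun y => @second_form_sym y a b) Wz).
  exact: is_derive_dot (ddN c (sdir a) Wz) (ddG c (sdir b) Wz).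
exact: is_derive_dot (ddN c (sdir b) Wz) (ddG c (sdir a) Wz).
Qed.

Lemma dtdG z v : W z -> 'D_tdir ('D_(sdir v) G) z =
  - ('D_(sdir v) phi z *: N z + phi z *: 'D_(sdir v) N z).
Proof.
move=> Wz; apply: etrans (derive_comm_rV tdir (sdir v) oW Wz CG) _.
apply: (on_patch (patch_time patch) Wz (ddG _ _ Wz)).
by apply: is_deriveN; apply: is_derive_smul; [exact: dphi|exact: dN].
Qed.

Lemma dot_dtN_dG z v : W z ->
  dot ('D_tdir N z) ('D_(sdir v) G z) = 'D_(sdir v) phi z.
Proof.
move=> Wz; apply: oppr_inj.
apply: etrans (esym (dot_N_ddG tdir v Wz)) _.
rewrite (dtdG v Wz) dotNr dotDr !dotZr (patch_unit patch Wz).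
by rewrite (dot_N_dN (sdir v) Wz) mulr0 addr0 mulr1.
Qed.

(** The derivative of [dot_dtN_dG]; its trace over the frame yields the Laplacian of phi in
    [evolution]. *)
Lemma ddphiE z u v : W z -> 'D_(sdir u) ('D_(sdir v) phi) z =
  dot ('D_(sdir u) ('D_tdir N) z) ('D_(sdir v) G z) +
  dot ('D_tdir N z) ('D_(sdir u) ('D_(sdir v) G) z).
Proof.
move=> Wz; apply/esym.
apply: (on_patch (fun y => @dot_dtN_dG y v) Wz).
  exact: is_derive_dot (ddN _ _ Wz) (ddG _ _ Wz).
by apply/derivableP/diff_derivable; apply: (proj1 (proj2 Cphi _)).
Qed.

Section AtPoint.
Context (z : E) (Wz : W z).
Local Notation J := (jac sdir G z).
Local Notation A := (jac sdir N z).
Local Notation U := (codual sdir G z).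
Local Notation S := (weingarten sdir G N z).
Local Notation Nz := (N z).

Let JE v : v *m J = 'D_(sdir v) G z.
Proof. by apply: mul_jac; exact: (proj1 CG). Qed.
Let AE v : v *m A = 'D_(sdir v) N z.
Proof. by apply: mul_jac; exact: (proj1 CN). Qed.

Lemma jac_codual : J *m U = 1%:M.
Proof. by rewrite mulmxA mulmxV// (patch_gram patch). Qed.

Lemma jacG_normal : J *m Nz^T = 0.
Proof.
apply/row_matrixP => i; rewrite row_mul row0 -delta_mul_row JE mul_row_tr.
by rewrite dotC (patch_normal patch)// raddf0.
Qed.

Lemma jacN_normal : A *m Nz^T = 0.
Proof.
apply/row_matrixP => i; rewrite row_mul row0 -delta_mul_row AE mul_row_tr.
by rewrite dotC dot_N_dN// raddf0.
Qed.

Lemma normal_codual : Nz *m U = 0.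
Proof.
by rewrite mulmxA -[Nz]trmxK -trmx_mul jacG_normal trmx0 mul0mx.
Qed.

Lemma codual_jac : U *m J = 1%:M - Nz^T *m Nz.
Proof.
apply: gram_projection; first exact: (patch_gram patch).
  exact: (patch_unit patch).
exact: jacG_normal.
Qed.

Lemma weingarten_normal : S *m Nz^T = 0.
Proof. by rewrite -mulmxA jacN_normal mulmx0. Qed.

Lemma jacN_sym : A *m J^T = J *m A^T.
Proof.
have h (X Y : 'M[R]_(n, n.+1)) i j : (X *m Y^T) i j = dot (row i X) (row j Y).
  by rewrite mxE; apply: eq_bigr => k _; rewrite !mxE.
apply/matrixP => i j; rewrite [LHS](h A J i j) [RHS](h J A i j) !row_jac.
apply: (etrans _ (dotC _ _)).
exact: (second_form_sym (delta_mx 0 i) (delta_mx 0 j) Wz).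
Qed.

(** The rows of A are tangential, so A = A (U J)^T and S = U (A J^T) U^T, where A J^T is the
    symmetric second fundamental form. *)
Lemma weingarten_sym : S^T = S.
Proof.
have AU : A = A *m J^T *m U^T.
  rewrite -mulmxA -trmx_mul codual_jac linearB /= trmx1 trmx_mul trmxK.
  by rewrite mulmxBr mulmx1 mulmxA jacN_normal mul0mx subr0.
have SE : S = U *m (A *m J^T) *m U^T by rewrite -mulmxA -AU.
by rewrite SE !trmx_mul !trmxK jacN_sym !mulmxA.
Qed.

Lemma normal_weingarten : Nz *m S = 0.
Proof. by rewrite mulmxA normal_codual mul0mx. Qed.

End AtPoint.

Section Evolution.
Context (z : E) (Wz : W z).
Local Notation J := (jac sdir G z).
Local Notation A := (jac sdir N z).
Local Notation U := (codual sdir G z).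
Local Notation S := (weingarten sdir G N z).
Local Notation Nz := (N z).

(** An exact formula for the increment of the trace, in which only J and A are subtracted; divided
    by h it passes to the limit without differentiating the inverse Gram matrix. It expands U1 (J1 -
    J0) U0 A1 with J0 U0 = 1 and U1 J1 = 1 - N1^T N1, the normal part having trace 0 because A1 N1^T
    = 0. *)
Lemma mxtrace_weingartenB y : W y ->
  \tr (weingarten sdir G N y) - \tr S =
  \tr (U *m (jac sdir N y - A)) -
  \tr (codual sdir G y *m (jac sdir G y - J) *m (U *m jac sdir N y)).
Proof.
move=> Wy; have UJ := codual_jac Wy; have AN := jacN_normal Wy.
have JU := jac_codual Wz; rewrite /weingarten.
move: (codual sdir G y) (jac sdir G y) (jac sdir N y) (N y) UJ AN JU.
move: U J A => U0 J0 A0 U1 J1 A1 N1 UJ AN JU.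
rewrite !mulmxBr mulmxBl UJ (mulmxA (U1 *m J0)) -(mulmxA U1) JU mulmx1.
rewrite mulmxBl mul1mx !raddfB /=.
have -> : \tr (N1^T *m N1 *m (U0 *m A1)) = 0.
  rewrite -mulmxA mxtrace_mulC -mulmxA -(mulmxA U0) AN !mulmx0.
  exact: mxtrace0.
by move: (\tr _) (\tr _) (\tr _) => a b c; ring.
Qed.

Lemma derive_trace c :
  'D_c (fun y => \tr (weingarten sdir G N y)) z =
  \tr (U *m jacD sdir N c z) - \tr (U *m jacD sdir G c z *m S).
Proof.
have cU : codual sdir G y @[y --> z] --> U.
  by apply: cvg_codual Wz (CkW CG) _; exact: (patch_gram patch).
have cA : jac sdir N y @[y --> z] --> A.
  by apply: (@cvg_jac _ _ _ sdir _ W) => //; exact: CkW.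
have cline : (fun h : R => h *: c + z) @ 0^' --> z.
  have : (fun h : R => h *: c + z) @ 0 --> z.
    rewrite -[X in _ --> X]add0r -[X in X + _](scale0r c).
    by apply: cvgD; [apply: cvgZr_tmp; exact: cvg_id|exact: cvg_cst].
  exact: cvg_within_filter.
have dq (f : E -> 'rV[R]_n.+1) : Ck 2 W f ->
    (fun h : R => h^-1 *: (jac sdir f (h *: c + z) - jac sdir f z)) @ 0^' -->
    jacD sdir f c z.
  by move=> Cf; exact: cvg_jacD Wz Cf.
apply/cvg_lim => //.
have nW : \forall h \near 0^', W (h *: c + z).
  by apply: cline; exact: open_nbhs_nbhs.
pose q h := \tr (U *m (h^-1 *: (jac sdir N (h *: c + z) - A))) -
  \tr (codual sdir G (h *: c + z) *m
    (h^-1 *: (jac sdir G (h *: c + z) - J)) *m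
    (U *m jac sdir N (h *: c + z))).
apply: (@cvg_trans _ (q @ 0^')); last first.
  apply: cvgB; apply: cvg_mxtrace.
    by apply: cvg_mulmx; [exact: cvg_cst|exact: dq].
  apply: cvg_mulmx.
    apply: cvg_mulmx; last exact: dq.
    exact: cvg_comp cline cU.
  apply: cvg_mulmx; first exact: cvg_cst.
  exact: cvg_comp cline cA.
apply: near_eq_cvg; apply: filterS nW => h Wh; rewrite /q /=.
move: (h *: c + z) Wh => y Wy.
rewrite mxtrace_scale_sub.
by apply: (congr1 ( *%R _)); exact/esym/mxtrace_weingartenB.
Qed.


Let JE v : v *m J = 'D_(sdir v) G z.
Proof. by apply: mul_jac; exact: (proj1 CG). Qed.
Let AE v : v *m A = 'D_(sdir v) N z.
Proof. by apply: mul_jac; exact: (proj1 CN). Qed.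

Local Notation u i := (sdir (row i U)).

Lemma frame_dG i : 'D_(u i) G z = row i (1%:M - Nz^T *m Nz).
Proof. by rewrite -JE -row_mul codual_jac. Qed.

Lemma frame_dN i : 'D_(u i) N z = row i S.
Proof. by rewrite -AE -row_mul. Qed.

Definition frame_grad : 'rV[R]_n.+1 := \row_i 'D_(u i) phi z.
(** The directions u i are frozen at z, so on functions this differs from the Laplace-Beltrami
    operator by a first order term: the latter maps phi to [L phi - dot (L G) K]. *)
Definition frame_lap (X : normedModType R) (f : E -> X) : X :=
  \sum_i 'D_(u i) ('D_(u i) f) z.

Local Notation K := frame_grad.
Local Notation L := frame_lap.

Lemma derive_sdir_codual w : 'D_(sdir (w *m U)) phi z = dot w K.
Proof.
rewrite sdir_mul; last exact: (proj1 Cphi).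
by apply: eq_bigr => i _; rewrite mxE.
Qed.

(** The time derivative of N is tangential since N has unit length, and [dot_dtN_dG] gives its
    tangential components. *)
Lemma dtN_grad : 'D_tdir N z = K.
Proof.
have e : 'D_tdir N z = 'D_tdir N z *m (U *m J)^T.
  rewrite codual_jac// linearB /= trmx1 trmx_mul trmxK mulmxBr mulmx1 mulmxA.
  by rewrite mul_row_tr dotC dot_N_dN// raddf0 mul0mx subr0.
rewrite e; apply/rowP => i; rewrite !mxE.
rewrite -(dot_dtN_dG (row i U) Wz) -JE.
apply: eq_bigr => k _; rewrite -row_mul; congr (_ * _).
by rewrite [LHS]mxE [RHS]mxE.
Qed.

Lemma dot_grad_normal : dot K Nz = 0.
Proof. by rewrite -dtN_grad dotC dot_N_dN. Qed.

Lemma mxtrace_weingarten : \tr S = phi z + dot (G z) Nz / 2.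
Proof. by rewrite -(patch_trace patch Wz) subrK. Qed.

Lemma weingarten_proj : S *m (1%:M - Nz^T *m Nz)^T = S.
Proof.
rewrite linearB /= trmx1 trmx_mul trmxK mulmxBr mulmx1 mulmxA.
by rewrite weingarten_normal// mul0mx subr0.
Qed.

Lemma dot_normal_lapG : dot Nz (L G) = - \tr S.
Proof.
rewrite dot_sumr -[in RHS]weingarten_proj mxtrace_dot -sumrN.
apply: eq_bigr => i _.
by rewrite -frame_dG -frame_dN; exact: (dot_N_ddG (u i) (row i U) Wz).
Qed.

Lemma dot_normal_lapN : dot Nz (L N) = - \tr (S *m S^T).
Proof.
rewrite dot_sumr mxtrace_dot -sumrN; apply: eq_bigr => i _.
by rewrite -frame_dN; exact: dot_N_ddN.
Qed.

Let row_jacDN c i : row i (U *m jacD sdir N c z) = 'D_c ('D_(u i) N) z.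
Proof. by rewrite row_mul; exact: (mul_jacD sdir c _ oW Wz CN). Qed.
Let row_jacDG c i : row i (U *m jacD sdir G c z) = 'D_c ('D_(u i) G) z.
Proof. by rewrite row_mul; exact: (mul_jacD sdir c _ oW Wz CG). Qed.

(** The derivative of [patch_trace], with the traces of [derive_trace] written as sums over the
    frame. A space direction c leads to the traced Codazzi equation, the time direction to the
    evolution of phi. *)
Lemma derive_mean_curvature c :
  'D_c phi z + (dot ('D_c G z) Nz + dot (G z) ('D_c N z)) / 2 =
  \sum_i dot ('D_c ('D_(u i) N) z) ('D_(u i) G z) -
  \sum_i dot ('D_c ('D_(u i) G) z) ('D_(u i) N z).
Proof.
have tA : \tr (U *m jacD sdir N c z) =
    \sum_i dot ('D_c ('D_(u i) N) z) ('D_(u i) G z).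
  have -> : \tr (U *m jacD sdir N c z) =
      \tr ((U *m jacD sdir N c z) *m (U *m J)^T).
    have h (X : 'M[R]_(n, n.+1)) : \tr (U *m X *m (Nz^T *m Nz)) = 0.
      by rewrite mxtrace_mulC -mulmxA (mulmxA Nz) normal_codual// mul0mx
         mulmx0 mxtrace0.
    rewrite codual_jac// linearB /= trmx1 trmx_mul trmxK mulmxBr mulmx1.
    by rewrite raddfB /= h subr0.
  rewrite mxtrace_dot; apply: eq_bigr => i _.
  by rewrite row_jacDN (row_mul i U J) JE.
have tG : \tr (U *m jacD sdir G c z *m S) =
    \sum_i dot ('D_c ('D_(u i) G) z) ('D_(u i) N z).
  rewrite -[S in LHS]weingarten_sym// mxtrace_dot; apply: eq_bigr => i _.
  by rewrite row_jacDG frame_dN.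
rewrite -tA -tG -derive_trace.
have Wtr y : W y -> phi y + (1 / 2) * dot (G y) (N y) = \tr (weingarten sdir G N y).
  by move=> Wy; rewrite -(patch_trace patch Wy) mul1r mulrC subrK.
apply/esym; rewrite -(derive_eq_on c oW Wtr Wz).
have dd : is_derive z c (fun y => dot (G y) (N y))
    (dot ('D_c G z) Nz + dot (G z) ('D_c N z)).
  by apply: is_derive_dot; [exact: dG|exact: dN].
have [_ ->] := is_deriveD (dphi c Wz) (is_deriveZ (1 / 2) dd).
by rewrite mul1r; congr (_ + _); rewrite mulrC.
Qed.

Lemma codazzi_trace v :
  dot (L N - L G *m S) ('D_(sdir v) G z) =
  'D_(sdir v) phi z + dot (G z) ('D_(sdir v) N z) / 2.
Proof.
have -> : 'D_(sdir v) phi z + dot (G z) ('D_(sdir v) N z) / 2 =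
    'D_(sdir v) phi z +
    (dot ('D_(sdir v) G z) Nz + dot (G z) ('D_(sdir v) N z)) / 2.
  by rewrite (dotC ('D_(sdir v) G z)) (patch_normal patch)// add0r.
rewrite derive_mean_curvature.
have LGS : dot (L G *m S) ('D_(sdir v) G z) = dot ('D_(sdir v) N z) (L G).
  (* Only the tangential part of L G pairs with a derivative of N, and on it the second fundamental
     form is symmetric. *)
  have e : L G = L G *m U *m J + (dot (L G) Nz) *: Nz.
    by rewrite -mulmxA codual_jac// mulmxBr mulmx1 mulmxA mul_row_tr
       mul_scalar_mx subrK.
  rewrite [in RHS]e dotDr dotZr (dotC ('D_(sdir v) N z) Nz).
  rewrite (dot_N_dN (sdir v) Wz) mulr0 addr0.
  by rewrite mulmxA AE JE; exact: (second_form_sym (L G *m U) v Wz).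
rewrite dotBl LGS.
(* In each frame direction, the Codazzi equation exchanges v with u i and so produces the two sums
   of [derive_mean_curvature]. *)
have -> : dot (L N) ('D_(sdir v) G z) = \sum_i
    (dot ('D_(sdir v) ('D_(u i) N) z) ('D_(u i) G z) +
     dot ('D_(sdir v) N z) ('D_(u i) ('D_(u i) G) z) -
     dot ('D_(sdir v) ('D_(u i) G) z) ('D_(u i) N z)).
  rewrite dotC dot_sumr; apply: eq_bigr => i _.
  rewrite dotC -(derive_comm_rV (u i) (sdir v) oW Wz CN).
  rewrite -(derive_comm_rV (u i) (sdir v) oW Wz CG).
  apply: (canRL (addrK _)).
  apply: (etrans _ (codazzi (row i U) v (u i) Wz)).
  by apply: (congr1 ( +%R _)); exact: dotC.
rewrite sumrB big_split /= -dot_sumr.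
apply: (etrans (addrAC _ _ _)); apply: (congr1 (fun t => t - _)).
exact: addrK.
Qed.

(** [derive_mean_curvature] in the time direction: its first sum is the Laplacian of phi by
    [ddphiE], its second is -phi |A|^2 by [dtdG], and the derivative of <G, N>/2 is (-phi + <G,
    K>)/2. *)
Lemma evolution : 'D_tdir phi z =
  L phi - dot (L G) K + phi z * \tr (S *m S^T) + phi z / 2 - dot (G z) K / 2.
Proof.
have := derive_mean_curvature tdir.
have -> : \sum_i dot ('D_tdir ('D_(u i) N) z) ('D_(u i) G z) =
    L phi - dot (L G) K.
  rewrite (dotC (L G)) dot_sumr -sumrB; apply: eq_bigr => i _.
  rewrite (ddphiE (row i U) (row i U) Wz) -dtN_grad addrK.
  by rewrite (derive_comm_rV tdir (u i) oW Wz CN).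
have -> : \sum_i dot ('D_tdir ('D_(u i) G) z) ('D_(u i) N z) =
    - (phi z * \tr (S *m S^T)).
  rewrite mxtrace_dot mulr_sumr -sumrN; apply: eq_bigr => i _.
  rewrite (dtdG (row i U) Wz) dotNl dotDl !dotZl (dot_N_dN (u i) Wz) mulr0 add0r.
  by rewrite frame_dN.
rewrite (patch_time patch Wz) dotNl dotZl (patch_unit patch Wz) dtN_grad.
move: ('D_tdir phi z) (L phi) (dot _ _) (dot _ _) (\tr _) (phi z).
by move=> a b c d e f h; lra.
Qed.

End Evolution.
End PatchFacts.

Local Transparent derive jac.

(** * The two-point inequality *)

(** Serves for k = kappa phi, d = G' - G and e = N, restricted to a pair of lines through the two
    points of a minimum. *)
Lemma second_variation {R : realType} {m : nat} (k k1 : R -> R) (k2 : R)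
    (d d1 e e1 : R -> 'rV[R]_m) (d2 e2 : 'rV[R]_m) :
  (\forall s \near (0 : R), is_derive (s : R) 1 k (k1 s)) ->
  (\forall s \near (0 : R), is_derive (s : R) 1 d (d1 s)) ->
  (\forall s \near (0 : R), is_derive (s : R) 1 e (e1 s)) ->
  is_derive (0 : R) 1 k1 k2 -> is_derive (0 : R) 1 d1 d2 ->
  is_derive (0 : R) 1 e1 e2 ->
  (\forall s \near (0 : R), k 0 * dot (d 0) (d 0) + 2 * dot (d 0) (e 0) <=
    k s * dot (d s) (d s) + 2 * dot (d s) (e s)) ->
  k1 0 * dot (d 0) (d 0) + 2 * k 0 * dot (d1 0) (d 0) +
    2 * (dot (d1 0) (e 0) + dot (d 0) (e1 0)) = 0 /\
  0 <= k2 * dot (d 0) (d 0) + 4 * k1 0 * dot (d 0) (d1 0) +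
    2 * k 0 * (dot (d1 0) (d1 0) + dot (d 0) d2) +
    2 * dot d2 (e 0) + 4 * dot (d1 0) (e1 0) + 2 * dot (d 0) e2.
Proof.
move=> hk hd he hk1 hd1 he1 hmin.
pose f s := k s * dot (d s) (d s) + 2 * dot (d s) (e s).
pose df s := k s * (dot (d1 s) (d s) + dot (d s) (d1 s)) +
  dot (d s) (d s) * k1 s + 2 * (dot (d1 s) (e s) + dot (d s) (e1 s)).
have Df : \forall s \near (0 : R), is_derive (s : R) 1 f (df s).
  apply: filterS3 hk hd he => s ks ds es.
  apply: (is_deriveD (f := fun s => k s * dot (d s) (d s))).
    exact: (is_deriveM ks (is_derive_dot ds ds)).
  exact: (is_deriveZ 2 (is_derive_dot ds es)).
have k0 := nbhs_singleton hk; have d0 := nbhs_singleton hd.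
have e0 := nbhs_singleton he.
have DDf : is_derive (0 : R) 1 df
    (k 0 * (dot d2 (d 0) + dot (d1 0) (d1 0) +
            (dot (d1 0) (d1 0) + dot (d 0) d2)) +
     (dot (d1 0) (d 0) + dot (d 0) (d1 0)) * k1 0 +
     (dot (d 0) (d 0) * k2 + k1 0 * (dot (d1 0) (d 0) + dot (d 0) (d1 0))) +
     2 * (dot d2 (e 0) + dot (d1 0) (e1 0) +
          (dot (d1 0) (e1 0) + dot (d 0) e2))).
  apply: is_deriveD; first apply: is_deriveD.
  - apply: (is_deriveM (f := k)
      (g := fun s => dot (d1 s) (d s) + dot (d s) (d1 s))).
    by apply: is_deriveD; exact: is_derive_dot.
  - apply: (is_deriveM (f := fun s => dot (d s) (d s)) (g := k1)).
    exact: is_derive_dot.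
  apply: (is_deriveZ 2 (f := fun s => dot (d1 s) (e s) + dot (d s) (e1 s))).
  by apply: is_deriveD; exact: is_derive_dot.
have [f1 f2] := second_derivative_at_min Df DDf hmin.
rewrite !(dotC (d1 0) (d 0)) !(dotC d2 (d 0)) in f2.
rewrite /df (dotC (d 0) (d1 0)) in f1.
split.
  by rewrite -[RHS]f1; ring.
by move: f2; congr (_ <= _); ring.
Qed.

(* Each variable stands for a scalar product at the minimum: D = <d, d>,
   a = <d, N>, Kd = <K, d>, r = rho^-2, sdd = <d, dS>, and so on. *)
Lemma two_point_algebra (R : realFieldType)
    (k kap D a Kd KG KL rho r sdd GdS LGdS GN Gd q phi phit Lphi LNd H phi' H'
     dLG dLG' LGN' G'nu psi : R) :
  r * (k ^+ 2 * D + 2 * k * a + 1) = 1 -> k = kap * phi ->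
  psi = k * D + 2 * a ->
  kap * D * Kd = 2 * k * (D - a * a) - 2 * sdd ->
  kap * D * KL = 2 * k * (dLG + a * H) - 2 * LGdS ->
  kap * D * KG = 2 * k * (Gd - a * GN) - 2 * GdS ->
  phit = Lphi - KL + phi * q + phi / 2 - KG / 2 ->
  LNd + a * q - LGdS = Kd + GdS / 2 ->
  H = phi + GN / 2 ->
  rho * G'nu = k * Gd + GN + k * D + a ->
  H' = phi' + G'nu / 2 ->
  k * dLG' + LGN' = - (rho * H') ->
  0 <= kap * Lphi * D + 4 * kap * (Kd - (k * Kd * (k * D + a)) * r - Kd) +
    2 * k * (2 - 2 * (k * a + 1) ^+ 2 * r + dLG' - dLG) + 2 * (LGN' + H) +
    4 * (H - k ^+ 2 * sdd * r - H) + 2 * LNd ->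
  k * D + psi * (q + 1 / 2 + 2 * k * (kap * Kd) * r) <=
  kap * phit * D + 2 * (- phi' * rho + phi * (k * a + 1)) + 2 * Kd.
Proof.
move=> er ek epsi e1 e2 e3 e4 e5 eH eg eH' eL.
(* The first order condition, paired with d, with the frame Laplacian of G and with G, eliminates
   the three products that contain the shape operator. *)
have esdd : sdd = k * (D - a * a) - kap * D * Kd / 2 by lra.
have eLG : LGdS = k * (dLG + a * H) - kap * D * KL / 2 by lra.
have eG : GdS = k * (Gd - a * GN) - kap * D * KG / 2 by lra.
have eLN : LNd = Kd + GdS / 2 - a * q + LGdS by lra.
have eL' : LGN' = - (rho * phi') - (k * Gd + GN + k * D + a) / 2 - k * dLG'.
  rewrite -eg; rewrite eH' in eL; lra.
rewrite -subr_ge0 => h; rewrite -subr_ge0; move: h.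
congr (_ <= _).
(* The two expressions agree only modulo [er], which therefore enters with its coefficient 4 k. *)
transitivity (kap * phit * D + 2 * (- phi' * rho + phi * (k * a + 1)) + 2 * Kd -
  (k * D + psi * (q + 1 / 2 + 2 * k * (kap * Kd) * r)) +
  4 * k * (1 - r * (k ^+ 2 * D + 2 * k * a + 1))); last by rewrite er; ring.
by rewrite esdd eLN eG eLG eL' e4 epsi eH ek; field.
Qed.

Section TwoPoint.
Context {R : realType} {n : nat} {E : normedModType R}.
Context (sdir : {linear 'rV[R]_n -> E}) (tdir : E).
Context (W W' : set E) (G N G' N' : E -> 'rV[R]_n.+1) (phi phi' : E -> R).
Hypotheses (patch : flow_patch sdir tdir W G N phi)
  (patch' : flow_patch sdir tdir W' G' N' phi').

Definition two_point kappa z w : R :=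
  kappa * phi z * dot (G' w - G z) (G' w - G z) + 2 * dot (G' w - G z) (N z).

Context (z w : E) (Wz : W z) (Ww : W' w).
Local Notation d := (G' w - G z).
Local Notation U := (codual sdir G z).
Local Notation S := (weingarten sdir G N z).
Local Notation K := (frame_grad sdir G phi z).
Local Notation u i := (sdir (row i U)).
Local Notation u' i := (sdir (row i (codual sdir G' w))).

Lemma near_line {X : normedModType R} (O : set X) x v : open O -> O x ->
  \forall s \near (0 : R), O (x + s *: v).
Proof.
move=> oO Ox; apply: (@continuous_line R X x v 0).
by rewrite scale0r addr0; exact: open_nbhs_nbhs.
Qed.

Lemma second_variation_frame kappa i :
  (\forall s \near (0 : R),
    two_point kappa z w <= two_point kappa (z + s *: u i) (w + s *: u' i)) ->
  kappa * K 0 i * dot d d +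
    2 * (kappa * phi z) * dot ('D_(u' i) G' w - 'D_(u i) G z) d +
    2 * (dot ('D_(u' i) G' w - 'D_(u i) G z) (N z) +
         dot d ('D_(u i) N z)) = 0 /\
  0 <= kappa * 'D_(u i) ('D_(u i) phi) z * dot d d +
    4 * (kappa * K 0 i) * dot d ('D_(u' i) G' w - 'D_(u i) G z) +
    2 * (kappa * phi z) *
      (dot ('D_(u' i) G' w - 'D_(u i) G z) ('D_(u' i) G' w - 'D_(u i) G z) +
       dot d ('D_(u' i) ('D_(u' i) G') w - 'D_(u i) ('D_(u i) G) z)) +
    2 * dot ('D_(u' i) ('D_(u' i) G') w - 'D_(u i) ('D_(u i) G) z) (N z) +
    4 * dot ('D_(u' i) G' w - 'D_(u i) G z) ('D_(u i) N z) +
    2 * dot d ('D_(u i) ('D_(u i) N) z).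
Proof.
move=> hmin.
have line0 (X : normedModType R) (x v : X) : x + (0 : R) *: v = x.
  by rewrite scale0r addr0.
have nW := near_line (u i) (patch_open patch) Wz.
have nW' := near_line (u' i) (patch_open patch') Ww.
have [[dG ddG] [dG' ddG']] := (patch_G patch, patch_G patch').
have [[dN ddN] [dphi ddphi]] := (patch_N patch, patch_phi patch).
have D1 (X : normedModType R) (f : E -> X) x v s :
    differentiable f (x + s *: v) ->
    is_derive (s : R) 1 (fun r : R => f (x + r *: v)) ('D_v f (x + s *: v)).
  by move=> df; apply: is_derive_comp_line; exact: diff_derivable.
have D2 (X : normedModType R) (f : E -> X) x v : differentiable ('D_v f) x ->
    is_derive (0 : R) 1 (fun r : R => 'D_v f (x + r *: v)) ('D_v ('D_v f) x).
  by move=> df; rewrite -[in X in is_derive _ _ _ X](line0 _ x v); apply: D1;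
    rewrite line0.
have := @second_variation R n.+1 (fun s => kappa * phi (z + s *: u i))
  (fun s => kappa * 'D_(u i) phi (z + s *: u i)) (kappa * 'D_(u i) ('D_(u i) phi) z)
  (fun s => G' (w + s *: u' i) - G (z + s *: u i))
  (fun s => 'D_(u' i) G' (w + s *: u' i) - 'D_(u i) G (z + s *: u i))
  (fun s => N (z + s *: u i)) (fun s => 'D_(u i) N (z + s *: u i))
  ('D_(u' i) ('D_(u' i) G') w - 'D_(u i) ('D_(u i) G) z)
  ('D_(u i) ('D_(u i) N) z).
rewrite /= !line0 mxE; apply.
- by apply: filterS nW => s Ws; apply: is_deriveZ; exact: D1 (dphi _ Ws).
- apply: filterS2 nW nW' => s Ws Ws'; apply: is_deriveB.
    exact: D1 (dG' _ Ws').
  exact: D1 (dG _ Ws).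
- by apply: filterS nW => s Ws; exact: D1 (dN _ Ws).
- by apply: is_deriveZ; apply: D2; case: (ddphi (u i)) => + _; exact.
- apply: is_deriveB; apply: D2.
    by case: (ddG' (u' i)) => + _; exact.
  by case: (ddG (u i)) => + _; exact.
- by apply: D2; case: (ddN (u i)) => + _; exact.
- exact: hmin.
Qed.

(** The i-th basis vector cancels between its two tangential projections, leaving the normal
    parts. *)
Let frame_diff i : 'D_(u' i) G' w - 'D_(u i) G z =
  N z 0 i *: N z - N' w 0 i *: N' w.
Proof.
rewrite (frame_dG patch Wz) (frame_dG patch' Ww) -linearB /= opprB addrC addrA.
rewrite subrK.
by rewrite linearB /= !row_mul; congr (_ - _); rewrite -mul_scalar_mx;
  congr (_ *m _); apply/rowP => j; rewrite ord1 !mxE eqxx.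
Qed.

Let dot_row v i : dot v (row i S) = (v *m S) 0 i.
Proof.
rewrite -[S in RHS](weingarten_sym patch Wz) mxE.
by apply: eq_bigr => j _; rewrite !mxE.
Qed.

(** The second variations are added over i. The traced structure equations at both points, together
    with the first order condition and the relation between the normals, turn the sum into the time
    derivative of [two_point]. *)
Lemma two_point_inequality (kappa rho : R) :
  (forall a b, \forall s \near (0 : R), two_point kappa z w <=
    two_point kappa (z + s *: sdir a) (w + s *: sdir b)) ->
  rho != 0 -> (kappa * phi z) *: d + N z = rho *: N' w ->
  kappa * phi z * dot d d + two_point kappa z w *
    (\tr (S *m S^T) + 1 / 2 +
     2 * (kappa * phi z) * (kappa * dot K d) / rho ^+ 2) <=
  kappa * 'D_tdir phi z * dot d d +
  2 * (kappa * phi z) * dot ('D_tdir G' w - 'D_tdir G z) d +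
  2 * (dot ('D_tdir G' w - 'D_tdir G z) (N z) + dot d ('D_tdir N z)).
Proof.
move=> hmin rho0 hrho.
set k := kappa * phi z.
have NN := patch_unit patch Wz; have nn := patch_unit patch' Ww.
have NS := normal_weingarten patch Wz.
(* Replaces every product with N' by products with d and N. *)
have hrhoE x : rho * dot (N' w) x = k * dot d x + dot (N z) x.
  rewrite -[LHS]dotZl -hrho.
  by apply: (etrans (dotDl _ _ _)); congr (_ + _); exact: dotZl.
have hrhoi i : rho * N' w 0 i = k * d 0 i + N z 0 i.
  by have /rowP/(_ i) := hrho; rewrite !mxE.
have KN : dot K (N z) = 0 := dot_grad_normal patch Wz.
have dot_diff i x : dot (N z 0 i *: N z - N' w 0 i *: N' w) x =
    N z 0 i * dot (N z) x - N' w 0 i * dot (N' w) x.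
  by rewrite dotBl !dotZl.
(* The first variation as a vector identity, kappa |d|^2 K = 2 k (d - <d, N> N) - 2 d S, paired with
   v. *)
have first_order v : kappa * dot d d * dot v K =
    2 * k * (dot v d - dot d (N z) * dot v (N z)) - 2 * dot v (d *m S).
  suff h i : kappa * dot d d * K 0 i =
      2 * k * (d 0 i - dot d (N z) * N z 0 i) - 2 * (d *m S) 0 i.
    have dS (x y t : 'rV[R]_n.+1) (c e : R) : (forall i, t 0 i =
        c * (x 0 i - e * N z 0 i) - 2 * y 0 i) ->
        dot v t = c * (dot v x - e * dot v (N z)) - 2 * dot v y.
      move=> te; have -> : t = c *: (x - e *: N z) - 2 *: y.
        by apply/rowP => i; rewrite te !mxE.
      by rewrite dotBr !dotZr dotBr dotZr.
    by rewrite -[LHS]dotZr; apply: dS => i; rewrite mxE h.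
  have [h _] := second_variation_frame (hmin (row i U) (row i _)).
  move: h; rewrite frame_diff (frame_dN patch Wz) dot_row !dot_diff NN -/k.
  have e1 := hrhoE d; have e2 := hrhoE (N z); rewrite NN in e2.
  have e3 := hrhoi i; rewrite (dotC (N z) d) in e1 *.
  have e4 : k * (N' w 0 i * dot (N' w) d) + N' w 0 i * dot (N' w) (N z) =
      k * d 0 i + N z 0 i.
    rewrite -[RHS]e3 -[in RHS](mul1r rho) -[in RHS]nn.
    have := hrhoE (N' w); rewrite nn mulr1 (dotC d) (dotC (N z)) => ->.
    by ring.
  move: e4; move: (N' w 0 i * dot (N' w) (N z)) (N' w 0 i * dot (N' w) d).
  move: (dot d d) (dot d (N z)) (d 0 i) (N z 0 i) (K 0 i) ((d *m S) 0 i).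
  by move=> D a di Ni Ki Si x y; nra.
have sums (f : 'I_n.+1 -> R) : (forall i, 0 <= f i) -> 0 <= \sum_i f i.
  by move=> f0; apply: sumr_ge0 => i _.
have {sums} := sums _ (fun i =>
  (second_variation_frame (hmin (row i U) (row i (codual sdir G' w)))).2).
(* The next three sums collapse because summing products of coordinates over i gives scalar
   products; K and S annihilate N. *)
have T1 : \sum_i K 0 i * dot d (N z 0 i *: N z - N' w 0 i *: N' w) =
    - (dot K (N' w) * dot d (N' w)).
  under eq_bigr do rewrite dotC dot_diff mulrBr !mulrA.
  rewrite sumrB -!mulr_suml -/(dot K (N z)) KN mul0r sub0r.
  by rewrite (dotC d).
have T2 : \sum_i dot (N z 0 i *: N z - N' w 0 i *: N' w)
    (N z 0 i *: N z - N' w 0 i *: N' w) = 2 - 2 * dot (N' w) (N z) ^+ 2.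
  have e i : dot (N z 0 i *: N z - N' w 0 i *: N' w)
      (N z 0 i *: N z - N' w 0 i *: N' w) =
      N z 0 i * N z 0 i + N' w 0 i * N' w 0 i -
      2 * dot (N' w) (N z) * (N' w 0 i * N z 0 i).
    rewrite dot_diff !(dotC _ (_ - _)) !dot_diff NN nn (dotC (N z) (N' w)).
    by ring.
  under eq_bigr do rewrite e.
  rewrite sumrB big_split /= -mulr_sumr -/(dot (N z) (N z)) NN.
  by rewrite -/(dot (N' w) (N' w)) nn -/(dot (N' w) (N z)); ring.
have T3 : \sum_i dot (N z 0 i *: N z - N' w 0 i *: N' w) (row i S) =
    - dot (N' w) (N' w *m S).
  under eq_bigr do rewrite dot_diff !dot_row NS mxE mulr0 sub0r.
  by rewrite sumrN.
under eq_bigr do rewrite frame_diff (frame_dN patch Wz) -/k.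
rewrite !big_split /=.
have -> : \sum_i kappa * 'D_(u i) ('D_(u i) phi) z * dot d d =
    kappa * frame_lap sdir G z phi * dot d d.
  by rewrite -mulr_suml -mulr_sumr.
have -> : \sum_i 4 * (kappa * K 0 i) *
      dot d (N z 0 i *: N z - N' w 0 i *: N' w) =
    4 * kappa * - (dot K (N' w) * dot d (N' w)).
  by rewrite -T1 mulr_sumr; apply: eq_bigr => i _; rewrite !mulrA.
rewrite -!mulr_sumr !big_split /= T2 T3 -!dot_sumr.
have dsum (f : 'I_n.+1 -> 'rV[R]_n.+1) x :
    \sum_i dot (f i) x = dot (\sum_i f i) x.
  by rewrite dotC dot_sumr; apply: eq_bigr => i _; rewrite dotC.
rewrite dsum !sumrB => hL.
(* This is |k d + N|^2 = rho^2. *)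
have hr : rho ^- 2 * (k ^+ 2 * dot d d + 2 * k * dot d (N z) + 1) = 1.
  suff <- : rho ^+ 2 = k ^+ 2 * dot d d + 2 * k * dot d (N z) + 1.
    by rewrite mulVf// expf_neq0.
  have e1 := hrhoE d; have e2 := hrhoE (N z); have e3 := hrhoE (N' w).
  rewrite nn mulr1 in e3; rewrite NN in e2; rewrite (dotC (N z) d) in e1.
  transitivity (rho * (k * dot d (N' w) + dot (N z) (N' w))).
    by rewrite -e3 expr2.
  by rewrite mulrDr mulrCA (dotC d) (dotC (N z) (N' w)) e1 e2; ring.
have := @two_point_algebra R k kappa (dot d d) (dot d (N z)) (dot K d)
  (dot K (G z)) (dot K (frame_lap sdir G z G)) rho (rho ^- 2)
  (dot d (d *m S)) (dot (G z) (d *m S)) (dot (frame_lap sdir G z G) (d *m S))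
  (dot (G z) (N z)) (dot (G z) d) (\tr (S *m S^T)) (phi z) ('D_tdir phi z)
  (frame_lap sdir G z phi) (dot (frame_lap sdir G z N) d) (\tr S)
  (phi' w) (\tr (weingarten sdir G' N' w))
  (dot d (frame_lap sdir G z G)) (dot d (frame_lap sdir G' w G'))
  (dot (frame_lap sdir G' w G') (N z)) (dot (G' w) (N' w))
  (two_point kappa z w) hr erefl erefl.
have NLG := dot_normal_lapG patch Wz.
have NLN := dot_normal_lapN patch Wz.
have JE v : v *m jac sdir G z = 'D_(sdir v) G z.
  by apply: mul_jac; case: (patch_G patch) => + _; exact.
have AE v : v *m jac sdir N z = 'D_(sdir v) N z.
  by apply: mul_jac; case: (patch_N patch) => + _; exact.
have p1 : kappa * dot d d * dot K d =
    2 * k * (dot d d - dot d (N z) * dot d (N z)) - 2 * dot d (d *m S).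
  by rewrite (dotC K d) first_order.
have p2 : kappa * dot d d * dot K (frame_lap sdir G z G) =
    2 * k * (dot d (frame_lap sdir G z G) + dot d (N z) * \tr S) -
    2 * dot (frame_lap sdir G z G) (d *m S).
  rewrite (dotC K) first_order (dotC d (frame_lap sdir G z G)).
  by rewrite (dotC (frame_lap sdir G z G) (N z)) NLG mulrN opprK.
have p3 : kappa * dot d d * dot K (G z) =
    2 * k * (dot (G z) d - dot d (N z) * dot (G z) (N z)) -
    2 * dot (G z) (d *m S).
  by rewrite (dotC K) first_order.
have p4 := evolution patch Wz.
rewrite (dotC (frame_lap sdir G z G) K) (dotC (G z) K) in p4.
have p5 : dot (frame_lap sdir G z N) d + dot d (N z) * \tr (S *m S^T) -
    dot (frame_lap sdir G z G) (d *m S) = dot K d + dot (G z) (d *m S) / 2.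
  (* The traced Codazzi equation is used in the direction d U, which G maps to the tangential part
     of d. *)
  have eJ : 'D_(sdir (d *m U)) G z = d - dot d (N z) *: N z.
    rewrite -JE -(mulmxA d U) (codual_jac patch Wz) mulmxBr mulmx1 mulmxA.
    by rewrite mul_row_tr mul_scalar_mx.
  have eA : 'D_(sdir (d *m U)) N z = d *m S by rewrite -AE -(mulmxA d U).
  have aux (v A B : 'rV[R]_n.+1) (q c : R) : dot (N z) A = - q ->
      dot (A - B *m S) (v - dot v (N z) *: N z) = c ->
      dot A v + dot v (N z) * q - dot B (v *m S) = c.
    have BS x : dot (B *m S) x = dot B (x *m S).
      by rewrite dot_mull (weingarten_sym patch Wz).
    move=> NA <-; rewrite dotBr dotZr !dotBl !BS NS dot0r (dotC A (N z)) NA.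
    by ring.
  apply: (aux _ _ _ _ _ NLN); rewrite -eJ.
  apply: (etrans (codazzi_trace patch Wz (d *m U))).
  by rewrite (derive_sdir_codual patch Wz) eA (dotC d K).
have p6 := mxtrace_weingarten patch Wz.
have p7 : rho * dot (G' w) (N' w) =
    k * dot (G z) d + dot (G z) (N z) + k * dot d d + dot d (N z).
  have aux v : G' w = v + G z -> k * dot v (G' w) + dot (N z) (G' w) =
      k * dot (G z) v + dot (G z) (N z) + k * dot v v + dot v (N z).
    move=> ->; rewrite !dotDr (dotC v (G z)) (dotC (N z) v).
    by rewrite (dotC (N z) (G z)); ring.
  by rewrite (dotC (G' w)) hrhoE aux// subrK.
have p8 := mxtrace_weingarten patch' Ww.
(* The left side is rho times the normal component of the frame Laplacian of G' at w, hence minus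
   rho times the mean curvature there. *)
have p9 : k * dot d (frame_lap sdir G' w G') +
    dot (frame_lap sdir G' w G') (N z) =
    - (rho * \tr (weingarten sdir G' N' w)).
  rewrite -mulrN -(dot_normal_lapG patch' Ww) hrhoE.
  by congr (_ + _); exact: dotC.
move=> /(_ p1 p2 p3 p4 p5 p6 p7 p8 p9) final.
have r2 : rho ^+ 2 != 0 by rewrite expf_neq0.
have dNu : rho * dot d (N' w) = k * dot d d + dot d (N z).
  by rewrite (dotC d (N' w)) hrhoE (dotC (N z)).
(* Here and in [q2] and [q3] two factors N' occur; each costs one factor 1/rho. *)
have q1 : dot K (N' w) * dot d (N' w) =
    k * dot K d * (k * dot d d + dot d (N z)) / rho ^+ 2.
  apply: (mulIf r2); rewrite mulfVK// -dNu.
  have -> : k * dot K d = rho * dot K (N' w).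
    by rewrite (dotC K (N' w)) hrhoE (dotC (N z)) KN addr0 (dotC d).
  by ring.
have q2 : dot (N' w) (N z) ^+ 2 = (k * dot d (N z) + 1) ^+ 2 / rho ^+ 2.
  by apply: (mulIf r2); rewrite mulfVK// -NN -hrhoE exprMn mulrC.
have q3 : dot (N' w) (N' w *m S) = k ^+ 2 * dot d (d *m S) / rho ^+ 2.
  have Ssym x y : dot x (y *m S) = dot y (x *m S).
    by rewrite dotC dot_mull (weingarten_sym patch Wz).
  have NS0 x : dot (N z) (x *m S) = 0 by rewrite Ssym NS dot0r.
  apply: (mulIf r2); rewrite mulfVK// expr2 mulrC -mulrA hrhoE NS0 addr0 Ssym.
  by rewrite mulrCA hrhoE NS0 addr0 expr2 mulrA.
rewrite q1 q2 q3 in hL.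
have hL' : 0 <= kappa * frame_lap sdir G z phi * dot d d +
    4 * kappa * - (k * dot K d * (k * dot d d + dot d (N z)) / rho ^+ 2) +
    2 * k * (2 - 2 * ((k * dot d (N z) + 1) ^+ 2 / rho ^+ 2) +
      dot d (frame_lap sdir G' w G' - frame_lap sdir G z G)) +
    2 * dot (frame_lap sdir G' w G' - frame_lap sdir G z G) (N z) +
    4 * - (k ^+ 2 * dot d (d *m S) / rho ^+ 2) +
    2 * dot d (frame_lap sdir G z N) := hL.
clear hL p1 p2 p3 p4 p5 p6 p7 p8 p9 q1 q2 q3 NLN.
move: (frame_lap sdir G z G) (frame_lap sdir G' w G') (frame_lap sdir G z N)
  (frame_lap sdir G z phi) NLG final hL' => LG LG' LN Lf NLG final hL'.
rewrite (dotBr d LG' LG) (dotBl LG' LG (N z)) (dotC LG (N z)) NLG opprK in hL'.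
rewrite (dotC d LN) in hL'.
have {final hL'} : k * dot d d + two_point kappa z w *
    (\tr (S *m S^T) + 1 / 2 + 2 * k * (kappa * dot K d) / rho ^+ 2) <=
    kappa * 'D_tdir phi z * dot d d +
    2 * (- phi' w * rho + phi z * (k * dot d (N z) + 1)) + 2 * dot K d.
  apply: final; move: hL'.
  move: (dot _ _) (dot _ _) (dot _ _) (dot _ _) (dot _ _) (dot _ _) (dot _ _).
  move: (\tr _) (rho ^- 2).
  by move=> t r a1 a2 a3 a4 a5 a6 a7; congr (_ <= _); ring.
move=> final; apply: (le_trans final).
rewrite (patch_time patch Wz) (patch_time patch' Ww) (dtN_grad patch Wz).
have e4 x : dot (- (phi' w *: N' w) - - (phi z *: N z)) x =
    phi z * dot (N z) x - phi' w * dot (N' w) x.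
  by rewrite opprK dotDl dotNl !dotZl addrC.
rewrite !e4 NN mulr1 (dotC K d) (dotC (N z) d).
have {}hrhoN : dot (N' w) (N z) + k * dot (N' w) d = rho.
  have := hrhoE (N' w); rewrite nn mulr1 => ->.
  by rewrite (dotC (N z)) (dotC d) addrC.
rewrite -hrhoN.
move: (dot _ _) (dot _ _) (dot _ _) (dot _ _) (dot _ _) ('D__ _ _) => a b c e f g.
rewrite le_eqVlt; apply/orP; left; apply/eqP; rewrite /k; ring.
Qed.

Lemma derive_two_point_time (kappa : R) :
  is_derive (0 : R) 1
    (fun s => two_point kappa (z + s *: tdir) (w + s *: tdir))
    (kappa * 'D_tdir phi z * dot d d +
     2 * (kappa * phi z) * dot ('D_tdir G' w - 'D_tdir G z) d +
     2 * (dot ('D_tdir G' w - 'D_tdir G z) (N z) + dot d ('D_tdir N z))).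
Proof.
have line0 (X : normedModType R) (x v : X) : x + (0 : R) *: v = x.
  by rewrite scale0r addr0.
have D1 (X : normedModType R) (f : E -> X) x : differentiable f x ->
    is_derive (0 : R) 1 (fun r : R => f (x + r *: tdir)) ('D_tdir f x).
  move=> df; rewrite -[in X in is_derive _ _ _ X](line0 _ x tdir).
  by apply: is_derive_comp_line; rewrite line0; exact: diff_derivable.
have dG := D1 _ _ _ (proj1 (patch_G patch) _ Wz).
have dG' := D1 _ _ _ (proj1 (patch_G patch') _ Ww).
have dN := D1 _ _ _ (proj1 (patch_N patch) _ Wz).
have dphi := is_deriveZ kappa (D1 _ _ _ (proj1 (patch_phi patch) _ Wz)).
have dd := is_deriveB dG' dG.
have h := is_deriveD (is_deriveM dphi (is_derive_dot dd dd))
  (is_deriveZ 2 (is_derive_dot dd dN)).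
apply: (@is_derive_eq _ _ _ _ _ _ _ _ h).
rewrite /= !fctE !line0 -(dotC d ('D_tdir G' w - 'D_tdir G z)) /GRing.scale /=.
by move: ('D_tdir phi z) (dot _ _) (dot _ _) (dot _ _) (dot _ _) => a b e f k; ring.
Qed.

End TwoPoint.

(** * Touching balls *)

Section OneSidedDerivative.
Context {R : realType}.
Implicit Type f : R -> R.

(** At a first zero in time, only earlier times are available for comparison. *)
Lemma derive_at_left_min f (df : R) : is_derive (0 : R) 1 f df ->
  (\forall s \near (0 : R), s < 0 -> f 0 <= f s) -> df <= 0.
Proof.
move=> [dd <-] /nbhs_ballP[r1 /= r10 h1]; rewrite leNgt; apply/negP => df0.
have : (fun h : R => h^-1 *: (f (h *: 1 + 0) - f 0)) @ 0^' --> 'D_1 f 0 := dd.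
move=> /cvgrPdist_lt/(_ _ df0)/nbhs_ballP[r2 /= r20 h2].
pose s := Num.min r1 r2 / 2.
have m0 : 0 < Num.min r1 r2 by rewrite lt_min r10.
have s0 : 0 < s by rewrite divr_gt0.
have /andP[s1 s2] : (s < r1) && (s < r2).
  by rewrite -lt_min ltr_pdivrMr// ltr_pMr// ltr1n.
have Ns0 : - s < 0 by rewrite oppr_lt0.
have := h1 (- s); rewrite /ball /= sub0r opprK gtr0_norm// => /(_ s1 Ns0) fs.
have := h2 (- s); rewrite /ball /= sub0r opprK gtr0_norm//.
move=> /(_ s2 (ltr0_neq0 Ns0)); rewrite addr0 [- s *: 1]mulr1.
rewrite ltr_norml => /andP[_]; rewrite gtrBl.
by rewrite nmulr_rgt0 ?invr_lt0// subr_lt0 ltNge fs.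
Qed.

Lemma derive_at_min f (df : R) : is_derive (0 : R) 1 f df ->
  (\forall s \near (0 : R), f 0 <= f s) -> df = 0.
Proof.
move=> hd hm; apply/eqP; rewrite eq_le; apply/andP; split.
  by apply: (derive_at_left_min hd); apply: filterS hm => s + _.
rewrite -oppr_le0; apply: (@derive_at_left_min (fun s => f (- s))).
  have hN : is_derive (- (0 : R)) 1 f df by rewrite oppr0.
  have h := is_derive1_comp hN (is_deriveNid (0 : R) 1).
  by apply: is_derive_eq h _; rewrite /GRing.scale /= ?mulrN1 ?mulN1r.
rewrite oppr0; have /nbhs_ballP[r /= r0 hr] := hm.
apply/nbhs_ballP; exists r => //= s; rewrite /ball /= sub0r normrN => sr _.
by apply: hr; rewrite /ball /= sub0r opprK.
Qed.

End OneSidedDerivative.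

Lemma cvg_dot {R : realType} {T : Type} (F : set_system T) {FF : Filter F} m
    (f g : T -> 'rV[R]_m) (a b : 'rV[R]_m) :
  f @ F --> a -> g @ F --> b -> (fun x => dot (f x) (g x)) @ F --> dot a b.
Proof.
move=> /cvg_mxP hf /cvg_mxP hg.
apply: (@cvg_sum R T F FF 'I_m (index_enum _) (fun i x => f x 0 i * g x 0 i)).
by move=> i; apply: cvgM; [exact: hf|exact: hg].
Qed.

Section Balls.
Context {R : realType} {m : nat}.
Implicit Types (x y c : 'rV[R]_m) (r : R).

Lemma eballE c r x : 0 < r -> eball c r x <-> dot (x - c) (x - c) < r ^+ 2.
Proof.
move=> r0; rewrite /eball /= -sqr_enorm.
by rewrite ltr_pXn2r ?nnegrE ?enorm_ge0 ?ltW.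
Qed.

(** Convexity, from |(1 - s) a + s b|^2 = (1 - s) |a|^2 + s |b|^2 - s (1 - s) |a - b|^2. *)
Lemma eball_segment c r x y s : 0 < r -> eball c r x -> eball c r y ->
  0 <= s <= 1 -> eball c r (x + s *: (y - x)).
Proof.
move=> r0 /eballE-/(_ r0) hx /eballE-/(_ r0) hy /andP[s0 s1]; apply/eballE => //.
have -> : x + s *: (y - x) - c = (1 - s) *: (x - c) + s *: (y - c).
  by apply/rowP => i; rewrite !mxE; ring.
move: (x - c) (y - c) hx hy => a b ha hb.
have hab := dot_ge0 (a - b).
rewrite dotBl !dotBr (dotC b a) in hab.
rewrite dotDl !dotDr !dotZl !dotZr (dotC b a).
move: (dot a a) (dot a b) (dot b b) ha hb hab => A B C ha hb hab.
have h1 : 0 <= s * (1 - s) * (A - B - (B - C)).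
  by rewrite !mulr_ge0// subr_ge0.
have h2 : 0 < (1 - s) * (r ^+ 2 - A) + s * (r ^+ 2 - C).
  move: s0; rewrite le_eqVlt => /orP[/eqP <-|s0].
    by rewrite mul0r addr0 subr0 mul1r subr_gt0.
  by rewrite ltr_wpDl ?mulr_gt0 ?mulr_ge0 ?subr_ge0 ?subr_gt0// ltW.
rewrite -subr_gt0; have := ltr_leD h2 h1; rewrite addr0 => /lt_le_trans; apply.
by rewrite le_eqVlt; apply/orP; left; apply/eqP; ring.
Qed.

Lemma eball_component (A : set 'rV[R]_m) c r x y : 0 < r -> eball c r `<=` A ->
  eball c r x -> eball c r y -> connected_component A x y.
Proof.
move=> r0 BA Bx By.
exists ((fun s : R => x + s *: (y - x)) @` `[0, 1]).
  split.
  - by exists 0 => /=; [rewrite in_itv /= lexx ler01|rewrite scale0r addr0].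
  - by move=> _ [s /= s01 <-]; apply: BA; apply: eball_segment => //;
      rewrite in_itv in s01.
  - apply: connected_continuous_connected; first exact: segment_connected.
    by apply: continuous_subspaceT => s; exact: continuous_line.
by exists 1 => /=; [rewrite in_itv /= lexx ler01|rewrite scale1r addrC subrK].
Qed.

End Balls.

Section EnclosedBalls.
Context {R : realType} {n : nat} {M : closedManifold R n}.
Implicit Types (f : M -> 'rV[R]_n.+1) (p : M).

Lemma enclosed_exterior f x : enclosed f x -> exterior f x -> False.
Proof. by move=> [_ h] [_]. Qed.

(** A ball that misses the hypersurface lies in one component of the complement, so a single point
    decides. *)
Lemma eball_sub_enclosed f c r x : 0 < r -> eball c r `<=` ~` range f ->
  eball c r x -> ~ exterior f x -> eball c r `<=` enclosed f.
Proof.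
move=> r0 Bf Bx nex y By; split; first exact: Bf.
rewrite -(same_connected_component (eball_component r0 Bf Bx By)).
apply: contrapT => nb; apply: nex; split => //; exact: Bf.
Qed.

(** The vector -v is also a unit normal and differs from v, so by uniqueness it can only fail to
    point into the exterior. *)
Lemma outward_unit_normalN f p v : unique (outward_unit_normal f p) v ->
  forall e, 0 < e -> exists s, 0 < s < e /\ ~ exterior f (f p - s *: v).
Proof.
move=> [[v1 nv _] uv] e e0; apply: contrapT => hn.
suff /uv/eqP : outward_unit_normal f p (- v).
  rewrite -addr_eq0 -mulr2n -scaler_nat scaler_eq0 pnatr_eq0 /= -enorm_eq0 v1.
  by rewrite oner_eq0.
split.
- by rewrite -scaleN1r enormZ normrN1 mul1r.
- by move=> c ac dc w; rewrite dotNl nv// oppr0.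
- near=> s; apply: contrapT => ns; apply: hn; exists s; split; last first.
    by rewrite -scalerN.
  by apply/andP; split; near: s; [exact: nbhs_right_gt|exact: nbhs_right_lt].
Unshelve. all: by end_near. Qed.

Lemma interior_touching_ball f p v r : 0 < r ->
  unique (outward_unit_normal f p) v ->
  eball (f p - r *: v) r `<=` ~` range f ->
  eball (f p - r *: v) r `<=` enclosed f.
Proof.
move=> r0 uv Bf; have [[v1 _ _] _] := uv.
have [s [/andP[s0 sr] hs]] := outward_unit_normalN uv r0.
apply: (eball_sub_enclosed r0 Bf) hs.
rewrite /eball /=.
have -> : f p - s *: v - (f p - r *: v) = (r - s) *: v.
  by apply/rowP => i; rewrite !mxE; ring.
rewrite enormZ v1 mulr1.
by rewrite ger0_norm ?subr_ge0 ?ltW// ltrBlDr ltrDl.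
Qed.

Lemma exterior_touching_ball f p v r : 0 < r -> outward_unit_normal f p v ->
  eball (f p + r *: v) r `<=` enclosed f -> False.
Proof.
move=> r0 [v1 _ hv] Bf.
have : \forall s \near (0 : R)^'+, False.
  near=> s; apply: (@enclosed_exterior f (f p + s *: v)); last by near: s.
  apply: Bf; rewrite /eball /=.
  have -> : f p + s *: v - (f p + r *: v) = (s - r) *: v.
    by apply/rowP => i; rewrite !mxE; ring.
  rewrite enormZ v1.
  have s0 : 0 < s by near: s; exact: nbhs_right_gt.
  have sr : s < r by near: s; exact: nbhs_right_lt.
  by rewrite mulr1 distrC ger0_norm ?subr_ge0 ?ltW// ltrBlDr ltrDl.
by move=> /filter_ex[].
Unshelve. all: by end_near. Qed.

Lemma continuous_sqr_dist (c : 'rV[R]_n.+1) :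
  continuous (fun x : 'rV[R]_n.+1 => dot (x - c) (x - c)).
Proof.
move=> x; have h : (fun y : 'rV[R]_n.+1 => y - c) @ x --> x - c.
  apply: (@continuousB _ _ _ id (cst c) x); first exact: cvg_id.
  exact: cst_continuous.
exact: (cvg_dot h h).
Qed.

Lemma frontier_eball (c x : 'rV[R]_n.+1) r : 0 < r ->
  frontier (eball c r) x <-> dot (x - c) (x - c) = r ^+ 2.
Proof.
move=> r0; split=> [[cBx iBx]|hx].
  apply/eqP; rewrite eq_le !leNgt; apply/andP; split; apply/negP => h.
    have /cBx[y [/eballE-/(_ r0) By hy]] :
        nbhs x [set y | r ^+ 2 < dot (y - c) (y - c)].
      apply: (@continuous_sqr_dist c x [set t | r ^+ 2 < t]).
      by apply: open_nbhs_nbhs; split => //; exact: open_gt.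
    by have := lt_trans By hy; rewrite ltxx.
  apply: iBx.
  have hB : nbhs x [set y | dot (y - c) (y - c) < r ^+ 2].
    apply: (@continuous_sqr_dist c x [set t | t < r ^+ 2]).
    by apply: open_nbhs_nbhs; split => //; exact: open_lt.
  by apply: filterS hB => y hy; apply/eballE.
split; last first.
  by move=> /interior_subset/eballE-/(_ r0); rewrite hx ltxx.
move=> V nV.
have : nbhs (0 : R) [set s | V (x + s *: (c - x))].
  by apply: (@continuous_line R _ x (c - x) 0); rewrite scale0r addr0.
move=> /nbhs_ballP[e /= e0 he].
(* A small step from x towards the centre enters the ball and stays in V. *)
pose s := Num.min e 1 / 2.
have m0 : 0 < Num.min e 1 by rewrite lt_min e0 ltr01.
have s0 : 0 < s by rewrite divr_gt0.
have /andP[s1 s2] : (s < e) && (s < 1).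
  by rewrite -lt_min ltr_pdivrMr// ltr_pMr// ltr1n.
exists (x + s *: (c - x)); split; last first.
  by apply: he; rewrite /ball /= sub0r normrN gtr0_norm.
apply/eballE => //.
have -> : x + s *: (c - x) - c = (1 - s) *: (x - c).
  by apply/rowP => i; rewrite !mxE; ring.
rewrite dotZl dotZr hx mulrA gtr_pMl ?exprn_gt0//.
have t1 : 0 <= 1 - s by rewrite subr_ge0 ltW.
have t2 : 1 - s < 1 by rewrite ltrBlDr ltrDl.
by apply: (@le_lt_trans _ _ (1 - s)) => //; rewrite ler_piMr// ltW.
Qed.

Lemma jacobianP m k (g : 'rV[R]_m -> 'rV[R]_k) x w :
  w *m 'J g x = 'd g x w.
Proof. exact: mul_rV_lin1. Qed.

Lemma gram_unit m k (J : 'M[R]_(m, k)) :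
  (forall v : 'rV_m, v *m J = 0 -> v = 0) -> J *m J^T \in unitmx.
Proof.
move=> hJ; rewrite -row_free_unit; apply/inj_row_free => v.
rewrite mulmxA => vJ; apply: hJ; apply/eqP; rewrite -dot_eq0.
by rewrite dot_mull vJ dot0r.
Qed.

Lemma immersion_gram f c x : immersion f -> atlas c -> chart_cod c x ->
  'J (f \o chart_inv c) x *m ('J (f \o chart_inv c) x)^T \in unitmx.
Proof.
move=> im ac cx; apply: gram_unit => v; rewrite jacobianP => hv.
by apply: (im c ac x cx); rewrite hv linear0.
Qed.

Lemma smooth_map_differentiable f c x : smooth_map f -> atlas c ->
  chart_cod c x -> differentiable (f \o chart_inv c) x.
Proof.
move=> sf ac cx; have [U [g [oU Ux Cg fg]]] := sf c ac x cx.
have [dg _] := Cg 1%N.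
apply: (@differentiable_eq_on _ _ _ (U `&` chart_cod c) g); last exact: dg.
- by apply: openI => //; exact: chart_cod_open.
- by move=> z [Uz cz]; exact/esym/fg.
- by [].
Qed.

(** At a point nearest to x the squared distance is critical, so f p - x is normal, and the normal
    space is the line of v. *)
Lemma normal_direction f p v (x : 'rV[R]_n.+1) : smooth_map f -> immersion f ->
  dot v v = 1 -> normal_vector f p v ->
  (forall q, dot (f p - x) (f p - x) <= dot (f q - x) (f q - x)) ->
  f p - x = dot (f p - x) v *: v.
Proof.
move=> sf im v1 nv hmin.
have [c ac dc] := @atlas_cover _ _ M p.
have cz := chart_map_dom dc.
have df := smooth_map_differentiable sf ac cz.
apply: (normal_multiple (immersion_gram im ac cz) v1).
  apply/row_matrixP => i; rewrite row_mul row0 -delta_mul_row jacobianP.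
  by rewrite mul_row_tr dotC nv// raddf0.
apply/row_matrixP => i; rewrite row_mul row0 -delta_mul_row jacobianP.
rewrite mul_row_tr; apply: (etrans _ (raddf0 _)); congr (_%:M).
set w := delta_mx 0 i; set h := f \o chart_inv c.
have hz : h (chart_map c p) = f p by rewrite /h /= chart_mapK.
have := @is_derive_comp_line R _ _ h (chart_map c p) w 0.
rewrite scale0r addr0 => /(_ (diff_derivable df)) dh.
have dhx : is_derive (0 : R) 1 (fun r : R => h (chart_map c p + r *: w) - x)
    ('D_w h (chart_map c p)).
  have := is_deriveB dh (is_derive_cst x (0 : R) 1).
  by rewrite subr0.
have := derive_at_min (is_derive_dot dhx dhx).
rewrite scale0r addr0 hz (dotC (f p - x)) -mulr2n deriveE// => /(_ _)/eqP.
rewrite mulrn_eq0 /= => e; apply/eqP/e.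
by near=> s; exact: hmin.
Unshelve. all: by end_near. Qed.

End EnclosedBalls.

(** * The unit normal and non-collapsing as a two-point condition *)

Section UnitNormal.
Context {R : realType} {n : nat} {M : closedManifold R n}.
Implicit Types (f : M -> 'rV[R]_n.+1) (p : M).

(** The differential is a choice among the admissible linear maps; when there is none, the choice
    takes its default value 0. *)
Lemma diff_not_differentiable (V W : normedModType R) (f : V -> W) (x : V) :
  ~ differentiable f x -> 'd f x = 0 :> (V -> W).
Proof.
move=> nd; rewrite /diff getPN// => df [dfc Hy]; apply: nd; apply/diffP.
have : exists df : {linear V -> W}, continuous df /\ forall y,
    f y = f (lim (nbhs x)) + df (y - lim (nbhs x))
          +o_(y \near nbhs x) (y - lim (nbhs x)) by exists df.
by move/getPex.
Qed.

Lemma unit_normal_sqr f p : dot (unit_normal f p) (unit_normal f p) = 1 \/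
  unit_normal f p = 0.
Proof.
have [h|h] := pselect (exists v, unique (outward_unit_normal f p) v).
  left; have [[v1 _ _] _] := xgetPex 0 h.
  by rewrite -sqr_enorm [enorm _]v1 expr1n.
by right; apply: xgetPN => v hv; apply: h; exists v.
Qed.

(** Otherwise [unit_normal f p] is the default 0, and its Jacobian at p vanishes: by default if the
    field is not differentiable there; if it is, then by continuity its length is below 1 near p,
    hence 0, since it is always 0 or 1. Then the rescaled mean curvature would be 0. *)
Lemma unit_normal_unique f p : rescaled_mean_curvature f p != 0 ->
  unique (outward_unit_normal f p) (unit_normal f p).
Proof.
move=> H0; have [h|h] := pselect (exists v, unique (outward_unit_normal f p) v).
  exact: (xgetPex 0 h).
have np : unit_normal f p = 0 by apply: xgetPN => v hv; apply: h; exists v.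
exfalso; move/eqP: H0; apply.
rewrite /rescaled_mean_curvature np dot0r mul0r subr0.
rewrite /mean_curvature /surface_div /=.
set c := chart_at p; set x := chart_map c p; set X := unit_normal f \o _.
suff -> : 'J X x = 0 by rewrite mul0mx mulmx0 mxtrace0.
have [ac dc] := svalP (cid2 (atlas_cover p)).
have Xx : X x = 0 by rewrite /X /= chart_mapK.
suff dX : 'd X x = 0 :> (_ -> _).
  by apply/row_matrixP => i; rewrite -delta_mul_row jacobianP dX row0.
have [dX|/diff_not_differentiable//] := pselect (differentiable X x).
have cX := differentiable_continuous dX.
have n0 : \forall y \near x, X y = 0.
  have : \forall y \near x, dot (X y) (X y) < 1.
    have cc : (fun y => dot (X y) (X y)) @ x --> dot (X x) (X x).
      exact: (cvg_dot cX cX).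
    apply: (cc [set t | t < 1]).
    apply: open_nbhs_nbhs; split; first exact: open_lt.
    by rewrite /= Xx dot0r ltr01.
  apply: filterS => y; rewrite /X /=.
  by case: (unit_normal_sqr f (chart_inv c y)) => [->|//]; rewrite ltxx.
apply/funext => w; rewrite -deriveE// (@near_eq_derive _ _ _ _ (cst 0))//.
exact: derive_cst.
Qed.

Lemma dot_unit_normal f p : rescaled_mean_curvature f p != 0 ->
  dot (unit_normal f p) (unit_normal f p) = 1.
Proof.
by move=> /unit_normal_unique[[v1 _ _] _]; rewrite -sqr_enorm v1 expr1n.
Qed.

Definition separation kappa f p q :=
  kappa * rescaled_mean_curvature f p * dot (f q - f p) (f q - f p) +
  2 * dot (f q - f p) (unit_normal f p).

(* With c the centre of the ball of radius 1/k touching from inside at [f p]. *)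
Lemma separationE kappa f p q : let k := kappa * rescaled_mean_curvature f p in
  rescaled_mean_curvature f p != 0 -> k != 0 ->
  let c := f p - k^-1 *: unit_normal f p in
  separation kappa f p q = k * (dot (f q - c) (f q - c) - k ^- 2).
Proof.
move=> k H0 k0 c; rewrite /separation -/k.
have -> : f q - c = f q - f p + k^-1 *: unit_normal f p.
  by rewrite /c opprB addrCA addrC.
move: (f q - f p) => d.
rewrite dotDl !dotDr !dotZl !dotZr (dot_unit_normal H0) (dotC _ d).
by field.
Qed.

(** As sg is its own inverse, the radius in the definition is 1/k in both sign cases. Given the ball
    at p, f p is a nearest point to its centre, so the centre lies on the normal line at distance
    1/k. Conversely, nonnegativity says that the inner ball misses the hypersurface, and
    [interior_touching_ball] applies. *)
Lemma noncollapsed_separation f sg delta : smooth_embedding f ->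
  sg = 1 \/ sg = -1 -> 0 < delta ->
  (forall p, 0 < sg * rescaled_mean_curvature f p) ->
  rescaled_noncollapsed (sg * delta) f <->
  forall p q, 0 <= separation (sg / delta) f p q.
Proof.
move=> [sf im [injf _]] sg1 d0 sgH.
have sg0 : sg != 0 by case: sg1 => ->; rewrite ?oppr_eq0 oner_eq0.
have H0 p : rescaled_mean_curvature f p != 0.
  by have := lt0r_neq0 (sgH p); rewrite mulf_eq0 negb_or => /andP[].
pose k p := sg / delta * rescaled_mean_curvature f p.
have k0 p : 0 < k p.
  by rewrite /k mulrAC divr_gt0.
have rE p : sg * delta / rescaled_mean_curvature f p = (k p)^-1.
  have sgV : sg^-1 = sg by case: sg1 => ->; rewrite ?invrN invr1.
  by rewrite /k !invfM invrK sgV.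
have uN p := unit_normal_unique (H0 p).
have sepE p q : separation (sg / delta) f p q =
    k p * (dot (f q - (f p - (k p)^-1 *: unit_normal f p))
               (f q - (f p - (k p)^-1 *: unit_normal f p)) - (k p)^-1 ^+ 2).
  by rewrite exprVn; exact: separationE q (H0 p) (lt0r_neq0 (k0 p)).
have rk0 p : 0 < (k p)^-1 by rewrite invr_gt0.
split=> [[_ hB] p q|hpsi].
  have [c] := hB p; rewrite rE; set r := (k p)^-1 => -[Be Bf].
  have out x : dot (f x - c) (f x - c) >= r ^+ 2.
    rewrite leNgt; apply/negP => /(eballE c (f x) (rk0 p))/Be[+ _].
    by apply; exists x.
  have fr := (frontier_eball c (f p) (rk0 p)).1 Bf.
  have [[v1 nv ov] uv] := uN p.
  have vv := dot_unit_normal (H0 p).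
  have := @normal_direction R n M f p _ c sf im vv nv.
  rewrite fr => /(_ out); set lam := dot _ _ => fc.
  have lam2 : lam ^+ 2 = r ^+ 2.
    by rewrite -fr fc dotZl dotZr vv mulr1 expr2.
  have {lam2} : lam == r \/ lam == - r by apply/orP; rewrite -eqf_sqr lam2.
  (* The value -r would put the centre on the outer side, so that an enclosed ball would contain
     exterior points. *)
  case=> /eqP lamr; rewrite {}lamr in fc; last first.
    exfalso; apply: (@exterior_touching_ball R n M f p _ r (rk0 p) (uN p).1).
    suff <- : c = f p + r *: unit_normal f p by [].
    by rewrite -[r *: _]opprK -scaleNr -fc opprB addrC subrK.
  have cE : c = f p - r *: unit_normal f p by rewrite -fc opprB addrC subrK.
  rewrite sepE mulr_ge0 ?(ltW (k0 p))// subr_ge0 -/r -cE.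
  exact: out.
split.
  case: sg1 => sgE; [left|right]; rewrite sgE ?mul1r ?mulN1r ?oppr_lt0; split => //.
    by move=> p; have := sgH p; rewrite sgE mul1r.
  by move=> p; have := sgH p; rewrite sgE mulN1r oppr_gt0.
move=> p; exists (f p - (k p)^-1 *: unit_normal f p); rewrite rE.
split; last first.
  apply/frontier_eball => //.
  rewrite opprB addrC subrK dotZl dotZr (dot_unit_normal (H0 p)) mulr1.
  by rewrite expr2.
apply: (interior_touching_ball (rk0 p) (uN p)) => x /(eballE _ _ (rk0 p)) h [q _ qx].
have := hpsi p q; rewrite sepE pmulr_rge0// subr_ge0 leNgt.
by rewrite qx h.
Qed.

End UnitNormal.

(** * Smooth fields in charts *)

Section ChartIndependence.
Context {R : realType} {n : nat} {M : closedManifold R n}.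

Lemma chart_inv_continuous_at (c : chart R n M) x : chart_cod c x ->
  {for x, continuous (chart_inv c)}.
Proof.
move=> cx; have := @chart_inv_continuous _ _ _ c.
rewrite continuous_open_subspace; last exact: chart_cod_open.
by apply; rewrite inE.
Qed.

Lemma chart_map_continuous_at (c : chart R n M) p : chart_dom c p ->
  {for p, continuous (chart_map c)}.
Proof.
move=> cp; have := @chart_map_continuous _ _ _ c.
rewrite continuous_open_subspace; last exact: chart_dom_open.
by apply; rewrite inE.
Qed.

Lemma near_chart_inv (c d : chart R n M) p : chart_dom c p -> chart_dom d p ->
  \forall y \near chart_map d p,
    chart_cod d y /\ chart_dom c (chart_inv d y).
Proof.
move=> cp dp; have dx := chart_map_dom dp.
have h1 : \forall y \near chart_map d p, chart_cod d y.
  by apply: open_nbhs_nbhs; split => //; exact: chart_cod_open.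
have h2 : \forall y \near chart_map d p, chart_dom c (chart_inv d y).
  apply: (chart_inv_continuous_at dx).
  apply: open_nbhs_nbhs; split; first exact: chart_dom_open.
  by rewrite chart_mapK.
by apply: filterS2 h1 h2.
Qed.

Lemma transition_differentiable (c d : chart R n M) p :
  atlas c -> atlas d -> chart_dom c p -> chart_dom d p ->
  differentiable (chart_map c \o chart_inv d) (chart_map d p).
Proof.
move=> ac ad cp dp.
have [|U [g [oU Ux Cg fg]]] := @atlas_smooth _ _ M d c ad ac (chart_map d p).
  by exists p.
apply: (@differentiable_eq_near _ _ _ g); last by case: (Cg 1%N) => + _; exact.
have nU : \forall y \near chart_map d p, U y by exact: open_nbhs_nbhs.
apply: filterS2 nU (near_chart_inv cp dp) => y Uy [dy cy].
apply/esym/fg => //; exists (chart_inv d y); last exact: chart_invK.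
by split => //; exact: chart_inv_cod.
Qed.

Lemma jacobian_transition m (h : M -> 'rV[R]_m) (c d : chart R n M) p :
  atlas c -> atlas d -> chart_dom c p -> chart_dom d p ->
  differentiable (h \o chart_inv c) (chart_map c p) ->
  'J (h \o chart_inv d) (chart_map d p) =
  'J (chart_map c \o chart_inv d) (chart_map d p) *m
  'J (h \o chart_inv c) (chart_map c p).
Proof.
move=> ac ad cp dp dh; have dt := transition_differentiable ac ad cp dp.
have tx : (chart_map c \o chart_inv d) (chart_map d p) = chart_map c p.
  by rewrite /= chart_mapK.
pose h' := (h \o chart_inv c) \o (chart_map c \o chart_inv d).
have near_h : \forall y \near chart_map d p, h' y = (h \o chart_inv d) y.
  apply: filterS (near_chart_inv cp dp) => y [dy cy].
  by rewrite /h' /= chart_mapK.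
have dh' : differentiable (h \o chart_inv c)
    ((chart_map c \o chart_inv d) (chart_map d p)) by rewrite tx.
have dhh : differentiable h' (chart_map d p) by exact: differentiable_comp.
have dhd := differentiable_eq_near near_h dhh.
have e w : 'd (h \o chart_inv d) (chart_map d p) w =
    'd (h \o chart_inv c) (chart_map c p)
      ('d (chart_map c \o chart_inv d) (chart_map d p) w).
  apply: (etrans (esym (deriveE w dhd))).
  apply: (etrans (esym (near_eq_derive w near_h))).
  apply: (etrans (deriveE w dhh)).
  by apply: (etrans (congr1 (fun k => k w) (diff_comp dt dh'))); rewrite -tx.
apply/row_matrixP => i; rewrite row_mul -!delta_mul_row.
apply: (etrans (jacobianP _ _ _)); apply: (etrans (e _)).
apply: (etrans _ (esym (jacobianP _ _ _))).
exact: (congr1 _ (esym (jacobianP _ _ _))).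
Qed.

(** A change of chart multiplies both Jacobians on the left by Q. That Q is invertible is read off
    from the product Q (A A^T) Q^T. *)
Lemma mxtrace_congruence m k (Q : 'M[R]_m) (A B : 'M[R]_(m, k)) :
  (Q *m A) *m (Q *m A)^T \in unitmx -> A *m A^T \in unitmx ->
  \tr (invmx ((Q *m A) *m (Q *m A)^T) *m ((Q *m B) *m (Q *m A)^T)) =
  \tr (invmx (A *m A^T) *m (B *m A^T)).
Proof.
have e (X : 'M[R]_(m, k)) : (Q *m X) *m (Q *m A)^T = Q *m (X *m A^T) *m Q^T.
  by rewrite trmx_mul !mulmxA.
rewrite !e; move: (A *m A^T) (B *m A^T) => g X uQ ug.
have uQ1 : Q \in unitmx by move: uQ; rewrite !unitmx_mul => /andP[/andP[]].
have uQ2 : Q^T \in unitmx by rewrite unitmx_tr.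
have -> : invmx (Q *m g *m Q^T) = invmx Q^T *m invmx g *m invmx Q.
  apply: (can_inj (mulmxK uQ)); rewrite mulVmx//.
  by rewrite !mulmxA !(mulmxKV uQ1) mulmxKV// mulVmx.
rewrite !mulmxA mulmxKV// mxtrace_mulC !mulmxA mulmxV// mul1mx.
by [].
Qed.

(** [surface_div] is computed in the chosen chart [chart_at p], which varies with p, whereas a patch
    needs one chart for all its points. *)
Lemma surface_div_chart (f X : M -> 'rV[R]_n.+1) (c : chart R n M) p :
  immersion f -> atlas c -> chart_dom c p ->
  differentiable (f \o chart_inv c) (chart_map c p) ->
  differentiable (X \o chart_inv c) (chart_map c p) ->
  let Jf := 'J (f \o chart_inv c) (chart_map c p) in
  let JX := 'J (X \o chart_inv c) (chart_map c p) in
  surface_div f X p = \tr (invmx (Jf *m Jf^T) *m (JX *m Jf^T)).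
Proof.
move=> im ac cp df dX Jf JX; rewrite /surface_div.
have [ad dp] := svalP (cid2 (atlas_cover p)).
rewrite -/(chart_at p) in ad dp *.
rewrite (jacobian_transition ac ad cp dp df) (jacobian_transition ac ad cp dp dX).
apply: mxtrace_congruence.
  rewrite -(jacobian_transition ac ad cp dp df).
  exact: immersion_gram (chart_map_dom dp).
exact: immersion_gram (chart_map_dom cp).
Qed.

End ChartIndependence.

Section Slices.
Context {R : realType} {n : nat}.

Definition spacetime : normedModType R := ('rV[R]_n * R)%type.

Let space_dir_fun (v : 'rV[R]_n) : spacetime := (v, 0).

Let space_dir_is_linear : linear space_dir_fun.
Proof.
move=> a u v; rewrite /space_dir_fun [RHS]surjective_pairing; congr (_, _).
by rewrite /= scaler0 addr0.
Qed.

Definition space_dir : {linear 'rV[R]_n -> spacetime} :=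
  HB.pack space_dir_fun
    (GRing.isLinear.Build _ _ _ _ space_dir_fun space_dir_is_linear).

Definition time_dir : spacetime := (0, 1).

Lemma slice_differentiable (z : 'rV[R]_n) (t : R) :
  differentiable (fun y : 'rV[R]_n => (y, t)) z.
Proof.
have : differentiable (fun y : 'rV[R]_n => (id y, cst t y)) z.
  by apply: differentiable_pair; [exact: ex_diff|exact: differentiable_cst].
exact.
Qed.

Lemma slice_derive (W : normedModType R) (h : spacetime -> W)
    (f : 'rV[R]_n -> W) z t :
  (\forall y \near z, f y = h (y, t)) -> differentiable h (z, t) ->
  differentiable f z /\ forall w, 'd f z w = 'D_(space_dir w) h (z, t).
Proof.
move=> fh dh; pose f' y := h (y, t).
have df' : differentiable f' z.
  exact: (differentiable_comp (slice_differentiable z t) dh).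
have df : differentiable f z.
  have fh' : \forall y \near z, f' y = f y.
    exact: (@filterS _ (nbhs z) _ _ _ (fun y e => esym e) fh).
  exact: (differentiable_eq_near fh' df').
split=> // w; apply: (etrans (esym (deriveE w df))).
apply: (etrans (near_eq_derive w fh)).
apply: (congr1 (fun k => lim (k @ 0^'))).
apply/funext => k /=; congr (_ *: (h _ - _)).
rewrite [RHS]surjective_pairing; congr (_, _).
by rewrite /= scaler0 add0r.
Qed.

Lemma slice_jacobian m (h : spacetime -> 'rV[R]_m)
    (f : 'rV[R]_n -> 'rV[R]_m) z t :
  (\forall y \near z, f y = h (y, t)) -> differentiable h (z, t) ->
  jac space_dir h (z, t) = 'J f z.
Proof.
move=> fh dh; have [_ df] := slice_derive fh dh.
apply/row_matrixP => i; rewrite row_jac -delta_mul_row.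
by apply: (etrans (esym (df _))); apply/esym; exact: jacobianP.
Qed.

End Slices.
Arguments spacetime : clear implicits.

Section LocalFields.
Context {R : realType} {n : nat} {M : closedManifold R n}.
Context (T : \bar R) (F : M -> R -> 'rV[R]_n.+1) (hF : rescaled_MCF T F).
Context (sg : R) (hsg : sg = 1 \/ sg = -1).
Hypothesis sgH : forall t, time_interval T t ->
  forall p, 0 < sg * rescaled_mean_curvature (F ^~ t) p.

Local Notation H t p := (rescaled_mean_curvature (F ^~ t) p).
Local Notation nu t p := (unit_normal (F ^~ t) p).

Let H0 t p : time_interval T t -> H t p != 0.
Proof.
by move=> /sgH/(_ p)/lt0r_neq0; rewrite mulf_eq0 negb_or => /andP[].
Qed.

Lemma open_time : open [set t : R | (t%:E < T)%E].
Proof.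
case: T => [r||].
- rewrite (_ : [set _ | _] = [set t : R | t < r]); first exact: open_lt.
  by apply/funext => t; rewrite /= lte_fin.
- rewrite (_ : [set _ | _] = setT); first exact: openT.
  by apply/funext => t; apply/propext; split => // _; rewrite /= ltry.
- rewrite (_ : [set _ | _] = set0); first exact: open0.
  by apply/funext => t; apply/propext; split => //=; rewrite ltNge leNye.
Qed.

(** The extension g has a two-sided time derivative, the flow possibly only a one-sided one. Both
    are limits along the increments that stay in [0, T), hence equal. *)
Lemma velocity (c : chart R n M) (U : set (spacetime R n)) g z t :
  open U -> Ck 1 U g -> U (z, t) -> chart_cod c z -> time_interval T t ->
  (forall y s, U (y, s) -> chart_cod c y -> time_interval T s ->
    g (y, s) = F (chart_inv c y) s) ->
  'D_time_dir g (z, t) = - (H t (chart_inv c z) *: nu t (chart_inv c z)).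
Proof.
move=> oU [dg _] Uz cz tT gF; have [_ _ ht] := hF.
have {}ht := ht (chart_inv c z) t tT.
pose D := [set h : R | time_interval T (t + h)].
(* Uniqueness of the limit needs arbitrarily small admissible increments; small positive ones exist
   even at t = 0. *)
have pD : ProperFilter (within D (0 : R)^').
  apply: Build_ProperFilter_ex => P /nbhs_ballP[e /= e0 he].
  have [t0 tT'] := tT.
  have : nbhs t [set s : R | (s%:E < T)%E].
    by apply: open_nbhs_nbhs; split => //; exact: open_time.
  move=> /nbhs_ballP[e' /= e'0 he'].
  pose h := Num.min e e' / 2.
  have m0 : 0 < Num.min e e' by rewrite lt_min e0.
  have h0 : 0 < h by rewrite divr_gt0.
  have /andP[h1 h2] : (h < e) && (h < e').
    by rewrite -lt_min ltr_pdivrMr// ltr_pMr// ltr1n.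
  exists h; apply: he; rewrite /ball /= ?sub0r ?normrN ?gtr0_norm//.
    exact: lt0r_neq0.
  split; first by rewrite addr_ge0// ltW.
  by apply: he'; rewrite /ball /= opprD addrA subrr sub0r normrN gtr0_norm.
have dgz : derivable g (z, t) time_dir by apply: diff_derivable; exact: dg.
suff hl : (fun h : R => h^-1 *: (F (chart_inv c z) (t + h) - F (chart_inv c z) t))
    @ within D (0 : R)^' --> 'D_time_dir g (z, t).
  apply: (etrans (esym (@cvg_lim _ (@norm_hausdorff _ _) _ _ pD _ _ hl))).
  exact: (@cvg_lim _ (@norm_hausdorff _ _) _ _ pD _ _ ht).
have : (fun h : R => h^-1 *: ((g \o shift (z, t)) (h *: time_dir) - g (z, t)))
    @ within D (0 : R)^' --> 'D_time_dir g (z, t).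
  by apply: cvg_trans dgz; apply: cvg_app; exact: cvg_within.
have nU : \forall h \near (0 : R)^', U (z, t + h).
  have : nbhs (0 : R) [set h | U ((z, t) + h *: time_dir)].
    apply: (@continuous_line R _ (z, t) time_dir 0).
    by rewrite scale0r addr0; exact: open_nbhs_nbhs.
  move=> /(@nbhs_dnbhs R 0).
  apply: (@filterS _ (0 : R)^') => h /=.
  rewrite (_ : (z, t) + _ = (z, t + h))// [LHS]surjective_pairing.
  by congr (_, _); rewrite /= ?scaler0 ?addr0// [_ *: _]mulr1.
suff e : {near within D (0 : R)^',
    (fun h : R => h^-1 *: ((g \o shift (z, t)) (h *: time_dir) - g (z, t))) =1
    (fun h : R => h^-1 *: (F (chart_inv c z) (t + h) - F (chart_inv c z) t))}.
  exact: (cvg_trans (near_eq_cvg e)).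
apply: (@filterS _ (0 : R)^' _ _ _ _ nU) => h Uh Dh.
have <- := gF _ _ Uz cz tT; have <- := gF _ _ Uh cz Dh.
congr (_ *: (g _ - _)); rewrite [RHS]surjective_pairing.
by congr (_, _); rewrite /= ?scaler0 ?add0r// addrC [_ *: _]mulr1.
Qed.

(** The open set U may reach beyond t = 0. There g, N and phi are mere extensions satisfying the
    unit and velocity equations; only at times in [0, T) are they tied to the flow. *)
Record local_fields (c : chart R n M) (U : set (spacetime R n))
    (g N : spacetime R n -> 'rV[R]_n.+1) (phi : spacetime R n -> R) : Prop :=
  LocalFields {
  fields_atlas : atlas c;
  fields_open : open U;
  fields_Cg : Ck 2 U g;
  fields_CN : Ck 2 U N;
  fields_Cphi : Ck 2 U phi;
  fields_unit : forall x, U x -> dot (N x) (N x) = 1;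
  fields_time : forall x, U x -> 'D_time_dir g x = - (phi x *: N x);
  fields_g : forall z t, U (z, t) -> chart_cod c z -> time_interval T t ->
    g (z, t) = F (chart_inv c z) t;
  fields_N : forall z t, U (z, t) -> chart_cod c z -> time_interval T t ->
    N (z, t) = nu t (chart_inv c z);
  fields_phi : forall z t, U (z, t) -> chart_cod c z -> time_interval T t ->
    phi (z, t) = H t (chart_inv c z)
}.

Lemma exists_local_fields p t : time_interval T t -> exists c U g N phi,
  [/\ local_fields c U g N phi, chart_dom c p & U (chart_map c p, t)].
Proof.
move=> tT; have [sF _ _] := hF.
have [c ac dc] := @atlas_cover _ _ M p.
have cz := chart_map_dom dc.
have [U [g [oU Uz Cg gF]]] := sF c ac (chart_map c p, t) (conj cz tT).
have {}gF z s : U (z, s) -> chart_cod c z -> time_interval T s ->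
    g (z, s) = F (chart_inv c z) s.
  by move=> Us cs Ts; rewrite -(gF (z, s) (conj cs Ts) Us).
pose V := 'D_time_dir g; pose q x := dot (V x) (V x).
have CV k : Ck k U V by case: (Cg k.+1) => _ /(_ time_dir).
have Cq k : Ck k U q := Ck_dot oU (CV k) (CV k).
(* Where the velocity is nonzero, its length is smooth and can be divided by. *)
pose U1 := U `&` [set x | 0 < q x].
have oU1 : open U1.
  rewrite openE => x [Ux qx].
  have nU : nbhs x U by exact: open_nbhs_nbhs.
  have nq : nbhs x [set y | 0 < q y].
    apply: (Cq 0%N x Ux [set s | 0 < s]).
    by apply: open_nbhs_nbhs; split => //; exact: open_gt.
  exact: filterI.
have U1U : U1 `<=` U by move=> x [].
have q0 x : U1 x -> 0 < q x by case.
pose phi x := sg * Num.sqrt (q x).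
pose N x := - (phi x)^-1 *: V x.
have sg2 : sg * sg = 1 by case: hsg => ->; rewrite ?mulrNN mulr1.
have sg0 : sg != 0 by case: hsg => ->; rewrite ?oppr_eq0 oner_eq0.
have phi0 x : U1 x -> phi x != 0.
  by move=> Ux; rewrite mulf_neq0// sqrtr_eq0 -ltNge q0.
have phi2 x : U1 x -> phi x * phi x = q x.
  move=> Ux; rewrite /phi mulrACA sg2 mul1r -expr2 sqr_sqrtr//.
  exact/ltW/q0.
have Cphi k : Ck k U1 phi.
  have c1 := CkM oU1 (@Ck_cst _ _ R k U1 sg)
    (Ck_sqrt oU1 q0 (Ck_sub U1U (Cq k))).
  exact: (Ck_ext oU1 _ c1).
have CN k : Ck k U1 N.
  have c1 := CkM oU1 (@Ck_cst _ _ R k U1 (-1)) (CkV oU1 phi0 (Cphi k)).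
  have c2 := Ck_smul oU1 c1 (Ck_sub U1U (CV k)).
  apply: (Ck_ext oU1 _ c2) => x _.
  by rewrite /N; congr (_ *: _); exact: mulN1r.
have VE z s : U (z, s) -> chart_cod c z -> time_interval T s ->
    V (z, s) = - (H s (chart_inv c z) *: nu s (chart_inv c z)).
  by move=> Us cs Ts; exact: (velocity oU (Cg 1%N) Us cs Ts gF).
have qE z s : U (z, s) -> chart_cod c z -> time_interval T s ->
    q (z, s) = H s (chart_inv c z) ^+ 2.
  move=> Us cs Ts; rewrite /q VE// dotNl dotNr opprK dotZl dotZr.
  by rewrite dot_unit_normal ?H0// mulr1 expr2.
have phiE z s : U (z, s) -> chart_cod c z -> time_interval T s ->
    phi (z, s) = H s (chart_inv c z).
  move=> Us cs Ts; rewrite /phi qE// sqrtr_sqr.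
  have := sgH Ts (chart_inv c z); case: hsg => ->.
    by rewrite !mul1r => h; rewrite gtr0_norm.
  by rewrite !mulN1r oppr_gt0 => h; rewrite ltr0_norm// opprK.
exists c, U1, g, N, phi; split => //; last first.
  split => //; rewrite /= qE// exprn_even_gt0//=.
  exact: H0.
split => //.
- exact: Ck_sub U1U (Cg 2%N).
- move=> x Ux; rewrite /N dotZl dotZr -/(q x) -phi2//.
  have := phi0 x Ux; move: (phi x) => f f0; field.
  exact: f0.
- by move=> x Ux; rewrite /N scalerA mulrN mulfV ?phi0// scaleN1r opprK.
- by move=> z s [Us _]; exact: gF.
- move=> z s [Us _] cs Ts; rewrite /N phiE// VE// scalerN scaleNr opprK scalerA.
  by rewrite mulVf ?H0// scale1r.
- by move=> z s [Us _]; exact: phiE.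
Qed.

Section Patch.
Context (c : chart R n M) (U : set (spacetime R n))
  (g N : spacetime R n -> 'rV[R]_n.+1) (phi : spacetime R n -> R).
Hypothesis lf : local_fields c U g N phi.

Lemma near_fields z t : U (z, t) -> chart_cod c z ->
  \forall y \near z, U (y, t) /\ chart_cod c y.
Proof.
move=> Uz cz.
have nc : \forall y \near z, chart_cod c y.
  by apply: open_nbhs_nbhs; split => //; exact: chart_cod_open.
have nU : \forall y \near z, U (y, t).
  have ct : (fun y : 'rV[R]_n => (y, t)) @ z --> (z, t).
    exact: (differentiable_continuous (slice_differentiable z t)).
  by apply: ct; apply: open_nbhs_nbhs; split => //; exact: (fields_open lf).
exact: (@filterS2 _ (nbhs z) _ _ _ _ (fun y a b => conj a b) nU nc).
Qed.

Lemma fields_jac z t : U (z, t) -> chart_cod c z -> time_interval T t ->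
  jac space_dir g (z, t) = 'J ((F ^~ t) \o chart_inv c) z.
Proof.
move=> Uz cz tT; apply: slice_jacobian; last by case: (fields_Cg lf) => + _; exact.
apply: (@filterS _ (nbhs z) _ _ _ _ (near_fields Uz cz)) => y [Uy cy].
by rewrite (fields_g lf).
Qed.

Lemma fields_gram z t : U (z, t) -> chart_cod c z -> time_interval T t ->
  gram space_dir g (z, t) \in unitmx.
Proof.
move=> Uz cz tT; rewrite /gram fields_jac//.
have [_ /(_ t tT)[_ im _] _] := hF.
exact: (immersion_gram im (fields_atlas lf) cz).
Qed.

Lemma fields_trace z t : U (z, t) -> chart_cod c z -> time_interval T t ->
  \tr (weingarten space_dir g N (z, t)) - dot (g (z, t)) (N (z, t)) / 2 =
  phi (z, t).
Proof.
move=> Uz cz tT; rewrite (fields_phi lf)// (fields_g lf)// (fields_N lf)//.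
congr (_ - _); rewrite /mean_curvature.
have [_ /(_ t tT)[sm im _] _] := hF.
have dz := chart_inv_cod cz.
have zE := chart_invK cz.
have dN := slice_derive _ (proj1 (fields_CN lf) _ Uz).
have eN : \forall y \near z, (unit_normal (F ^~ t) \o chart_inv c) y = N (y, t).
  apply: (@filterS _ (nbhs z) _ _ _ _ (near_fields Uz cz)) => y [Uy cy].
  by rewrite (fields_N lf).
have [dNz _] := dN _ eN.
have := @surface_div_chart R n M (F ^~ t) (unit_normal (F ^~ t)) c
  (chart_inv c z) im (fields_atlas lf) dz; rewrite zE.
move=> /(_ (smooth_map_differentiable sm (fields_atlas lf) cz) dNz) ->.
rewrite -(slice_jacobian eN (proj1 (fields_CN lf) _ Uz)) -(fields_jac Uz cz tT).
by rewrite /weingarten /codual -mulmxA mxtrace_mulC -mulmxA.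
Qed.

(** Time is strictly positive, which makes the set open while all its points still belong to the
    flow, so the geometric identities hold throughout. *)
Definition patch_dom : set (spacetime R n) :=
  U `&` [set x | chart_cod c x.1] `&` [set x | 0 < x.2] `&`
  [set x | (x.2%:E < T)%E].

Lemma patch_dom_time x : patch_dom x ->
  [/\ U (x.1, x.2), chart_cod c x.1 & time_interval T x.2].
Proof. by move=> [[[Ux cx] x0] xT]; split => //; [case: x Ux {cx x0 xT}|split => //; exact: ltW]. Qed.

Lemma fields_patch : flow_patch space_dir time_dir patch_dom g N phi.
Proof.
have oP : open patch_dom.
  apply: openI; first apply: openI; first apply: openI.
  - exact: (fields_open lf).
  - by apply: open_comp; [move=> x _; exact: cvg_fst|exact: chart_cod_open].
  - by apply: (@open_comp _ _ snd [set s : R | 0 < s]);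
      [move=> x _; exact: cvg_snd|exact: open_gt].
  - by apply: (@open_comp _ _ snd [set s : R | (s%:E < T)%E]);
      [move=> x _; exact: cvg_snd|exact: open_time].
have PU : patch_dom `<=` U by move=> x [[[]]].
split => //.
- exact: Ck_sub PU (fields_Cg lf).
- exact: Ck_sub PU (fields_CN lf).
- exact: Ck_sub PU (fields_Cphi lf).
- by move=> x /PU; exact: (fields_unit lf).
- move=> [z t] v /patch_dom_time /= [Ux cx tT].
  rewrite (fields_N lf)//.
  have eg : \forall y \near z, ((F ^~ t) \o chart_inv c) y = g (y, t).
    apply: (@filterS _ (nbhs z) _ _ _ _ (near_fields Ux cx)) => y [Uy cy].
    by rewrite (fields_g lf).
  have [_ <-] := slice_derive eg (proj1 (fields_Cg lf) _ Ux).
  have [[_ nv _] _] := unit_normal_unique (H0 (chart_inv c z) tT).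
  have := nv c (fields_atlas lf) (chart_inv_cod cx) v.
  by rewrite chart_invK.
- by move=> x /PU; exact: (fields_time lf).
- by move=> [z t] /patch_dom_time[Ux cx tT]; exact: fields_gram.
- by move=> [z t] /patch_dom_time[Ux cx tT]; exact: fields_trace.
Qed.

End Patch.
End LocalFields.

(** * Compactness *)

Section FrameContinuity.
Context {R : realType} {n : nat} {E : normedModType R}.
Context (sdir : {linear 'rV[R]_n -> E}) (U : set E).
Context (G N : E -> 'rV[R]_n.+1) (phi : E -> R) (z : E).
Hypotheses (oU : open U) (Uz : U z) (CG : Ck 2 U G) (CN : Ck 2 U N)
  (Cphi : Ck 2 U phi) (ug : gram sdir G z \in unitmx).

Lemma cvg_weingarten : weingarten sdir G N y @[y --> z] --> weingarten sdir G N z.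
Proof.
apply: cvg_mulmx; first exact: (cvg_codual Uz (CkW CG) ug).
by apply: cvg_jac Uz _; exact: CkW.
Qed.

Lemma cvg_frame_grad : frame_grad sdir G phi y @[y --> z] --> frame_grad sdir G phi z.
Proof.
have e y : U y -> frame_grad sdir G phi y =
    \row_i \sum_j codual sdir G y i j * 'D_(sdir (delta_mx 0 j)) phi y.
  move=> Uy; apply/rowP => i; rewrite !mxE.
  rewrite -[row i _]mulmx1 sdir_mul; last by case: Cphi => + _; exact.
  by apply: eq_bigr => j _; rewrite row1 mxE.
rewrite e//; apply: cvg_trans (near_eq_cvg _) _.
  have nU : \forall y \near z, U y by exact: open_nbhs_nbhs.
  exact: (@filterS _ (nbhs z) _ _ _ (fun y Uy => esym (e y Uy)) nU).
have cU := cvg_codual Uz (CkW CG) ug.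
apply/cvg_mxP => i j; rewrite mxE.
under eq_fun do rewrite mxE.
apply: (@cvg_sum _ _ (nbhs z) _ _ (index_enum _) (fun k y =>
  codual sdir G y j k * 'D_(sdir (delta_mx 0 k)) phi y)).
move=> k; apply: cvgM; first by move/cvg_mxP : cU; exact.
have h : Ck 0 U ('D_(sdir (delta_mx 0 k)) phi).
  by apply: CkW; case: Cphi => _ /(_ (sdir (delta_mx 0 k))).
exact: (h z Uz).
Qed.

End FrameContinuity.

(** A monotone predicate replaces a function because the curvature bounds concern fields that exist
    only locally. *)
Lemma compact_uniform_bound {R : realType} {X : topologicalType} (K : set X)
    (P : R -> X -> Prop) : compact K ->
  (forall B B' x, B <= B' -> P B x -> P B' x) ->
  (forall x, K x -> exists B, \forall y \near x, P B y) ->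
  exists B, forall x, K x -> P B x.
Proof.
move=> /compact_near_coveringP cK mono loc.
have : \forall B \near pinfty_nbhs R, K `<=` P B.
  apply: cK => x /loc[B hB].
  exists ([set y | P B y], [set B' | B <= B']) => /=.
    by split => //; apply: nbhs_pinfty_ge; exact: num_real.
  by move=> [y B'] /= [Py BB']; exact: mono BB' Py.
move=> [B [_ h]]; exists (B + 1); apply: h; rewrite /= ltrDl.
exact: ltr01.
Qed.

Section Clipped.
Context {R : realType} {n : nat} {M : closedManifold R n}.
Context (T : \bar R) (F : M -> R -> 'rV[R]_n.+1) (hF : rescaled_MCF T F).
Context (sg : R) (hsg : sg = 1 \/ sg = -1).
Hypothesis sgH : forall t, time_interval T t ->
  forall p, 0 < sg * rescaled_mean_curvature (F ^~ t) p.
Context (t1 : R) (t1T : time_interval T t1).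

Local Notation H t p := (rescaled_mean_curvature (F ^~ t) p).
Local Notation nu t p := (unit_normal (F ^~ t) p).

(* Extends functions of time continuously from [0, t1] to the real line. *)
Definition clip (s : R) : R := Num.max 0 (Num.min s t1).

Let t10 : 0 <= t1 := proj1 t1T.

Lemma clip_itv s : 0 <= clip s <= t1.
Proof. by rewrite /clip le_max lexx ge_max t10 ge_min lexx orbT. Qed.

Lemma clip_id s : 0 <= s <= t1 -> clip s = s.
Proof. by move=> /andP[s0 s1]; rewrite /clip min_l// max_r. Qed.

Lemma itv_time s : 0 <= s <= t1 -> time_interval T s.
Proof.
move=> /andP[s0 s1]; split => //; have [_ +] := t1T.
by apply: le_lt_trans; rewrite lee_fin.
Qed.

Lemma clip_time s : time_interval T (clip s).
Proof. exact/itv_time/clip_itv. Qed.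

Lemma clip_continuous : continuous clip.
Proof.
move=> s.
have hm : {for s, continuous ((id : R -> R^o) \min (cst t1 : R -> R^o))}.
  by apply: continuous_min; [exact: cvg_id|exact: cst_continuous].
have := @continuous_max _ _ (cst 0 : R -> R^o) _ s (@cst_continuous _ _ _ _) hm.
exact.
Qed.

Section ClipChart.
Context (c : chart R n M) (U : set (spacetime R n))
  (g N : spacetime R n -> 'rV[R]_n.+1) (phi : spacetime R n -> R).
Hypothesis lf : local_fields T F c U g N phi.
Context (x : M * R) (cx : chart_dom c x.1) (Ux : U (chart_map c x.1, clip x.2)).

Definition clip_chart (y : M * R) : spacetime R n := (chart_map c y.1, clip y.2).

Lemma cvg_clip_chart : clip_chart y @[y --> x] --> clip_chart x.
Proof.
have h1 : (fun y : M * R => chart_map c y.1) @ x --> chart_map c x.1.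
  apply: (@cvg_comp _ _ _ fst (chart_map c) _ (nbhs x.1)); first exact: cvg_fst.
  exact: chart_map_continuous_at.
have h2 : (fun y : M * R => clip y.2) @ x --> clip x.2.
  apply: (@cvg_comp _ _ _ snd clip _ (nbhs x.2)); first exact: cvg_snd.
  exact: clip_continuous.
exact: (@cvg_pair _ _ _ (nbhs x) _ _ _ _ _ (fun y : M * R => chart_map c y.1)
  (fun y : M * R => clip y.2) h1 h2).
Qed.

Lemma near_clip_chart : \forall y \near x, chart_dom c y.1 /\ U (clip_chart y).
Proof.
have h1 : \forall y \near x, chart_dom c y.1.
  by apply: cvg_fst; apply: open_nbhs_nbhs; split => //; exact: chart_dom_open.
have h2 : \forall y \near x, U (clip_chart y).
  by apply: cvg_clip_chart; apply: open_nbhs_nbhs; split => //;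
    exact: (fields_open lf).
exact: (@filterS2 _ (nbhs x) _ _ _ _ (fun y a b => conj a b) h1 h2).
Qed.

Lemma cvg_clip (X : topologicalType) (f : M * R -> X) (h : spacetime R n -> X) :
  (forall y, chart_dom c y.1 -> U (clip_chart y) -> h (clip_chart y) = f y) ->
  h w @[w --> clip_chart x] --> h (clip_chart x) -> f @ x --> f x.
Proof.
move=> fh hc; rewrite -fh//.
apply: cvg_trans (cvg_comp _ _ cvg_clip_chart hc).
apply: near_eq_cvg.
by apply: (@filterS _ (nbhs x) _ _ _ _ near_clip_chart) => y [] /fh; apply.
Qed.

End ClipChart.

Let fields_at (x : M * R) : exists c U g N phi,
  [/\ local_fields T F c U g N phi, chart_dom c x.1 &
      U (chart_map c x.1, clip x.2)].
Proof. exact: (exists_local_fields hF hsg sgH x.1 (clip_time x.2)). Qed.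

Lemma continuous_clip_F : continuous (fun x : M * R => F x.1 (clip x.2)).
Proof.
move=> x; have [c [U [g [N [phi [lf cx Ux]]]]]] := fields_at x.
apply: (cvg_clip lf cx Ux (h := g)).
  move=> y cy Uy; rewrite (fields_g lf) ?chart_mapK//; first exact: chart_map_dom.
  exact: clip_time.
exact: differentiable_continuous (proj1 (fields_Cg lf) _ Ux).
Qed.

Lemma continuous_clip_N : continuous (fun x : M * R => nu (clip x.2) x.1).
Proof.
move=> x; have [c [U [g [N [phi [lf cx Ux]]]]]] := fields_at x.
apply: (cvg_clip lf cx Ux (h := N)).
  move=> y cy Uy; rewrite (fields_N lf) ?chart_mapK//; first exact: chart_map_dom.
  exact: clip_time.
exact: differentiable_continuous (proj1 (fields_CN lf) _ Ux).
Qed.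

Lemma continuous_clip_H : continuous (fun x : M * R => H (clip x.2) x.1).
Proof.
move=> x; have [c [U [g [N [phi [lf cx Ux]]]]]] := fields_at x.
apply: (cvg_clip lf cx Ux (h := phi)).
  move=> y cy Uy; rewrite (fields_phi lf) ?chart_mapK//; first exact: chart_map_dom.
  exact: clip_time.
exact: differentiable_continuous (proj1 (fields_Cphi lf) _ Ux).
Qed.

Let proj_left : continuous (fun x : (M * M) * R => (x.1.1, x.2)).
Proof.
move=> x; have h1 : (fun y : (M * M) * R => y.1.1) @ x --> x.1.1.
  apply: (@cvg_comp _ _ _ fst fst _ (nbhs x.1)); first exact: cvg_fst.
  exact: cvg_fst.
have h2 : (fun y : (M * M) * R => y.2) @ x --> x.2 by exact: cvg_snd.
exact: (@cvg_pair _ _ _ (nbhs x) _ _ _ _ _ (fun y : (M * M) * R => y.1.1)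
  (fun y : (M * M) * R => y.2) h1 h2).
Qed.

Let proj_right : continuous (fun x : (M * M) * R => (x.1.2, x.2)).
Proof.
move=> x; have h1 : (fun y : (M * M) * R => y.1.2) @ x --> x.1.2.
  apply: (@cvg_comp _ _ _ fst snd _ (nbhs x.1)); first exact: cvg_fst.
  exact: cvg_snd.
have h2 : (fun y : (M * M) * R => y.2) @ x --> x.2 by exact: cvg_snd.
exact: (@cvg_pair _ _ _ (nbhs x) _ _ _ _ _ (fun y : (M * M) * R => y.1.2)
  (fun y : (M * M) * R => y.2) h1 h2).
Qed.

Let comp_continuous (X Y Z : topologicalType) (f : X -> Y) (g : Y -> Z) :
  continuous f -> continuous g -> continuous (fun x => g (f x)).
Proof. by move=> cf cg x; exact: (continuous_comp (cf x) (cg (f x))). Qed.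

Lemma continuous_clip_H_left : continuous (fun x : (M * M) * R =>
  H (clip x.2) x.1.1).
Proof. by move=> x; exact: (@comp_continuous _ _ _ _ _ proj_left continuous_clip_H x). Qed.

Lemma continuous_clip_N_left : continuous (fun x : (M * M) * R =>
  nu (clip x.2) x.1.1).
Proof. by move=> x; exact: (@comp_continuous _ _ _ _ _ proj_left continuous_clip_N x). Qed.

Lemma continuous_clip_N_right : continuous (fun x : (M * M) * R =>
  nu (clip x.2) x.1.2).
Proof. by move=> x; exact: (@comp_continuous _ _ _ _ _ proj_right continuous_clip_N x). Qed.

Lemma continuous_clip_diff : continuous (fun x : (M * M) * R =>
  F x.1.2 (clip x.2) - F x.1.1 (clip x.2)).
Proof.
move=> x.
have h1 : (fun y : (M * M) * R => F y.1.1 (clip y.2)) @ x -->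
    F x.1.1 (clip x.2) by exact: (@comp_continuous _ _ _ _ _ proj_left continuous_clip_F x).
have h2 : (fun y : (M * M) * R => F y.1.2 (clip y.2)) @ x -->
    F x.1.2 (clip x.2) by exact: (@comp_continuous _ _ _ _ _ proj_right continuous_clip_F x).
exact: (cvgB h2 h1).
Qed.

Lemma continuous_clip_separation (kappa : R) : continuous (fun x : (M * M) * R =>
  separation kappa (F ^~ (clip x.2)) x.1.1 x.1.2).
Proof.
move=> x; have hd := @continuous_clip_diff x.
have hH := @continuous_clip_H_left x.
have hN := @continuous_clip_N_left x.
apply: cvgD; apply: cvgM.
- by apply: cvgM; [exact: cvg_cst|exact: hH].
- exact: (cvg_dot hd hd).
- exact: cvg_cst.
- exact: (cvg_dot hd hN).
Qed.

End Clipped.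

Lemma replace_right_continuous {R : realType} {X : topologicalType} (r : X)
    (x : (X * X) * R) :
  (fun y : (X * X) * R => ((y.1.1, r), y.2)) @ x --> ((x.1.1, r), x.2).
Proof.
have h1 : (fun y : (X * X) * R => y.1.1) @ x --> x.1.1.
  apply: (@cvg_comp _ _ _ fst fst _ (nbhs x.1)); first exact: cvg_fst.
  exact: cvg_fst.
have h2 : (fun y : (X * X) * R => (y.1.1, r)) @ x --> (x.1.1, r).
  exact: (@cvg_pair _ _ _ (nbhs x) _ _ _ _ _ (fun y : (X * X) * R => y.1.1)
    (fun=> r) h1 (cvg_cst _)).
have h3 : (fun y : (X * X) * R => y.2) @ x --> x.2 by exact: cvg_snd.
exact: (@cvg_pair _ _ _ (nbhs x) _ _ _ _ _ (fun y : (X * X) * R => (y.1.1, r))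
  (fun y : (X * X) * R => y.2) h2 h3).
Qed.

Lemma continuous_compact_bound {R : realType} {X : topologicalType} (K : set X)
    (f : X -> R) : compact K -> continuous f ->
  exists2 B, 0 <= B & forall x, K x -> f x <= B.
Proof.
move=> cK cf.
have loc x : K x -> exists B, \forall y \near x, `|f y| <= B.
  move=> _; exists (`|f x| + 1).
  have : \forall y \near x, `|f x - f y| < 1.
    by have /cvgrPdist_lt := cf x; apply; exact: ltr01.
  apply: (@filterS _ (nbhs x)) => y hy.
  have -> : f y = f x - (f x - f y) by rewrite opprB addrC subrK.
  by rewrite (le_trans (ler_normB _ _))// lerD// ltW.
have [B hB] := compact_uniform_bound cK
  (fun B B' x (BB' : B <= B') (h : `|f x| <= B) => le_trans h BB') loc.
exists (Num.max 0 B); first by rewrite le_max lexx.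
by move=> x /hB; rewrite le_max => /(le_trans (ler_norm _)) ->; rewrite orbT.
Qed.

Lemma compact_pairs_itv {R : realType} {n : nat} {M : closedManifold R n}
  (a b : R) : compact ([set: M * M] `*` `[a, b] : set ((M * M) * R)).
Proof.
apply: compact_setX; last exact: segment_compact.
have -> : [set: M * M] = [set: M] `*` [set: M] by apply/seteqP; split.
by apply: compact_setX; exact: manifold_compact.
Qed.

(** * Uniform bounds and the normals at a spatial minimum *)

Section MaximumPrinciple.
Context {R : realType} {n : nat} {M : closedManifold R n}.
Context (T : \bar R) (F : M -> R -> 'rV[R]_n.+1) (hF : rescaled_MCF T F).
Context (sg : R) (hsg : sg = 1 \/ sg = -1).
Hypothesis sgH : forall t, time_interval T t ->
  forall p, 0 < sg * rescaled_mean_curvature (F ^~ t) p.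
Context (t1 : R) (t1T : time_interval T t1).
Context (delta : R) (delta0 : 0 < delta).

Local Notation H t p := (rescaled_mean_curvature (F ^~ t) p).
Local Notation nu t p := (unit_normal (F ^~ t) p).
Local Notation kappa := (sg / delta).
Local Notation sep t p q := (separation kappa (F ^~ t) p q).

Let H0 t p : time_interval T t -> H t p != 0.
Proof.
by move=> /sgH/(_ p)/lt0r_neq0; rewrite mulf_eq0 negb_or => /andP[].
Qed.

Let k0 t p : time_interval T t -> 0 < kappa * H t p.
Proof. by move=> tT; rewrite mulrAC divr_gt0// sgH. Qed.

(** The quantities |A|^2 and |grad phi|^2 are available only through local fields, so each point
    receives fields together with the bounds, and B alone is uniform. *)
Lemma fields_bound : exists B, forall p s, 0 <= s <= t1 -> exists c U g N phi,
  [/\ local_fields T F c U g N phi, chart_dom c p, U (chart_map c p, s),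
   \tr (weingarten space_dir g N (chart_map c p, s) *m
        (weingarten space_dir g N (chart_map c p, s))^T) <= B &
   dot (frame_grad space_dir g phi (chart_map c p, s))
       (frame_grad space_dir g phi (chart_map c p, s)) <= B].
Proof.
pose P B (x : M * R) := exists c U g N phi,
  [/\ local_fields T F c U g N phi, chart_dom c x.1,
   U (clip_chart t1 c x),
   \tr (weingarten space_dir g N (clip_chart t1 c x) *m
        (weingarten space_dir g N (clip_chart t1 c x))^T) <= B &
   dot (frame_grad space_dir g phi (clip_chart t1 c x))
       (frame_grad space_dir g phi (clip_chart t1 c x)) <= B].
have [||x _|B hB] := @compact_uniform_bound R _
    ([set: M] `*` `[0, t1]) P.
- by apply: compact_setX; [exact: manifold_compact|exact: segment_compact].
- move=> B B' x BB' [c [U [g [N [phi [lf cx Ux h1 h2]]]]]].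
  exists c, U, g, N, phi; split => //; exact: le_trans BB'.
- have xT := clip_time t1T x.2.
  have [c [U [g [N [phi [lf cx Ux]]]]]] := exists_local_fields hF hsg sgH x.1 xT.
  have ug := fields_gram hF lf Ux (chart_map_dom cx) xT.
  have cm : clip_chart t1 c y @[y --> x] --> clip_chart t1 c x.
    exact: cvg_clip_chart.
  have cS := cvg_comp _ _ cm (cvg_weingarten Ux (fields_Cg lf) (fields_CN lf) ug).
  have cK := cvg_comp _ _ cm (cvg_frame_grad (fields_open lf) Ux (fields_Cg lf)
    (fields_Cphi lf) ug).
  pose a y := \tr (weingarten space_dir g N (clip_chart t1 c y) *m
        (weingarten space_dir g N (clip_chart t1 c y))^T).
  pose b y := dot (frame_grad space_dir g phi (clip_chart t1 c y))
       (frame_grad space_dir g phi (clip_chart t1 c y)).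
  have ca : a @ x --> a x.
    by apply: cvg_mxtrace; apply: cvg_mulmx => //; exact: cvg_trmx.
  have cb : b @ x --> b x by exact: (cvg_dot cK cK).
  exists (Num.max (a x) (b x) + 1).
  have na : \forall y \near x, a y < a x + 1.
    apply: (ca [set t | t < a x + 1]); apply: open_nbhs_nbhs.
    by split; [exact: open_lt|rewrite /= ltrDl].
  have nb : \forall y \near x, b y < b x + 1.
    apply: (cb [set t | t < b x + 1]); apply: open_nbhs_nbhs.
    by split; [exact: open_lt|rewrite /= ltrDl].
  have nc := near_clip_chart lf cx Ux.
  apply: (@filterS3 _ (nbhs x) _ _ _ _ _ _ nc na nb) => y [cy Uy] ay by_.
  exists c, U, g, N, phi; split => //.
    by rewrite (le_trans (ltW ay))// lerD2r le_max lexx.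
  by rewrite (le_trans (ltW by_))// lerD2r le_max lexx orbT.
exists B => p s s01.
have [|c [U [g [N [phi]]]]] := hB (p, s); first by split => //=; rewrite in_itv.
by rewrite /clip_chart /= clip_id// => h; exists c, U, g, N, phi.
Qed.

Let centreE t p q (tT : time_interval T t) :
  let c := F p t - (kappa * H t p)^-1 *: nu t p in
  (kappa * H t p) *: (F q t - c) = (kappa * H t p) *: (F q t - F p t) + nu t p.
Proof.
move=> c; rewrite /c opprB addrCA scalerDr scalerA mulfV.
  by rewrite scale1r; exact: addrC.
exact: (lt0r_neq0 (k0 p tT)).
Qed.

(** With c the centre of the inner ball at p, the left side is k (F q - c), and minimizing the
    separation in q means minimizing the distance to c. *)
Lemma normal_at_min t p q : time_interval T t ->
  (forall r, sep t p q <= sep t p r) ->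
  (kappa * H t p) *: (F q t - F p t) + nu t p =
  dot ((kappa * H t p) *: (F q t - F p t) + nu t p) (nu t q) *: nu t q.
Proof.
move=> tT hmin; have [_ /(_ t tT)[sm im _] _] := hF.
set c := F p t - (kappa * H t p)^-1 *: nu t p.
have kp := k0 p tT.
have out r : dot (F q t - c) (F q t - c) <= dot (F r t - c) (F r t - c).
  have := hmin r; rewrite !(separationE _ (H0 p tT) (lt0r_neq0 kp)).
  by rewrite ler_pM2l// lerD2r.
have [[_ nv _] _] := unit_normal_unique (H0 q tT).
have := @normal_direction R n M (F ^~ t) q _ c sm im
  (dot_unit_normal (H0 q tT)) nv out.
by move=> e; rewrite -(centreE _ _ tT) /= -/c dotZl -[RHS]scalerA -e.
Qed.

(** The enclosed inner ball at p also touches the hypersurface at q. Its centre is on the inner side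
    there, since on the outer side the ball would contain exterior points; this fixes the sign of
    the normal. *)
Lemma normal_at_zero t p q : time_interval T t ->
  (forall r, 0 <= sep t p r) -> sep t p q = 0 ->
  (kappa * H t p) *: (F q t - F p t) + nu t p = nu t q.
Proof.
move=> tT hge h0; have [_ /(_ t tT)[sm im _] _] := hF.
set c := F p t - (kappa * H t p)^-1 *: nu t p.
have kp := k0 p tT; set r := (kappa * H t p)^-1.
have r0 : 0 < r by rewrite invr_gt0.
have sepE x : sep t p x =
    kappa * H t p * (dot (F x t - c) (F x t - c) - r ^+ 2).
  by rewrite exprVn; exact: (separationE x (H0 p tT) (lt0r_neq0 kp)).
have out x : r ^+ 2 <= dot (F x t - c) (F x t - c).
  by have := hge x; rewrite sepE pmulr_rge0// subr_ge0.
have qr : dot (F q t - c) (F q t - c) = r ^+ 2.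
  move: h0; rewrite sepE => /eqP; rewrite mulf_eq0 (negbTE (lt0r_neq0 kp)) /=.
  by rewrite subr_eq0 => /eqP.
have Bs : eball c r `<=` enclosed (F ^~ t).
  apply: (interior_touching_ball r0 (unit_normal_unique (H0 p tT))).
  move=> y /(eballE _ _ r0) h [x _ ex]; move: h; rewrite -ex ltNge.
  by rewrite out.
have [[v1 nv ov] uv] := unit_normal_unique (H0 q tT).
have vv := dot_unit_normal (H0 q tT).
have out' x : dot (F q t - c) (F q t - c) <= dot (F x t - c) (F x t - c).
  by rewrite qr.
have := @normal_direction R n M (F ^~ t) q _ c sm im vv nv out'.
set lam := dot _ _ => fc.
have lam2 : lam ^+ 2 = r ^+ 2.
  by rewrite -qr fc dotZl dotZr vv mulr1 expr2.
have {lam2} : lam == r \/ lam == - r by apply/orP; rewrite -eqf_sqr lam2.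
case=> /eqP lamr; rewrite {}lamr in fc; last first.
  exfalso.
  apply: (@exterior_touching_ball R n M (F ^~ t) q _ r r0 (And3 v1 nv ov)).
  suff <- : c = F q t + r *: nu t q by [].
  by rewrite -[r *: _]opprK -scaleNr -fc opprB addrC subrK.
rewrite -(centreE _ _ tT) /= -/c fc scalerA mulfV ?scale1r//.
exact: lt0r_neq0.
Qed.

Local Notation K3 := ([set: M * M] `*` `[0, t1]).

Let compact_K3 : compact (K3 : set ((M * M) * R)) :=
  @compact_pairs_itv R n M 0 t1.

Local Notation csep x :=
  (separation kappa (F ^~ (clip t1 x.2)) x.1.1 x.1.2).

Let csep_continuous : continuous (fun x : (M * M) * R => csep x).
Proof. exact: (continuous_clip_separation hF hsg sgH t1T). Qed.

Let csepE s p q : 0 <= s <= t1 -> csep ((p, q), s) = sep s p q.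
Proof. by move=> s01; rewrite /= clip_id. Qed.

(** The minima in q with nonpositive pairing form a compact set [bad]. The separation is at most 0
    at a minimum, as it vanishes for q = p, and the value 0 would make the pairing 1 by
    [normal_at_zero]. So it is negative on [bad], and its maximum there gives the gap. *)
Lemma orientation_gap : exists2 s0, 0 < s0 & forall s p q, 0 <= s <= t1 ->
  (forall r, sep s p q <= sep s p r) -> - s0 < sep s p q ->
  0 < dot ((kappa * H s p) *: (F q s - F p s) + nu s p) (nu s q).
Proof.
pose pairing (x : (M * M) * R) := dot
  ((kappa * H (clip t1 x.2) x.1.1) *:
    (F x.1.2 (clip t1 x.2) - F x.1.1 (clip t1 x.2)) + nu (clip t1 x.2) x.1.1)
  (nu (clip t1 x.2) x.1.2).
have pairing_continuous : continuous pairing.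
  move=> x; have hd := @continuous_clip_diff R n M T F hF sg hsg sgH t1 t1T x.
  have hH := @continuous_clip_H_left R n M T F hF sg hsg sgH t1 t1T x.
  have hN := @continuous_clip_N_left R n M T F hF sg hsg sgH t1 t1T x.
  have hN' := @continuous_clip_N_right R n M T F hF sg hsg sgH t1 t1T x.
  apply: cvg_dot hN'; apply: cvgD hN.
  by apply: cvgZ hd; apply: cvgM; [exact: cvg_cst|exact: hH].
pose bad : set ((M * M) * R) := K3 `&` ([set x | pairing x <= 0] `&`
  \bigcap_(r in [set: M]) [set x | csep x <= csep ((x.1.1, r), x.2)]).
have cbad : compact bad.
  apply: compact_closedI => //; apply: closedI.
    apply: (@closed_comp _ _ pairing [set t | t <= 0]); last exact: closed_le.
    by move=> x _; exact: pairing_continuous.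
  apply: closed_bigI => r _.
  pose f (x : (M * M) * R) := csep ((x.1.1, r), x.2) - csep x.
  rewrite (_ : [set _ | _] = f @^-1` [set t | 0 <= t]); last first.
    by apply/funext => x; rewrite /f /= subr_ge0.
  apply: closed_comp; last exact: closed_ge.
  move=> x _; apply: cvgB; last exact: csep_continuous.
  apply: (@cvg_comp _ _ _ (fun x : (M * M) * R => ((x.1.1, r), x.2))
    (fun x => csep x) (nbhs x) (nbhs ((x.1.1, r), x.2))).
    exact: replace_right_continuous.
  exact: csep_continuous.
have csep0 (x : (M * M) * R) : csep ((x.1.1, x.1.1), x.2) = 0.
  by rewrite /separation /= subrr !dot0l !mulr0 addr0.
have bad_neg x : bad x -> csep x < 0.
  move=> [[_ x01] [hp hm]]; rewrite lt_neqAle.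
  have hle : csep x <= 0 by rewrite -(csep0 x); exact: hm.
  rewrite hle andbT; apply/eqP => h0.
  have xT := clip_time t1T x.2.
  have hge r : 0 <= sep (clip t1 x.2) x.1.1 r by rewrite -h0; exact: hm.
  have : pairing x <= 0 := hp.
  rewrite /pairing (normal_at_zero xT hge h0).
  by rewrite (dot_unit_normal (H0 x.1.2 xT)) /= leNgt ltr01.
have goodP s0 s p q : 0 <= s <= t1 ->
    (forall r, sep s p q <= sep s p r) -> - s0 < sep s p q ->
    (forall x, bad x -> csep x <= - s0) ->
    0 < dot ((kappa * H s p) *: (F q s - F p s) + nu s p) (nu s q).
  move=> s01 hm hs hb; rewrite ltNge; apply/negP => hle.
  have : bad ((p, q), s).
    split; first by split => //=; rewrite in_itv.
    split; first by rewrite /pairing /= clip_id.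
    by move=> r _; rewrite /= clip_id.
  by move=> /hb; rewrite csepE// leNgt hs.
(* If [bad] is empty, any positive gap will do. *)
have [[x0 bx0]|nbad] := pselect (bad !=set0); last first.
  exists 1 => // s p q s01 hm hs; apply: (goodP _ _ _ _ s01 hm hs) => x bx.
  by exfalso; apply: nbad; exists x.
have [||x1 bx1 hx1] := @compact_EVT_max _ R (fun x => csep x) bad _ cbad _.
- by exists x0.
- exact: continuous_subspaceT.
rewrite inE in bx1; exists (- csep x1); first by rewrite oppr_gt0 bad_neg.
move=> s p q s01 hm hs; apply: (goodP _ _ _ _ s01 hm hs) => x bx.
by rewrite opprK; apply: hx1; rewrite inE.
Qed.

End MaximumPrinciple.

(** * The maximum principle *)

Section Preservation.
Context {R : realType} {n : nat} {M : closedManifold R n}.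
Context (T : \bar R) (F : M -> R -> 'rV[R]_n.+1) (hF : rescaled_MCF T F).
Context (sg : R) (hsg : sg = 1 \/ sg = -1).
Hypothesis sgH : forall t, time_interval T t ->
  forall p, 0 < sg * rescaled_mean_curvature (F ^~ t) p.
Context (t1 : R) (t1T : time_interval T t1).
Context (delta : R) (delta0 : 0 < delta).

Local Notation H t p := (rescaled_mean_curvature (F ^~ t) p).
Local Notation nu t p := (unit_normal (F ^~ t) p).
Local Notation kappa := (sg / delta).
Local Notation sep t p q := (separation kappa (F ^~ t) p q).
Local Notation K3 := ([set: M * M] `*` `[0, t1]).

(** The set of nonpositivity is compact, so time attains its minimum on it. *)
Lemma first_zero (h : (M * M) * R -> R) : continuous h ->
  (forall p q, 0 < h ((p, q), 0)) ->
  (exists2 x, K3 x & h x <= 0) ->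
  exists p q t, [/\ 0 < t <= t1, h ((p, q), t) = 0,
    (forall p' q', 0 <= h ((p', q'), t)) &
    forall p' q' s, 0 <= s < t -> 0 < h ((p', q'), s)].
Proof.
move=> ch h0 [x Kx hx].
pose Z : set ((M * M) * R) := K3 `&` [set y | h y <= 0].
have cZ : compact Z.
  apply: compact_closedI; first exact: compact_pairs_itv.
  apply: (@closed_comp _ _ h [set t | t <= 0]); last exact: closed_le.
  by move=> y _; exact: ch.
have [||[[p q] t] Zt hmin] := @compact_EVT_min _ R (fun y => y.2) Z _ cZ _.
- by exists x.
- by apply: continuous_subspaceT => y; exact: cvg_snd.
rewrite inE in Zt; case: Zt => [[_ /=]]; rewrite in_itv /= => /andP[t0 tt1] ht.
have before p' q' s : 0 <= s < t -> 0 < h ((p', q'), s).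
  move=> /andP[s0 st]; rewrite ltNge; apply/negP => hs.
  have /hmin /= : ((p', q'), s) \in Z.
    rewrite inE; split => //; split => //=.
    by rewrite in_itv /= s0 (le_trans (ltW st)).
  by rewrite leNgt st.
have {t0} t0 : 0 < t.
  rewrite lt_neqAle t0 andbT; apply/eqP => e.
  by move: ht; rewrite /= -e leNgt h0.
(* A negative value at time t would persist at slightly earlier times. *)
have at_t p' q' : 0 <= h ((p', q'), t).
  rewrite leNgt; apply/negP => hneg.
  have cl : (fun s : R => h ((p', q'), s)) @ t --> h ((p', q'), t).
    apply: (@cvg_comp _ _ _ (fun s : R => ((p', q'), s)) h (nbhs t)
      (nbhs ((p', q'), t))); last exact: ch.
    exact: (@cvg_pair _ _ _ (nbhs t) _ _ _ _ _ (fun=> (p', q')) id (cvg_cst _)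
      (@cvg_id _ _)).
  have : nbhs t [set s | h ((p', q'), s) < 0].
    apply: (cl [set r | r < 0]); apply: open_nbhs_nbhs.
    by split; [exact: open_lt|exact: hneg].
  move=> /nbhs_ballP[e /= e0 he].
  pose s := t - Num.min e t / 2.
  have m0 : 0 < Num.min e t by rewrite lt_min e0.
  have /andP[m1 m2] : (Num.min e t / 2 < e) && (Num.min e t / 2 < t).
    by rewrite -lt_min ltr_pdivrMr// ltr_pMr// ltr1n.
  have st : 0 <= s < t.
    by rewrite subr_ge0 (ltW m2) /= ltrBlDr ltrDl divr_gt0.
  have := before p' q' s st; rewrite ltNge => /negP; apply; apply/ltW/he.
  rewrite /ball /= /s opprB addrC subrK ger0_norm//.
  by rewrite divr_ge0// ltW.
exists p, q, t; split => //; first by rewrite t0.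
by apply/eqP; rewrite eq_le ht at_t.
Qed.

Section Step.
Context (c c' : chart R n M) (U U' : set (spacetime R n))
  (g N g' N' : spacetime R n -> 'rV[R]_n.+1) (phi phi' : spacetime R n -> R).
Hypotheses (lf : local_fields T F c U g N phi)
  (lf' : local_fields T F c' U' g' N' phi').

Lemma two_point_separation (y y' : 'rV[R]_n) s :
  patch_dom T c U (y, s) -> patch_dom T c' U' (y', s) ->
  two_point g N g' phi kappa (y, s) (y', s) =
  sep s (chart_inv c y) (chart_inv c' y').
Proof.
move=> /patch_dom_time[Uy cy sT] /patch_dom_time[Uy' cy' _].
rewrite /two_point /separation (fields_g lf Uy cy sT) (fields_g lf' Uy' cy' sT).
by rewrite (fields_N lf Uy cy sT) (fields_phi lf Uy cy sT).
Qed.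

(** Carries [two_point_inequality] to the flow. The function r is [two_point] along the time
    direction, which agrees with the separation as long as both points stay in their patches. *)
Lemma separation_step t p q rho : 0 < t -> time_interval T t ->
  chart_dom c p -> U (chart_map c p, t) ->
  chart_dom c' q -> U' (chart_map c' q, t) ->
  (forall p' q', sep t p q <= sep t p' q') ->
  rho != 0 ->
  (kappa * H t p) *: (F q t - F p t) + nu t p = rho *: nu t q ->
  exists r (psi' : R), [/\ is_derive (0 : R) 1 r psi',
    \forall s \near (0 : R), r s = sep (t + s) p q &
    kappa * H t p * dot (F q t - F p t) (F q t - F p t) + sep t p q *
      (\tr (weingarten space_dir g N (chart_map c p, t) *m
           (weingarten space_dir g N (chart_map c p, t))^T) + 1 / 2 +
       2 * (kappa * H t p) *
         (kappa * dot (frame_grad space_dir g phi (chart_map c p, t))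
                      (F q t - F p t)) / rho ^+ 2) <= psi'].
Proof.
move=> t0 tT cp Up cq Uq hmin rho0 hrho.
have P := fields_patch hF sgH lf; have P' := fields_patch hF sgH lf'.
set z : spacetime R n := (chart_map c p, t).
set w : spacetime R n := (chart_map c' q, t).
have Wz : patch_dom T c U z.
  by split; last exact: (proj2 tT); split => //; split => //; exact: chart_map_dom.
have Ww : patch_dom T c' U' w.
  by split; last exact: (proj2 tT); split => //; split => //; exact: chart_map_dom.
have [Uz cz _] := patch_dom_time Wz; have [Uw cw _] := patch_dom_time Ww.
have gz : g z = F p t by rewrite (fields_g lf Uz cz tT) chart_mapK.
have gw : g' w = F q t by rewrite (fields_g lf' Uw cw tT) chart_mapK.
have Nz : N z = nu t p by rewrite (fields_N lf Uz cz tT) chart_mapK.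
have Nw : N' w = nu t q by rewrite (fields_N lf' Uw cw tT) chart_mapK.
have phiz : phi z = H t p by rewrite (fields_phi lf Uz cz tT) chart_mapK.
have tpE : two_point g N g' phi kappa z w = sep t p q.
  by rewrite (two_point_separation Wz Ww) !chart_mapK.
have hmin' a b : \forall s \near (0 : R), two_point g N g' phi kappa z w <=
    two_point g N g' phi kappa (z + s *: space_dir a) (w + s *: space_dir b).
  have n1 := near_line (space_dir a) (patch_open P) Wz.
  have n2 := near_line (space_dir b) (patch_open P') Ww.
  have lineE (v : 'rV[R]_n) (x : 'rV[R]_n) (s : R) :
      ((x, t) : spacetime R n) + s *: space_dir v = (x + s *: v, t).
    rewrite [LHS]surjective_pairing; congr (_, _).
    by rewrite /= scaler0 addr0.
  apply: (@filterS2 _ (nbhs (0 : R)) _ _ _ _ _ n1 n2) => s.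
  rewrite !lineE tpE => W1 W2.
  by rewrite (two_point_separation W1 W2); exact: hmin.
have hrho' : (kappa * phi z) *: (g' w - g z) + N z = rho *: N' w.
  by rewrite gz gw Nz Nw phiz.
have ineq := two_point_inequality P P' Wz Ww hmin' rho0 hrho'.
have der := derive_two_point_time P P' Wz Ww kappa.
rewrite tpE gz gw phiz in ineq.
rewrite gz gw phiz in der.
exists (fun s => two_point g N g' phi kappa (z + s *: time_dir)
  (w + s *: time_dir)).
eexists; split; [exact: der| |exact: ineq].
have n1 := near_line time_dir (patch_open P) Wz.
have n2 := near_line time_dir (patch_open P') Ww.
have lineE (x : 'rV[R]_n) (s : R) :
    ((x, t) : spacetime R n) + s *: time_dir = (x, t + s).
  rewrite [LHS]surjective_pairing; congr (_, _); rewrite /= ?scaler0 ?addr0//.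
  by congr (_ + _); exact: mulr1.
apply: (@filterS2 _ (nbhs (0 : R)) _ _ _ _ _ n1 n2) => s.
rewrite !lineE => W1 W2.
by rewrite (two_point_separation W1 W2) !chart_mapK.
Qed.

End Step.

End Preservation.

Section Conclusion.
Context {R : realType} {n : nat} {M : closedManifold R n}.
Context (T : \bar R) (F : M -> R -> 'rV[R]_n.+1) (hF : rescaled_MCF T F).
Context (sg : R) (hsg : sg = 1 \/ sg = -1).
Hypothesis sgH : forall t, time_interval T t ->
  forall p, 0 < sg * rescaled_mean_curvature (F ^~ t) p.
Context (delta : R) (delta0 : 0 < delta).

Local Notation H t p := (rescaled_mean_curvature (F ^~ t) p).
Local Notation nu t p := (unit_normal (F ^~ t) p).
Local Notation kappa := (sg / delta).
Local Notation sep t p q := (separation kappa (F ^~ t) p q).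

(** Bounds the gradient term of the coefficient, for A = kappa, Kd = <K, d>, r2 = rho^2: Young's
    inequality controls 2 |<K, d>|, and 1/rho^2 is at most 2. *)
Lemma reaction_bound (k A Kd KK D B B2 Bk r2 : R) : 0 <= k -> k <= Bk ->
  `|Kd| *+ 2 <= KK + D -> KK <= B -> D <= B2 -> 1 / 2 <= r2 ->
  2 * k * (A * Kd) / r2 <= 2 * Bk * `|A| * (B + B2).
Proof.
move=> k0 kB hKd hK hD hr.
have r0 : 0 < r2 by apply: lt_le_trans hr; rewrite divr_gt0.
have hS : `|Kd| *+ 2 <= B + B2 by apply: (le_trans hKd); exact: lerD.
have S0 : 0 <= B + B2 by apply: le_trans hS; rewrite mulrn_wge0.
rewrite ler_pdivrMr//.
have h1 : 2 * k * (A * Kd) <= Bk * `|A| * (B + B2).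
  apply: (@le_trans _ _ (Bk * `|A| * (`|Kd| *+ 2))); last first.
    by rewrite ler_wpM2l// mulr_ge0// (le_trans k0).
  rewrite (mulrC 2) -!mulrA.
  apply: (@le_trans _ _ (k * (`|A| * (`|Kd| *+ 2)))).
    rewrite ler_wpM2l//; rewrite -(mulr_natl `|Kd| 2) [leRHS]mulrCA ler_pM2l//.
    by rewrite -normrM ler_norm.
  by rewrite ler_wpM2r// mulr_ge0// mulrn_wge0.
apply: (le_trans h1).
have -> : 2 * Bk * `|A| * (B + B2) * r2 = Bk * `|A| * (B + B2) * (2 * r2).
  by ring.
rewrite ler_peMr//.
  by rewrite !mulr_ge0// (le_trans k0).
by rewrite -ler_pdivrMl// mulrC.
Qed.

Lemma dot_young m (u v : 'rV[R]_m) : `|dot u v| *+ 2 <= dot u u + dot v v.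
Proof.
have h1 := dot_ge0 (u - v); have h2 := dot_ge0 (u + v).
rewrite dotBl !dotBr (dotC v u) in h1; rewrite dotDl !dotDr (dotC v u) in h2.
rewrite mulr2n; case: (ler0P (dot u v)) => _; lra.
Qed.

Lemma separation_preserved t1 : time_interval T t1 ->
  (forall p q, 0 <= sep 0 p q) -> forall p q, 0 <= sep t1 p q.
Proof.
move=> t1T init p1 q1.
have [t10 _] := t1T.
have H0 t p : time_interval T t -> H t p != 0.
  by move=> /sgH/(_ p)/lt0r_neq0; rewrite mulf_eq0 negb_or => /andP[].
have k0 t p : time_interval T t -> 0 < kappa * H t p.
  by move=> tT; rewrite mulrAC divr_gt0// sgH.
have compact_K3 := @compact_pairs_itv R n M 0 t1.
have in_K3 p q s : 0 <= s <= t1 -> ([set: M * M] `*` `[0, t1]) ((p, q), s).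
  by move=> s01; split => //=; rewrite in_itv.
have [B hB] := fields_bound hF hsg sgH t1T.
have [B2 B20 hB2] := continuous_compact_bound compact_K3
  (fun x => cvg_dot (@continuous_clip_diff _ _ _ _ _ hF _ hsg sgH _ t1T x)
                    (@continuous_clip_diff _ _ _ _ _ hF _ hsg sgH _ t1T x)).
have [Bk Bk0 hBk] := continuous_compact_bound compact_K3
  (fun x => cvgM (cvg_cst kappa)
    (@continuous_clip_H_left _ _ _ _ _ hF _ hsg sgH _ t1T x)).
have [s0 s00 orient] := orientation_gap hF hsg sgH t1T delta0.
rewrite leNgt; apply/negP => neg.
(* All but the last summand bound the coefficient of psi; the final 1 makes the contradiction
   strict. *)
pose C := `|B| + 1 / 2 + 2 * Bk * `|kappa| * (`|B| + B2) + 1.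
have C0 : 0 <= C by rewrite !addr_ge0// !mulr_ge0// addr_ge0.
(* The bounds on the perturbation serve in turn to apply [orientation_gap], to get k m <= 1/2 and
   hence rho^2 >= 1/2, and to keep h nonpositive at (p1, q1, t1). *)
pose m := Num.min (s0 / 2) (Num.min (1 / (2 * (Bk + 1))) (- sep t1 p1 q1)).
have Bk1 : 0 < 2 * (Bk + 1) by rewrite mulr_gt0// ltr_wpDl.
have m0 : 0 < m by rewrite !lt_min !divr_gt0//= oppr_gt0.
(* Normalized so that the perturbation reaches m exactly at t1. *)
pose eta := m / expR (C * t1).
have eta0 : 0 < eta by rewrite divr_gt0// expR_gt0.
pose h (x : (M * M) * R) :=
  separation kappa (F ^~ (clip t1 x.2)) x.1.1 x.1.2 + eta * expR (C * x.2).
have hE p q s : 0 <= s <= t1 -> h ((p, q), s) = sep s p q + eta * expR (C * s).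
  by move=> s01; rewrite /h /= clip_id.
have ch : continuous h.
  move=> x; apply: cvgD.
    exact: (@continuous_clip_separation _ _ _ _ _ hF _ hsg sgH _ t1T kappa x).
  apply: cvgM; first exact: cvg_cst.
  apply: (@cvg_comp _ _ _ (fun y : (M * M) * R => C * y.2) expR (nbhs x)
    (nbhs (C * x.2))); last exact: continuous_expR.
  by apply: cvgM; [exact: cvg_cst|exact: cvg_snd].
have etam t : t <= t1 -> eta * expR (C * t) <= m.
  move=> tt1; rewrite /eta mulrAC ler_pdivrMr ?expR_gt0// ler_pM2l//.
  by rewrite ler_expR ler_wpM2l.
have [||p [q [t [/andP[t0 tt1] ht hge hpos]]]] := @first_zero R n M t1 h ch.
- move=> p q; rewrite hE ?lexx//; apply: ltr_wpDl; first exact: init.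
  by rewrite mulr_gt0// expR_gt0.
- exists ((p1, q1), t1); first by apply: in_K3; rewrite t10 lexx.
  rewrite hE ?t10 ?lexx//; apply: (@le_trans _ _ (sep t1 p1 q1 + m)).
    by rewrite lerD2l etam.
  by rewrite -lerBrDl sub0r /m !ge_min lexx !orbT.
have t01 : 0 <= t <= t1 by rewrite ltW.
have tT : time_interval T t := itv_time t1T t01.
pose E := eta * expR (C * t).
have E0 : 0 < E by rewrite mulr_gt0// expR_gt0.
have Em : E <= m by exact: etam.
have sepE : sep t p q = - E.
  by apply/eqP; rewrite -addr_eq0 -hE// ht.
have smin p' q' : sep t p q <= sep t p' q'.
  by rewrite sepE -subr_ge0 opprK -hE.
pose k := kappa * H t p; pose d := F q t - F p t.
pose rho := dot (k *: d + nu t p) (nu t q).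
have rho0 : 0 < rho.
  apply: (orient t p q t01 (fun r => smin p r)).
  rewrite sepE ltrN2; apply: (le_lt_trans Em).
  by rewrite gt_min ltr_pdivrMr// ltr_pMr// ltr1n.
have normE : k *: d + nu t p = rho *: nu t q.
  by apply: (normal_at_min hF sgH delta0 tT) => r; exact: smin.
have kB : k <= Bk by have := hBk _ (in_K3 p q t t01); rewrite /= clip_id.
have dB : dot d d <= B2 by have := hB2 _ (in_K3 p q t t01); rewrite /= clip_id.
(* Squaring [normE] gives rho^2 = 1 + k psi with psi = -E. *)
have rho2 : 1 / 2 <= rho ^+ 2.
  have -> : rho ^+ 2 = 1 + k * sep t p q.
    have <- : dot (k *: d + nu t p) (k *: d + nu t p) = rho ^+ 2.
      by rewrite normE dotZl dotZr (dot_unit_normal (H0 t q tT)) mulr1 expr2.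
    rewrite dotDl !dotDr !dotZl !dotZr (dot_unit_normal (H0 t p tT)).
    by rewrite (dotC (nu t p)) /separation -/k -/d; ring.
  rewrite sepE mulrN lerBrDr -lerBrDl.
  have -> : 1 - 1 / 2 = 1 / 2 :> R by field.
  apply: (@le_trans _ _ (Bk * (1 / (2 * (Bk + 1))))).
    apply: ler_pM => //; [exact: ltW (k0 _ _ tT)|exact: ltW|].
    by apply: (le_trans Em); rewrite /m !ge_min lexx orbT.
  rewrite mulrA mulr1 ler_pdivrMr// mulrA mul1r mulVf// mul1r.
  by rewrite lerDl.
have [c [U [g [N [phi [lf cp Up hS hK]]]]]] := hB p t t01.
have [c' [U' [g' [N' [phi' [lf' cq Uq _ _]]]]]] := hB q t t01.
have [r [psi' [dr rE ineq]]] := separation_step hF sgH lf lf' t0 tT cp Up cq Uq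
  smin (lt0r_neq0 rho0) normE.
have dexp : is_derive (0 : R) 1 (fun s : R => expR (C * (t + s)))
    (C * expR (C * t)).
  have d1 : is_derive (0 : R) 1 (fun s : R => C * (t + s)) C.
    apply: (@is_derive_eq _ _ _ _ _ _ _ _ (is_deriveZ C
      (is_deriveD (is_derive_cst t (0 : R) 1) (is_derive_id (0 : R) 1)))).
    by rewrite add0r; exact: mulr1.
  have d2 : is_derive (C * (t + 0)) 1 (@expR R) (expR (C * (t + 0))).
    exact: is_derive_expR.
  have [d3 d4] := @is_derive1_comp R expR (fun s => C * (t + s)) 0 _ _ d2 d1.
  apply: DeriveDef; first exact: d3.
  by apply: (etrans d4); rewrite addr0 mulrC.
have dtot := is_deriveD dr (is_deriveZ eta dexp).
have r0 : r 0 = - E by rewrite (nbhs_singleton rE) addr0.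
have dle : psi' + eta * (C * expR (C * t)) <= 0.
  apply: (derive_at_left_min dtot).
  (* Keeps t + s nonnegative, where h is known to be positive before t. *)
  have near_t : \forall s \near (0 : R), `|s| < t.
    apply/nbhs_ballP; exists t => //= s.
    by rewrite /ball /= sub0r normrN.
  apply: (@filterS2 _ (nbhs (0 : R)) _ _ _ _ _ rE near_t) => s rs st sneg.
  rewrite !fctE r0 rs.
  change (- E + eta * expR (C * (t + 0)) <=
    sep (t + s) p q + eta * expR (C * (t + s))).
  rewrite addr0 -/E addNr.
  have ts : 0 <= t + s < t.
    rewrite ltr0_norm// in st.
    by rewrite gtrDl sneg andbT -[s in t + s]opprK subr_ge0 ltW.
  have := hpos p q (t + s) ts.
  rewrite hE; first exact: ltW.
  by case/andP: ts => -> /ltW/le_trans; apply.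
have EC : eta * (C * expR (C * t)) = C * E by rewrite mulrCA.
rewrite EC in dle.
have Q : \tr (weingarten space_dir g N (chart_map c p, t) *m
           (weingarten space_dir g N (chart_map c p, t))^T) + 1 / 2 +
       2 * k * (kappa * dot (frame_grad space_dir g phi (chart_map c p, t)) d) /
         rho ^+ 2 <= C - 1.
  rewrite /C addrK; apply: lerD.
    by rewrite lerD2r (le_trans hS)// ler_norm.
  have hK' := le_trans hK (ler_norm B).
  exact: (@reaction_bound k kappa _ _ _ `|B| B2 Bk (rho ^+ 2) (ltW (k0 t p tT)) kB
    (dot_young _ d) hK' dB rho2).
have kD : 0 <= k * dot d d by rewrite mulr_ge0 ?dot_ge0// ltW// k0.
rewrite -/k -/d sepE in ineq.
move: ineq Q; move: (_ + _ / rho ^+ 2) => q0 ineq Q.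
(* Now psi' >= k |d|^2 - E q0 >= k |d|^2 - C E + E, so psi' + C E >= E > 0, against [dle]. *)
have hq : E * q0 <= E * (C - 1) by rewrite ler_pM2l.
have : 0 < E by [].
rewrite mulrBr mulr1 in hq; rewrite mulNr in ineq.
move: (E * q0) (E * C) (C * E) (mulrC E C) hq ineq dle kD => a b b' ->.
move: (k * dot d d) => f; lra.
Qed.

End Conclusion.

Unset Implicit Arguments.

Theorem theorem1p3 (R : realType) (n : nat) (hn : (0 < n)%N)
  (M : closedManifold R n) (T : \bar R) (hT : (0 < T)%E)
  (F : M -> R -> 'rV[R]_n.+1) (hF : rescaled_MCF T F)
  (delta : R) (hdelta : 0 < delta) :
  ((forall t, time_interval T t -> rescaled_mean_convex (F ^~ t)) ->
   rescaled_noncollapsed delta (F ^~ 0) ->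
   forall t, time_interval T t -> rescaled_noncollapsed delta (F ^~ t)) /\
  ((forall t, time_interval T t -> rescaled_mean_concave (F ^~ t)) ->
   rescaled_noncollapsed (- delta) (F ^~ 0) ->
   forall t, time_interval T t -> rescaled_noncollapsed (- delta) (F ^~ t)).
Proof.
have T0 : time_interval T 0 by split.
have [_ emb _] := hF.
(* The convex and the concave case are the instances sg = 1 and sg = -1. *)
have main sg : sg = 1 \/ sg = -1 ->
    (forall t, time_interval T t ->
      forall p, 0 < sg * rescaled_mean_curvature (F ^~ t) p) ->
    rescaled_noncollapsed (sg * delta) (F ^~ 0) ->
    forall t, time_interval T t -> rescaled_noncollapsed (sg * delta) (F ^~ t).
  move=> hsg sgH /(noncollapsed_separation (emb 0 T0) hsg hdelta (sgH 0 T0)) h t tT.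
  apply/(noncollapsed_separation (emb t tT) hsg hdelta (sgH t tT)).
  exact: (separation_preserved hF hsg sgH hdelta tT h).
split=> hH h0.
  have := main 1 (or_introl erefl); rewrite !mul1r; apply=> // t tT p.
  by rewrite mul1r; exact: hH.
have := main (-1) (or_intror erefl); rewrite !mulN1r; apply=> // t tT p.
by rewrite mulN1r oppr_gt0; exact: hH.
Qed.
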